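(* Let $s\in(0,1)$ and $p>1$. Let $\Omega\subset\mathbb{R}^d$, $d\ge 2$, be a bounded Lipschitz domain, and let $K\subset\Omega$ be a compact set of codimension $k$ of class $C^{0,1}$, where $1<k\le d$, $k\in\mathbb{N}$; when $k=d$, assume that $0\in\Omega$ and $K=\{0\}$. Assume that $sp=k$, that $\delta_K(x)<R$ for all $x\in\Omega$, for some $R>0$, and that $\alpha=d+(k-d)\frac{\tau}{p}$. Then the fractional Hardy-type inequality $$\left(\int_\Omega \frac{|u(x)|^\tau}{\delta_K^\alpha(x)\,\ln^\beta\!\left(\frac{2R}{\delta_K(x)}\right)}\,dx\right)^{\frac1\tau}\le C\left(\int_\Omega\int_\Omega\frac{|u(x)-u(y)|^p}{|x-y|^{d+sp}}\,dx\,dy+\int_\Omega|u(x)|^p\,dx\right)^{\frac1p}\quad\text{for all }u\in W^{s,p}_0(\Omega\setminus K),$$ where $C=C(d,p,s,\tau,R,K,\Omega)>0$, holds in each of the following cases: (1) if $1<k<d$ and $\tau=p$, then $\beta=p$; (2) if $1<k<d$ and $\tau\in\left(p,\frac{dp+1}{1-(k-d)}\right]$, then $\beta=\tau-1$; (3) if $1<k<d$ and $\tau\in\left(\frac{dp+1}{1-(k-d)},p_s^*\right]$, then $\beta=dp+(k-d)\tau$; (4) if $k=d$ and $\tau\ge p$, then $\beta=\tau$. The weight function is optimal for the case $\tau=p$.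
   Context: Notation: $\delta_K(x)=\inf_{y\in K}|x-y|$; $\ln^\beta(t)=(\ln t)^\beta$; for $sp<d$, $p_s^*=\frac{dp}{d-sp}$; $(u)_\Omega=\frac1{|\Omega|}\int_\Omega u(x)\,dx$. $[u]^p_{W^{s,p}(\Omega)}=\int_\Omega\int_\Omega\frac{|u(x)-u(y)|^p}{|x-y|^{d+sp}}\,dx\,dy$; $W^{s,p}(\Omega)$ is the space of $u\in L^p(\Omega)$ with $[u]_{W^{s,p}(\Omega)}<\infty$, with norm $\|u\|_{W^{s,p}(\Omega)}=\left([u]^p_{W^{s,p}(\Omega)}+\|u\|^p_{L^p(\Omega)}\right)^{1/p}$. $W^{s,p}_0(\Omega\setminus K)$ is the closure, with respect to $\|\cdot\|_{W^{s,p}(\Omega)}$, of the set of $u\in W^{s,p}(\Omega)\cap C(\Omega)$ that vanish in a neighbourhood of $K$. Class $C^{0,1}$ (for $1<k<d$): a compact surface $K$ of codimension $k$ in $\mathbb{R}^d$ is of class $C^{0,1}$ if there is $C>0$ such that for every $x\in K$ there exist a ball $B=B_r(x)\subset\mathbb{R}^d$, $r>0$, and an isomorphism $T:Q\to B$, with $Q=B_1^k(0)\times(0,1)^{d-k}$ and $B_1^k(0)$ the unit ball of $\mathbb{R}^k$ centered at $0$, such that $T\in C^{0,1}(\overline Q)$, $T^{-1}\in C^{0,1}(\overline B)$ (Lipschitz), $\|T\|_{C^{0,1}(\overline Q)}+\|T^{-1}\|_{C^{0,1}(\overline B)}\le C$, and, writing $\xi=(\xi_k,\xi_{d-k})\in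 Q$ with $\xi_k\in B_1^k(0)$, $\xi_{d-k}\in(0,1)^{d-k}$, one has $T^{-1}(B\cap K)=\{\xi\in Q:\xi_k=0\}$. It is also assumed that for any $y=T((\xi_k,\xi_{d-k}))\in(\Omega\setminus K)\cap B$ one has $C_1|\xi_k|\le\delta_K(y)\le C_2|\xi_k|$ for some $C_1,C_2>0$ very close to $1$. On the word ''optimal'': the paper gives no formal definition. Its optimality argument, written for $1<k<d$ and $\tau=p$, treats the flat model $\Omega=B_1^k(0)\times(0,1)^{d-k}$, $K=\{x=(x_k,x_{d-k})\in\mathbb{R}^d:x_k=0,\ x_{d-k}\in[0,1]^{d-k}\}$. There it derives a contradiction from the existence of a function $f$ with $f(x_k)\to\infty$ as $|x_k|\to0$ such that $\int_\Omega\frac{|f(x_k)||u(x)-(u)_\Omega|^p}{|x_k|^k\ln^p(2/|x_k|)}\,dx\le[u]^p_{W^{s,p}(\Omega)}$ for all $u\in W^{s,p}_0(\Omega\setminus K)$. It says that the case of a general domain follows by patching. *)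

(* Defs.v *)
From HB Require Import structures.
From mathcomp Require Import all_boot all_order all_algebra.
From mathcomp Require Import all_classical all_reals all_analysis.

Set Warnings "-redundant-canonical-projection".

Set Implicit Arguments.
Unset Strict Implicit.
Unset Printing Implicit Defensive.

Import Order.TTheory GRing.Theory Num.Theory.
Import numFieldNormedType.Exports.

Local Open Scope classical_set_scope.
Local Open Scope ring_scope.

(* R^d is 'rV[R]_d with its product topology.  The norm `|x| on 'rV[R]_d is the
   sup norm; the Euclidean norm is enorm below. *)

Section borel_rV.
Context {R : realType} {n : nat}.

Definition rV_coord (i : 'I_n) (x : 'rV[R]_n) : R := x 0 i.

Let rV_set0 : g_sigma_preimage rV_coord set0.
Proof. exact: sigma_algebra0. Qed.

Let rV_setC A : g_sigma_preimage rV_coord A -> g_sigma_preimage rV_coord (~` A).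
Proof. exact: sigma_algebraC. Qed.

Let rV_bigcup (F : _^nat) : (forall i, g_sigma_preimage rV_coord (F i)) ->
  g_sigma_preimage rV_coord (\bigcup_i (F i)).
Proof. exact: sigma_algebra_bigcup. Qed.

(* Generated by the coordinates, hence the Borel sigma-algebra of R^n. *)
HB.instance Definition _ := @isMeasurable.Build default_measure_display
  'rV[R]_n (g_sigma_preimage rV_coord) rV_set0 rV_setC rV_bigcup.

End borel_rV.

Lemma measurable_rV_coord (R : realType) n (i : 'I_n) :
  measurable_fun [set: 'rV[R]_n] (rV_coord i).
Proof.
move=> _ Y mY; rewrite setTI; apply: sub_sigma_algebra => /=.
rewrite -bigcup_seq/=; exists i => /=; first by rewrite mem_index_enum.
by exists Y => //; rewrite setTI.
Qed.

Lemma measurable_fun_rVP (R : realType) d (T : measurableType d) n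
    (f : T -> 'rV[R]_n) :
  (forall i, measurable_fun [set: T] (rV_coord i \o f)) ->
  measurable_fun [set: T] f.
Proof.
move=> mf.
apply: (measurability
  (\big[setU/set0]_(i < n) preimage_set_system setT (@rV_coord R n i) measurable)).
  by [].
move=> _ [B + <-]; rewrite -bigcup_seq => -[i _ [C mC <-]].
by rewrite !setTI -comp_preimage -[X in measurable X]setTI; exact: mf.
Qed.

Section lebesgue_rV.
Context {R : realType}.

Definition rV_cons n (z : measurableTypeR R * 'rV[R]_n) : 'rV[R]_n.+1 :=
  row_mx z.1%:M z.2 : 'rV[R]_(1 + n).

Lemma rV_cons0 n z : rV_cons (n := n) z 0 ord0 = z.1.
Proof.
rewrite /rV_cons mxE; case: splitP => [j _|j /= j0]; first by rewrite !mxE !ord1 eqxx.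
by have := erefl 0%N; rewrite {1}j0.
Qed.

Lemma rV_consS n z (i : 'I_n) : rV_cons z 0 (lift ord0 i) = z.2 0 i.
Proof.
rewrite /rV_cons mxE; case: splitP => [j|j /= ji]; first by rewrite ord1.
by congr (z.2 0 _); apply/val_inj; case: ji.
Qed.

Lemma measurable_rV_cons n : measurable_fun setT (@rV_cons n).
Proof.
apply: measurable_fun_rVP => i.
have [j ->|->] := unliftP ord0 i.
  rewrite (_ : _ \o _ = rV_coord j \o snd); last first.
    by apply/funext => z /=; rewrite /rV_coord rV_consS.
  by apply: measurableT_comp => //; exact: measurable_rV_coord.
rewrite (_ : _ \o _ = fst); last first.
  by apply/funext => z /=; rewrite /rV_coord rV_cons0.
exact: measurable_fst.
Qed.

Definition rV_uncons n (x : 'rV[R]_n.+1) : measurableTypeR R * 'rV[R]_n :=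
  (x 0 ord0, \row_i x 0 (lift ord0 i)).

Lemma measurable_rV_uncons n : measurable_fun setT (@rV_uncons n).
Proof.
apply: measurable_fun_pair; first exact: (measurable_rV_coord ord0).
apply: measurable_fun_rVP => i.
rewrite (_ : _ \o _ = rV_coord (lift ord0 i)); last first.
  by apply/funext => z /=; rewrite /rV_coord mxE.
exact: measurable_rV_coord.
Qed.

Lemma rV_consK n : cancel (@rV_cons n) (@rV_uncons n).
Proof.
move=> [a v]; rewrite /rV_uncons rV_cons0 /=; congr pair.
by apply/rowP => i; rewrite mxE rV_consS.
Qed.

Lemma rV_unconsK n : cancel (@rV_uncons n) (@rV_cons n).
Proof.
move=> x; apply/rowP => i.
by have [j ->|->] := unliftP ord0 i; rewrite ?rV_consS ?rV_cons0 ?mxE.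
Qed.

Section step.
Variables (n : nat) (m : {sigma_finite_measure set 'rV[R]_n -> \bar R}).

Definition lebesgue_step : set 'rV[R]_n.+1 -> \bar R :=
  pushforward (@lebesgue_measure R \x m)%E (@rV_cons n).

HB.instance Definition _ := Measure.copy lebesgue_step
  (measure_function_pushforward__canonical__measure_function_Measure
     (@lebesgue_measure R \x m)%E (@measurable_rV_cons n)).

Let lebesgue_step_sigma_finite : sigma_finite setT lebesgue_step.
Proof.
have /sigma_finiteP[F [TF ndF Foo]] := sigma_finiteT (@lebesgue_measure R).
have /sigma_finiteP[G [TG ndG Goo]] := sigma_finiteT m.
exists (fun k => rV_uncons (n := n) @^-1` (F k `*` G k)).
  rewrite -preimage_bigcup (_ : \bigcup_k _ = setT) ?preimage_setT//.
  apply/seteqP; split=> // -[x y] _.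
  have [i _ Fx] : (\bigcup_k F k) x by rewrite -TF.
  have [j _ Gy] : (\bigcup_k G k) y by rewrite -TG.
  exists (maxn i j) => //; split => /=.
    by move: x Fx; exact/subsetPset/ndF/leq_maxl.
  by move: y Gy; exact/subsetPset/ndG/leq_maxr.
move=> k; have [mF Fk] := Foo k; have [mG Gk] := Goo k; split.
  rewrite -[X in measurable X]setTI; apply: measurable_rV_uncons => //.
  exact: measurableX.
rewrite /lebesgue_step /pushforward -comp_preimage.
rewrite (_ : _ \o _ = id); last by apply/funext => z; exact: rV_consK.
by rewrite preimage_id product_measure1E// lte_mul_pinfty// ge0_fin_numE.
Qed.

HB.instance Definition _ := Measure_isSigmaFinite.Build _ _ _ lebesgue_step
  lebesgue_step_sigma_finite.

End step.

(* The n-dimensional Lebesgue measure, as an iterated product of the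
   one-dimensional one; lebesgue_rV_box is its defining property. *)
Fixpoint lebesgue_rV n : {sigma_finite_measure set 'rV[R]_n -> \bar R} :=
  if n is n'.+1 then lebesgue_step (lebesgue_rV n') else \d_(0 : 'rV[R]_0).

Lemma lebesgue_rV_prod n (A : 'I_n -> set R) :
  (forall i, measurable (A i)) ->
  lebesgue_rV n [set x : 'rV[R]_n | forall i, A i (x 0 i)] =
  (\prod_(i < n) @lebesgue_measure R (A i))%E.
Proof.
elim: n A => [|n IH] A mA.
  by rewrite big_ord0 /= diracE mem_set// => -[].
pose B := [set x : 'rV[R]_n | forall i, A (lift ord0 i) (x 0 i)].
have mB : measurable B.
  rewrite (_ : B = \bigcap_i (rV_coord i @^-1` A (lift ord0 i))).
    apply: fin_bigcap_measurable => // i _.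
    by rewrite -[X in measurable X]setTI; exact: measurable_rV_coord.
  by apply/seteqP; split=> [x Bx i _|x Bx i]; exact: Bx.
have E : @rV_cons n @^-1` [set x : 'rV[R]_n.+1 | forall i, A i (x 0 i)] = A ord0 `*` B.
  apply/seteqP; split=> [z Az|z [/= A0 AS] i].
    split=> /= [|i]; first by have := Az ord0; rewrite rV_cons0.
    by have := Az (lift ord0 i); rewrite rV_consS.
  by have [j ->|->] := unliftP ord0 i; rewrite ?rV_consS ?rV_cons0.
rewrite big_ord_recl -(IH (fun i => A (lift ord0 i)))//.
transitivity ((@lebesgue_measure R \x lebesgue_rV n)%E (A ord0 `*` B)).
  by rewrite -E.
by apply: (product_measure1E (@lebesgue_measure R)); [exact: (mA ord0)|exact: mB].
Qed.

Lemma lebesgue_rV_box n (a b : 'rV[R]_n) : (forall i, a 0 i <= b 0 i) ->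
  lebesgue_rV n [set x : 'rV[R]_n | forall i, a 0 i <= x 0 i <= b 0 i] =
  (\prod_(i < n) (b 0 i - a 0 i))%:E.
Proof.
move=> ab.
have -> : [set x : 'rV[R]_n | forall i, a 0 i <= x 0 i <= b 0 i] =
    [set x : 'rV[R]_n | forall i, `[a 0 i, b 0 i]%classic (x 0 i)].
  by apply/seteqP; split=> x /= + i => /(_ i); rewrite in_itv.
rewrite (lebesgue_rV_prod (A := fun i => `[a 0 i, b 0 i]%classic))// -prodEFin; apply: eq_bigr => i _.
rewrite lebesgue_measure_itv/= lte_fin; case: ltP => // ba.
by have -> : a 0 i = b 0 i; [apply/le_anti; rewrite ab ba|rewrite subrr].
Qed.

End lebesgue_rV.

Section geometry.
Context {R : realType} {d : nat}.
Implicit Types (x y xi : 'rV[R]_d) (Omega K : set 'rV[R]_d).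

Definition enorm n (x : 'rV[R]_n) : R := Num.sqrt (\sum_i x 0 i ^+ 2).

Definition eball x (r : R) : set 'rV[R]_d := [set y | enorm (y - x) < r].

Definition edistance K x : R := inf [set enorm (x - y) | y in K].

(* After an orthogonal change of coordinates, Omega is near each boundary point
   the part of space above the graph of a Lipschitz function. *)
Definition bounded_lipschitz_domain Omega : Prop :=
  [/\ open Omega, connected Omega, bounded_set Omega &
    forall x, (closure Omega `\` Omega) x ->
      exists (r : R) (A : 'M[R]_d) (j : 'I_d) (g : 'rV[R]_d.-1 -> R),
        [/\ 0 < r, A *m A^T = 1%:M, [lipschitz g z | z in setT] &
          forall y, eball x r y ->
            Omega y <-> g (col' j (y *m A)) < (y *m A) 0 j]].

(* The norm sup |f| + (Lipschitz constant of f) of C^{0,1}(A); the diagonal of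
   A x A contributes the quotient 0 / 0 = 0. *)
Definition C01_norm m n (A : set 'rV[R]_m) (f : 'rV[R]_m -> 'rV[R]_n) : \bar R :=
  (ereal_sup [set (enorm (f x))%:E | x in A] +
   ereal_sup [set (enorm (f z.1 - f z.2) / enorm (z.1 - z.2))%:E
             | z in A `*` A])%E.

(* |xi_k|, where xi_k is made of the first k coordinates of xi. *)
Definition normal_norm (k : nat) xi : R :=
  Num.sqrt (\sum_(i < d | (i < k)%N) xi 0 i ^+ 2).

(* Q = B_1^k(0) x (0,1)^(d-k). *)
Definition flat_cylinder (k : nat) : set 'rV[R]_d :=
  [set xi | normal_norm k xi < 1 /\
            forall i : 'I_d, (k <= i)%N -> 0 < xi 0 i < 1].

(* Compact surface of codimension k and class C^{0,1} in the ambient Omega.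
   S is the inverse of the chart T.  The last clause is required with some
   positive constants C1, C2, whatever their size. *)
Definition C01_surface Omega (k : nat) K : Prop :=
  [/\ compact K, K !=set0 &
    exists2 C : R, 0 < C & forall x, K x ->
      exists (r : R) (T S : 'rV[R]_d -> 'rV[R]_d),
        let Q := flat_cylinder k in
        let B := eball x r in
        [/\ 0 < r,
            set_bij Q B T /\ (forall xi, Q xi -> S (T xi) = xi),
            (C01_norm (closure Q) T + C01_norm (closure B) S <= C%:E)%E,
            S @` (B `&` K) = [set xi | Q xi /\ normal_norm k xi = 0] &
            exists C1 C2 : R, [/\ 0 < C1, 0 < C2 &
              forall xi, Q xi -> (Omega `\` K) (T xi) ->
                C1 * normal_norm k xi <= edistance K (T xi)
                  <= C2 * normal_norm k xi]]].

End geometry.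

Section fractional_sobolev.
Context {R : realType} {d : nat}.
Implicit Types (s p : R) (u v f w : 'rV[R]_d -> R) (Omega K : set 'rV[R]_d).
Local Notation mu := (lebesgue_rV (R := R) d).

(* The p-th power of the seminorm [u]_{W^{s,p}(Omega)}. *)
Definition gagliardo s p Omega u : \bar R :=
  \int[mu]_(x in Omega) \int[mu]_(y in Omega)
    ((`|u x - u y| `^ p) / (enorm (x - y) `^ (d%:R + s * p)))%:E.

(* Functions on Omega are total functions whose values outside Omega are
   irrelevant; Borel representatives are used. *)
Definition sobolev s p Omega : set ('rV[R]_d -> R) :=
  [set u : 'rV[R]_d -> R | [/\ measurable_fun Omega u,
               (\int[mu]_(x in Omega) (`|u x| `^ p)%:E < +oo)%E &
               (gagliardo s p Omega u < +oo)%E]].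

Definition sobolev_norm s p Omega u : \bar R :=
  ((gagliardo s p Omega u + \int[mu]_(x in Omega) (`|u x| `^ p)%:E)
     `^ p^-1)%E.

Definition sobolev_off s p Omega K : set ('rV[R]_d -> R) :=
  [set v : 'rV[R]_d -> R | [/\ sobolev s p Omega v, {within Omega, continuous v} &
    exists U : set 'rV[R]_d, [/\ open U, K `<=` U &
      forall x, (U `&` Omega) x -> v x = 0]]].

(* W^{s,p}_0(Omega \ K): the closure of sobolev_off in sobolev. *)
Definition sobolev0 s p Omega K : set ('rV[R]_d -> R) :=
  [set u : 'rV[R]_d -> R | sobolev s p Omega u /\
    forall e : R, 0 < e -> exists2 v, sobolev_off s p Omega K v &
      (sobolev_norm s p Omega (u \- v)%R < e%:E)%E].

(* On the null set K the value is the one given by the conventions of powR, ln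
   and ^-1 at 0. *)
Definition hardy_weight K (R0 alpha beta : R) (x : 'rV[R]_d) : R :=
  (edistance K x `^ alpha * ln (2 * R0 / edistance K x) `^ beta)^-1.

Definition average Omega u : R :=
  (fine (mu Omega))^-1 * \int[mu]_(x in Omega) u x.

Definition blows_up_at Omega K f : Prop :=
  forall M : R, exists2 r : R, 0 < r &
    forall x, (Omega `\` K) x -> edistance K x < r -> M < f x.

(* The weight w cannot be multiplied by any function that tends to infinity at
   K: neither the inequality with exponent tau = p nor its variant for
   u - (u)_Omega, with the seminorm on the right, survives. *)
Definition optimal_weight s p Omega K w : Prop :=
  ~ (exists f, [/\ measurable_fun Omega f, blows_up_at Omega K f &
      exists2 C : R, 0 < C & forall u, sobolev0 s p Omega K u ->
        ((\int[mu]_(x in Omega) (`|f x| * `|u x| `^ p * w x)%:E) `^ p^-1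
           <= C%:E * sobolev_norm s p Omega u)%E]) /\
  ~ (exists f, [/\ measurable_fun Omega f, blows_up_at Omega K f &
      exists2 C : R, 0 < C & forall u, sobolev0 s p Omega K u ->
        (\int[mu]_(x in Omega) (`|f x| * `|u x - average Omega u| `^ p * w x)%:E
           <= C%:E * gagliardo s p Omega u)%E]).

End fractional_sobolev.

(* Main.v *)
(** Two facts about the geometry suffice.  Omega is plump: near each of its
    points x and at every small scale r it contains a ball of radius comparable
    to r.  The tubes around K satisfy
      c t^k <= |{dist(., K) < t}| <= C t^k  and
      |{dist(., K) < t} /\ B(z, rho)| <= C t^k rho^(d - k)  for t <= rho.

    Inequality.  Telescoping the averages of u over the parts of Omega in rings
    of radii r_i = r0 theta^i around x bounds |u x|, for x in the shell
    r_(l+1) <= dist(x, K) < r_l, by the local energies of u at the scales r_i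
    with i < l; the scales i >= l are summed by Hedberg's trick.  A weak Hoelder
    inequality with weights h_i, Tonelli's theorem with the tube bounds on each
    shell, and a summation by parts in l give the result, with geometric h_i if
    alpha < k and with h_i = sqrt (i + 1) - sqrt i in the critical case
    alpha = k.

    Optimality.  Let u be the tent of height n ln b / 2 in the variable
    L = ln (rs / dist(., K)) over the interval 0 <= L <= n ln b.  Since the
    integral of ln (1 + |x - y| / a)^p / |x - y|^(d + k) in y is O(a^(-k)), the
    energy of u is O(n).  Each of the n / 4 shells around L = 3 n ln b / 8
    contributes at least a constant to the integral of |u|^p w, hence n M times
    a constant to that of |f| |u|^p w where |f| >= M; the average of u is too
    small to change this. *)

Require Import Defs.
From mathcomp Require Import all_boot all_order all_algebra.
From mathcomp Require Import all_classical all_reals all_analysis.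
From mathcomp Require Import measurable_realfun.
From mathcomp Require Import ring lra.

Set Implicit Arguments.
Unset Strict Implicit.
Unset Printing Implicit Defensive.

Import Order.TTheory GRing.Theory Num.Theory.
Import numFieldNormedType.Exports.

Local Open Scope classical_set_scope.
Local Open Scope ring_scope.

(** * Euclidean norm and Borel sets of R^d *)

(** Averages are taken over rings, not balls, because consecutive rings are separated: the pairs of
    points compared at scale i lie at a distance comparable to r_i, the bands of distances of
    different scales are disjoint, and the energies of all scales add up to at most the full
    Gagliardo energy. Concentric balls would count the pairs near the diagonal at every scale. The
    energy is normalised to be at most 1, so that its power of exponent tau / p >= 1 is dominated by
    the energy itself; what remains is linear in the energies, and Tonelli's theorem applies. When
    alpha = k all scales weigh the same and constant h_i fail: the resulting series, with terms
    l^(-tau) l^(tau - 1), diverges. When tau > p and k < d one has alpha < k, and the geometric gain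
    makes every beta >= 0 admissible; this covers cases (2) and (3) at once. Optimality rests on p >
    k, that is on s < 1: it makes the logarithmic kernel integrable at the diagonal. *)

Section euclidean_norm.
Context {R : realType} {n : nat}.
Implicit Types x y z : 'rV[R]_n.

Lemma coord_le_norm x i : `|x 0 i| <= `|x|.
Proof.
rewrite [leRHS](_ : _ = mx_norm x)// mx_normrE.
exact: (le_bigmax _ (fun ij => `|x ij.1 ij.2|) (0, i)).
Qed.

Lemma norm_leP x (a : R) : 0 <= a -> (forall i, `|x 0 i| <= a) -> `|x| <= a.
Proof.
move=> a0 xa; rewrite [leLHS](_ : _ = mx_norm x)// mx_normrE.
by apply/bigmax_leP; split=> // -[i j] _ /=; rewrite (ord1 i).
Qed.

Lemma enorm_ge0 x : 0 <= enorm x.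
Proof. exact: sqrtr_ge0. Qed.

Lemma sum_sqr_ge0 x : 0 <= \sum_i x 0 i ^+ 2.
Proof. by apply: sumr_ge0 => i _; exact: sqr_ge0. Qed.

Lemma sqr_enorm x : enorm x ^+ 2 = \sum_i x 0 i ^+ 2.
Proof. by rewrite sqr_sqrtr ?sum_sqr_ge0. Qed.

Lemma norm_le_enorm x : `|x| <= enorm x.
Proof.
apply: norm_leP; first exact: enorm_ge0.
move=> i; rewrite -sqrtr_sqr ler_wsqrtr// (bigD1 i)//= lerDl.
by apply: sumr_ge0 => j _; exact: sqr_ge0.
Qed.

Lemma enorm_le_norm x : enorm x <= n%:R * `|x|.
Proof.
rewrite -(@ler_pXn2r _ 2)// ?nnegrE ?enorm_ge0// ?mulr_ge0// sqr_enorm exprMn.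
apply: (@le_trans _ _ (\sum_(i < n) `|x| ^+ 2)).
  apply: ler_sum => i _; rewrite -[leLHS]real_normK ?num_real//.
  by rewrite ler_pXn2r ?nnegrE// coord_le_norm.
rewrite sumr_const card_ord -[_ *+ n]mulr_natl ler_wpM2r ?sqr_ge0//.
by case: (n) => [|m]; [rewrite expr0n|rewrite ler_eXnr// ler1n].
Qed.

Lemma enorm0 : enorm (0 : 'rV[R]_n) = 0.
Proof.
apply/le_anti; rewrite enorm_ge0 andbT.
by apply: (le_trans (enorm_le_norm 0)); rewrite normr0 mulr0.
Qed.

Lemma enormN x : enorm (- x) = enorm x.
Proof. by rewrite /enorm; congr Num.sqrt; apply: eq_bigr => i _; rewrite mxE sqrrN. Qed.

Lemma enorm_distC x y : enorm (x - y) = enorm (y - x).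
Proof. by rewrite -enormN opprB. Qed.

Lemma enorm_eq0 x : enorm x = 0 -> x = 0.
Proof. by move=> x0; apply/eqP; rewrite -normr_le0 -x0 norm_le_enorm. Qed.

Lemma enorm_gt0 x : x != 0 -> 0 < enorm x.
Proof. by rewrite lt_def enorm_ge0 andbT; apply: contra => /eqP/enorm_eq0/eqP. Qed.

Lemma dot_le_enorm x y : \sum_i x 0 i * y 0 i <= enorm x * enorm y.
Proof.
have [->|x0] := eqVneq x 0.
  by rewrite enorm0 mul0r big1// => i _; rewrite mxE mul0r.
have [->|y0] := eqVneq y 0.
  by rewrite enorm0 mulr0 big1// => i _; rewrite mxE mulr0.
have a0 := enorm_gt0 x0; have b0 := enorm_gt0 y0.
set a := enorm x in a0 *; set b := enorm y in b0 *.
(* Young's inequality with the weight b / a, for which the two sums over i are a b / 2 each. *)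
have H i : x 0 i * y 0 i <= (b / a / 2) * x 0 i ^+ 2 + (a / b / 2) * y 0 i ^+ 2.
  have := sqr_ge0 (b * x 0 i - a * y 0 i) => H.
  rewrite -subr_ge0.
  have -> : (b / a / 2) * x 0 i ^+ 2 + (a / b / 2) * y 0 i ^+ 2 - x 0 i * y 0 i
      = (b * x 0 i - a * y 0 i) ^+ 2 / (2 * a * b).
    by field; rewrite !gt_eqF.
  by rewrite divr_ge0// !mulr_ge0// ltW.
apply: (le_trans (ler_sum _ (fun i _ => H i))).
rewrite big_split/= -!mulr_sumr -!sqr_enorm -/a -/b.
by rewrite le_eqVlt; apply/orP; left; apply/eqP; field; rewrite !gt_eqF.
Qed.

Lemma enormD x y : enorm (x + y) <= enorm x + enorm y.
Proof.
rewrite -(@ler_pXn2r _ 2)// ?nnegrE ?enorm_ge0// ?addr_ge0 ?enorm_ge0//.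
rewrite sqrrD !sqr_enorm.
under eq_bigr do rewrite mxE sqrrD.
rewrite !big_split/= lerD2r lerD2l.
by rewrite -mulr2n lerMn2r dot_le_enorm.
Qed.

Lemma enorm_triangle z x y : enorm (x - y) <= enorm (x - z) + enorm (z - y).
Proof. by rewrite (le_trans _ (enormD _ _))// addrA subrK. Qed.

End euclidean_norm.

Section borel_sets.
Context {R : realType} {n : nat}.
Implicit Types x y z : 'rV[R]_n.
Local Notation mu := (lebesgue_rV (R := R) n).

Lemma measurable_rV_prod (A : 'I_n -> set R) :
  (forall i, measurable (A i)) -> measurable [set x : 'rV[R]_n | forall i, A i (x 0 i)].
Proof.
move=> mA.
rewrite (_ : mkset _ = \bigcap_i (rV_coord i @^-1` A i)).
  apply: fin_bigcap_measurable => // i _.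
  by rewrite -[X in measurable X]setTI; exact: measurable_rV_coord.
by apply/seteqP; split=> [x Bx i _|x Bx i]; exact: Bx.
Qed.

Lemma in_ball x r y : ball x r y <-> `|x - y| < r.
Proof. by rewrite -ball_normE. Qed.

Lemma ball_rVE x r : 0 < r -> ball x r = [set y : 'rV[R]_n | forall i, ball (x 0 i) r (y 0 i)].
Proof.
move=> r0; apply/seteqP; split=> y /=; first by move=> [_ xy] i; exact: xy.
by move=> xy; split=> // i j; rewrite (ord1 i).
Qed.

Lemma measurable_ball_rV x r : measurable (ball x r).
Proof.
have [r0|r0] := ltP 0 r.
  by rewrite ball_rVE//; apply: (measurable_rV_prod (A := fun i => ball (x 0 i) r)) => i; exact: measurable_ball.
rewrite (_ : ball x r = set0)//; apply/seteqP; split=> // y /in_ball xy.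
by have := lt_le_trans xy r0; rewrite ltNge normr_ge0.
Qed.

(** Balls of the sup norm are cubes, so volumes are explicit. Coverings, rings and scales are
    therefore taken in this norm, and the Euclidean norm enters through the kernel and the distance
    to K. *)
Lemma measure_ball_rV x r : 0 < r -> mu (ball x r) = ((2 * r) ^+ n)%:E.
Proof.
move=> r0; rewrite ball_rVE// (lebesgue_rV_prod (A := fun i => ball (x 0 i) r)); last first.
  by move=> i; exact: measurable_ball.
under eq_bigr do rewrite lebesgue_measure_ball ?ltW//.
by rewrite prodEFin prodr_const card_ord mulr_natl.
Qed.

Lemma open_measurable_rV (U : set 'rV[R]_n) : open U -> measurable U.
Proof.
move=> oU.
(* Balls with rational centre and radius 1 / (m + 1) form a countable base. *)
pose F (z : 'rV[rat]_n * nat) : set 'rV[R]_n :=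
  if `[< ball (map_mx ratr z.1 : 'rV[R]_n) z.2.+1%:R^-1 `<=` U >]
  then ball (map_mx ratr z.1 : 'rV[R]_n) z.2.+1%:R^-1 else set0.
rewrite (_ : U = \bigcup_z F z).
  apply: countable_bigcupT_measurable; first exact: countableP.
  by move=> z; rewrite /F; case: ifP => // _; exact: measurable_ball_rV.
apply/seteqP; split=> [x Ux|x [z _]]; last first.
  by rewrite /F; case: ifPn => // /asboolP; exact.
have /nbhs_ballP[e /= e0 xeU] : nbhs x U by exact: open_nbhs_nbhs.
have [m me] : exists m : nat, m.+1%:R^-1 < e / 2.
  have /ltr_add_invr[m] : 0 < e / 2 by rewrite divr_gt0.
  by rewrite add0r => ?; exists m.
have [q xq] : exists q : 'rV[rat]_n, forall i, `|ratr (q 0 i) - x 0 i| < m.+1%:R^-1.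
  have H i : exists a : rat, `|ratr a - x 0 i| < m.+1%:R^-1.
    have /rat_in_itvoo[a] : x 0 i < x 0 i + m.+1%:R^-1 by rewrite ltrDl.
    rewrite in_itv/= => /andP[a1 a2]; exists a.
    by rewrite ger0_norm ?subr_ge0 ?ltW// ltrBlDl.
  have [f Hf] := choice H.
  by exists (\row_i f i) => i; rewrite mxE.
exists (q, m) => //; rewrite /F.
have qx : ball (map_mx ratr q : 'rV[R]_n) m.+1%:R^-1 x.
  by rewrite ball_rVE//= => i; rewrite mxE -ball_normE/=; exact: xq.
rewrite ifT//=; apply/asboolP => y qy; apply: xeU.
rewrite [X in ball x X]splitr; apply: (@ball_triangle _ _ (map_mx ratr q : 'rV[R]_n)).
  by apply: ball_sym; exact: (le_ball (ltW me)).
exact: (le_ball (ltW me)).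
Qed.

Lemma continuous_measurable_rV (f : 'rV[R]_n -> R) :
  continuous f -> measurable_fun setT f.
Proof.
move=> cf; apply: (measurability _ (RGenOInfty.measurableE R)) => _ [_ [a ->] <-].
rewrite setTI; apply: open_measurable_rV.
apply: open_comp; last exact: interval_open.
by move=> x _; exact: cf.
Qed.

Lemma measurable_enorm : measurable_fun setT (@enorm R n).
Proof.
rewrite (_ : @enorm R n = Num.sqrt \o (fun x => \sum_i rV_coord i x ^+ 2))//.
apply: measurableT_comp.
  by apply: continuous_measurable_fun; exact: sqrt_continuous.
apply: measurable_sum => i; apply: measurable_funX.
exact: (measurable_rV_coord i).
Qed.

Lemma lipschitz_continuous_rV (f : 'rV[R]_n -> R) (L : R) :
  (forall x y, `|f x - f y| <= L * `|x - y|) -> continuous f.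
Proof.
move=> fL x; apply/(@cvgrPdist_lt _ _ _ _ (nbhs_filter x)) => e e0.
have : nbhs x (ball x (e / (`|L| + 1))) by apply: nbhsx_ballx; rewrite divr_gt0.
apply: filterS => y /in_ball xy.
rewrite (le_lt_trans (fL _ _))// (@le_lt_trans _ _ ((`|L| + 1) * `|x - y|))//.
  by rewrite ler_wpM2r// (le_trans (ler_norm _))// lerDl.
by rewrite mulrC -ltr_pdivlMr.
Qed.

End borel_sets.

Section product_measurability.
Context {R : realType} {n : nat}.

Lemma measurable_sub_rV :
  measurable_fun setT (fun z : 'rV[R]_n * 'rV[R]_n => z.1 - z.2).
Proof.
apply: measurable_fun_rVP => i.
rewrite (_ : _ \o _ = (fun z => rV_coord i z.1 - rV_coord i z.2)); last first.
  by apply/funext => z; rewrite /rV_coord/= !mxE.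
apply: measurable_funB.
  exact: (measurableT_comp (measurable_rV_coord i) measurable_fst).
exact: (measurableT_comp (measurable_rV_coord i) measurable_snd).
Qed.

Lemma measurable_enorm_sub :
  measurable_fun setT (fun z : 'rV[R]_n * 'rV[R]_n => enorm (z.1 - z.2)).
Proof. exact: (measurableT_comp measurable_enorm measurable_sub_rV). Qed.

Lemma measurable_norm_sub :
  measurable_fun setT (fun z : 'rV[R]_n * 'rV[R]_n => `|z.1 - z.2|).
Proof.
apply: (measurableT_comp _ measurable_sub_rV); apply: continuous_measurable_rV.
exact: norm_continuous.
Qed.

End product_measurability.

Section distance_to_a_set.
Context {R : realType} {n : nat}.
Implicit Types (x y z : 'rV[R]_n) (K : set 'rV[R]_n).

Lemma edistance_has_inf K x : K !=set0 -> has_inf [set enorm (x - y) | y in K].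
Proof.
move=> [y Ky]; split; first by exists (enorm (x - y)), y.
by exists 0 => _ [z _ <-]; exact: enorm_ge0.
Qed.

Lemma edistance_ge0 K x : 0 <= edistance K x.
Proof.
have [K0|/set0P K0] := eqVneq K set0; first by rewrite /edistance K0 image_set0 inf0.
apply: lb_le_inf; first by case: (edistance_has_inf x K0).
by move=> _ [z _ <-]; exact: enorm_ge0.
Qed.

Lemma edistance_le K x y : K y -> edistance K x <= enorm (x - y).
Proof.
move=> Ky; apply: ge_inf; last by exists y.
by exists 0 => _ [z _ <-]; exact: enorm_ge0.
Qed.

Lemma edistance_ltP K x t : K !=set0 ->
  edistance K x < t -> exists2 y, K y & enorm (x - y) < t.
Proof.
move=> /(edistance_has_inf x) H xt.
have e0 : 0 < t - edistance K x by rewrite subr_gt0.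
have [_ [y Ky <-]] := inf_adherent e0 H.
by rewrite /edistance addrCA subrr addr0; exists y.
Qed.

Lemma edistance_eq0 K x : K x -> edistance K x = 0.
Proof.
by move=> Kx; apply/le_anti; rewrite edistance_ge0 andbT (le_trans (edistance_le x Kx))// subrr enorm0.
Qed.

Lemma edistance_le_add K x y : K !=set0 ->
  edistance K x <= edistance K y + enorm (x - y).
Proof.
move=> K0; apply/ler_addgt0Pr => e e0.
have : edistance K y < edistance K y + e by rewrite ltrDl.
move=> /(edistance_ltP K0)[z Kz yz].
rewrite (le_trans (edistance_le x Kz))// (le_trans (enorm_triangle y _ _))//.
by rewrite addrC addrAC lerD2r ltW.
Qed.

Lemma edistance_lip K x y : K !=set0 ->
  `|edistance K x - edistance K y| <= enorm (x - y).
Proof.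
move=> K0; rewrite ler_norml; have := edistance_le_add x y K0.
by have := edistance_le_add y x K0; rewrite enorm_distC; lra.
Qed.

Lemma continuous_edistance K : K !=set0 -> continuous (edistance K).
Proof.
move=> K0; apply: (@lipschitz_continuous_rV _ _ _ n%:R) => x y.
by rewrite (le_trans (edistance_lip _ _ K0))// enorm_le_norm.
Qed.

Lemma open_edistance_lt K t : K !=set0 -> open [set x | edistance K x < t].
Proof.
move=> K0; rewrite (_ : mkset _ = edistance K @^-1` [set y | y < t])//.
by apply: open_comp; [move=> x _; exact: continuous_edistance|exact: open_lt].
Qed.

Lemma measurable_edistance K : K !=set0 -> measurable_fun setT (edistance K).
Proof. by move=> K0; apply: continuous_measurable_rV; exact: continuous_edistance. Qed.

End distance_to_a_set.

(** * Coverings and packings *)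

Section measure_bounds.
Context {d : measure_display} {T : measurableType d} {R : realType}.
Variable mu : {measure set T -> \bar R}.

(** Countable subadditivity without disjointness: each point picks one piece whose own bound [t j]
    dominates [F] there, so pieces carrying bounds of different kinds may overlap. *)
Lemma integral_le_cover (D : set T) (F : T -> \bar R) (S : nat -> set T)
    (t : nat -> T -> \bar R) (M : \bar R) :
  measurable D -> measurable_fun D F -> (forall x, D x -> (0 <= F x)%E) ->
  (forall j, measurable (S j)) -> (forall j, measurable_fun D (t j)) ->
  (forall j x, D x -> (0 <= t j x)%E) ->
  (forall x, D x -> exists2 j, S j x & (F x <= t j x)%E) ->
  (forall n, (\sum_(j < n) \int[mu]_(x in D `&` S j) t j x <= M)%E) ->
  (\int[mu]_(x in D) F x <= M)%E.
Proof.
move=> mD mF F0 mS mt t0 cov sumM.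
have mtS j : measurable_fun D (t j \_ (S j)).
  by apply/measurable_restrict => //; apply: measurable_funS (mt j) => //; exact: subIsetl.
have tS0 j x : D x -> (0 <= (t j \_ (S j)) x)%E.
  by move=> Dx; rewrite patchE; case: ifP => // _; exact: t0.
apply: (@le_trans _ _ (\int[mu]_(x in D) \sum_(0 <= j <oo) (t j \_ (S j)) x)%E).
  apply: ge0_le_integral => //.
    by apply: (@ge0_emeasurable_sum _ _ _ D (fun j => t j \_ (S j)) xpredT) => // k x Dx _; exact: tS0.
  move=> x Dx; have [j Sx Fx] := cov _ Dx.
  apply: (@le_trans _ _ (\sum_(0 <= i < j.+1) (t i \_ (S i)) x)%E).
    rewrite big_nat_recr//= -[leLHS]add0e leeD//.
      by apply: sume_ge0 => i _; exact: tS0.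
    by rewrite patchE mem_set.
  by apply: nneseries_lim_ge => k _ _; exact: tS0.
rewrite integral_nneseries//.
apply: lime_le.
  by apply: is_cvg_nneseries => k _ _; apply: integral_ge0 => x Dx; exact: tS0.
apply: nearW => n; rewrite big_mkord; apply: le_trans (sumM n).
by apply: lee_sum => j _; rewrite integral_mkcondr.
Qed.

Lemma integral_le_shells (D : set T) (F : T -> \bar R) (S : nat -> set T)
    (c m : nat -> R) (M : R) :
  measurable D -> measurable_fun D F -> (forall x, D x -> (0 <= F x)%E) ->
  (forall j, measurable (S j)) -> (forall j, 0 <= c j) ->
  (forall x, D x -> exists2 j, S j x & (F x <= (c j)%:E)%E) ->
  (forall j, (mu (D `&` S j) <= (m j)%:E)%E) ->
  (forall n, \sum_(j < n) c j * m j <= M) ->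
  (\int[mu]_(x in D) F x <= M%:E)%E.
Proof.
move=> mD mF F0 mS c0 cov muS sumM.
apply: (integral_le_cover mD mF F0 mS (t := fun j => cst (c j)%:E)) => //.
  by move=> j x _; rewrite lee_fin.
move=> n; apply: (@le_trans _ _ (\sum_(j < n) c j * m j)%:E); last by rewrite lee_fin.
rewrite -sumEFin; apply: lee_sum => j _.
rewrite integral_cst; last exact: measurableI.
by rewrite EFinM lee_wpmul2l ?lee_fin.
Qed.

Lemma measure_finite_cover_le (I : finType) (X : set T) (B : I -> set T) (b : R) :
  (forall i, measurable (B i)) -> measurable X -> X `<=` \bigcup_i B i ->
  (forall i, (mu (B i) <= b%:E)%E) -> (mu X <= (#|I|%:R * b)%:E)%E.
Proof.
move=> mB mX XB Bb.
have XB' : X `<=` \bigcup_(i in [set` enum I]) B i.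
  by move=> x /XB[i _ Bx]; exists i => //=; rewrite mem_enum.
have := @content_sub_fsum _ _ _ mu I [set` enum I] X B (finite_seq _) (fun i _ => mB i) mX XB'.
move=> /le_trans; apply; rewrite -fsbig_seq ?enum_uniq// big_enum/=.
apply: (@le_trans _ _ (\sum_(i in I) b%:E)%E); first by apply: lee_sum.
by rewrite sumEFin sumr_const lee_fin mulr_natl.
Qed.

End measure_bounds.

Section covering_and_packing.
Context {R : realType} {n : nat}.
Local Notation mu := (lebesgue_rV (R := R) n).

Lemma measure_le_ball (x : 'rV[R]_n) (a : R) (X : set 'rV[R]_n) :
  0 < a -> measurable X -> X `<=` ball x a -> (mu X <= ((2 * a) ^+ n)%:E)%E.
Proof.
move=> a0 mX Xx; rewrite -(measure_ball_rV x)//.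
by apply: le_measure => //; rewrite inE//; exact: measurable_ball_rV.
Qed.

(** Pigeonhole: the labels sort X into at most N^m cells, and a cell lies in the ball of radius [a]
    around any of its points. *)
Lemma measure_cells_le (m N : nat) (X : set 'rV[R]_n)
    (f : 'rV[R]_n -> 'I_m -> 'I_N) (a : R) :
  0 < a -> measurable X ->
  (forall x y, X x -> X y -> (forall j, f x j = f y j) -> `|x - y| < a) ->
  (mu X <= (N%:R ^+ m * (2 * a) ^+ n)%:E)%E.
Proof.
move=> a0 mX Xa.
pose F x : {ffun 'I_m -> 'I_N} := [ffun j => f x j].
pose B (g : {ffun 'I_m -> 'I_N}) : set 'rV[R]_n :=
  if pselect (exists2 x, X x & F x = g) is left e then ball (projT1 (cid2 e)) a else set0.
have := @measure_finite_cover_le _ _ _ mu {ffun 'I_m -> 'I_N} X B ((2 * a) ^+ n).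
rewrite card_ffun !card_ord natrX; apply => //.
- by move=> g; rewrite /B; case: pselect => // e; exact: measurable_ball_rV.
- move=> x Xx; exists (F x) => //; rewrite /B; case: pselect => [e|[]]; last by exists x.
  case: (cid2 e) => y Xy yx /=; apply/in_ball; apply: Xa => // j.
  by have := congr1 (fun g : {ffun 'I_m -> 'I_N} => g j) yx; rewrite !ffunE.
- move=> g; rewrite /B; case: pselect => [e|_].
    by move: (projT1 _) => z; rewrite [leLHS](measure_ball_rV z).
  by rewrite measure0 lee_fin exprn_ge0// mulr_ge0// ltW.
Qed.

Lemma measure_packing_ge (I : finType) (X : set 'rV[R]_n) (c : I -> 'rV[R]_n) (a : R) :
  0 < a -> measurable X -> (forall i, ball (c i) a `<=` X) ->
  (forall i j, i != j -> 2 * a <= `|c i - c j|) ->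
  ((#|I|%:R * (2 * a) ^+ n)%:E <= mu X)%E.
Proof.
move=> a0 mX cX sep.
have tr : trivIset [set` enum I] (fun i => ball (c i) a).
  move=> i j _ _ [y [/in_ball ci /in_ball cj]]; apply/eqP; apply: contraT => ij.
  have := sep _ _ ij; rewrite leNgt => /negP[].
  have -> : c i - c j = (c i - y) - (c j - y) by rewrite opprB addrA subrK.
  by rewrite (le_lt_trans (ler_normB _ _))//; move: ci cj; set u := `|_|; set v := `|_|; lra.
have mB i : measurable (ball (c i) a) by exact: measurable_ball_rV.
have := @measure_fin_bigcup _ _ _ mu I [set` enum I] (fun i => ball (c i) a)
  (finite_seq _) tr (fun i _ => mB i).
rewrite -fsbig_seq ?enum_uniq// big_enum/=.
under eq_bigr do rewrite measure_ball_rV//.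
rewrite sumEFin sumr_const -[_ *+ #|_|]mulr_natl => <-.
apply: le_measure; rewrite ?inE//.
  by apply: fin_bigcup_measurable => //; exact: finite_seq.
by move=> y [i _]; exact: cX.
Qed.

End covering_and_packing.

(** * Lipschitz domains are plump *)

Section plump_domain.
Context {R : realType} {d : nat}.
Implicit Types (x y z : 'rV[R]_d) (Omega : set 'rV[R]_d).

Lemma norm_mulmx_le (m n : nat) (h : 'rV[R]_m) (A : 'M[R]_(m, n)) j :
  `|(h *m A) 0 j| <= (\sum_i \sum_k `|A i k|) * `|h|.
Proof.
rewrite mxE (le_trans (ler_norm_sum _ _ _))// mulr_suml ler_sum// => i _.
rewrite normrM mulrC ler_pM// ?coord_le_norm//.
by rewrite (bigD1 j)//= lerDl sumr_ge0.
Qed.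

(* Moving from x by about r along the axis of the graph leads into the cone
   above x, which contains a ball of radius comparable to r. *)
Lemma plump_at_boundary Omega x0 (r1 : R) (A : 'M[R]_d) (j : 'I_d)
    (g : 'rV[R]_d.-1 -> R) :
  0 < r1 -> A *m A^T = 1%:M -> [lipschitz g z | z in setT] ->
  (forall y, eball x0 r1 y -> Omega y <-> g (col' j (y *m A)) < (y *m A) 0 j) ->
  exists2 e : R, 0 < e & forall c x r, 0 < c <= e -> ball x0 e x -> Omega x ->
    0 < r <= c -> exists z, ball z (c * r) `<=` Omega `&` ball x r.
Proof.
move=> r10 AA lipg OmegaE.
have [L [L0 gL]] : exists L : R, 0 < L /\ forall u v, `|g u - g v| <= L * `|u - v|.
  have [L [_ HL]] := lipg.
  exists (`|L| + 1); split; first by rewrite ltr_wpDl.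
  by move=> u v; apply: (HL _ _ (u, v)) => //; rewrite (le_lt_trans (ler_norm _))// ltrDl.
(* The change of coordinates [A] sends [ej] to the axis of the graph. *)
pose ej := row j A^T.
have ejA : ej *m A = delta_mx 0 j.
  by rewrite -row_mul (mulmx1C AA) row1.
pose E := 1 + `|ej|; have E0 : 0 < E by rewrite ltr_pwDl.
pose M := 1 + \sum_i \sum_k `|A i k|.
have M0 : 0 < M by rewrite ltr_pwDl// sumr_ge0// => i _; rewrite sumr_ge0.
have AM (h : 'rV[R]_d) i : `|(h *m A) 0 i| <= M * `|h|.
  by rewrite (le_trans (norm_mulmx_le _ _ _))// ler_wpM2r// lerDr.
(* A perturbation of norm below e1 r moves the height and the graph together by at most r / (2 E),
   the height gained along [ej]. The bound [e2] keeps all points inside the chart, the factor d + 1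
   converting between the two norms. *)
pose e1 := (2 * E * ((L + 1) * M))^-1.
have e10 : 0 < e1 by rewrite invr_gt0 !mulr_gt0// ltr_wpDl// ltW.
pose e2 := r1 / (4 * d.+1%:R).
have e20 : 0 < e2 by rewrite divr_gt0// mulr_gt0.
pose e := Num.min (1 / 2) (Num.min e1 e2).
have e0 : 0 < e by rewrite !lt_min e10 e20 divr_gt0.
exists e => // c x r /andP[c0 ce] /in_ball xe Ox /andP[r0 rc].
have [c12 [ce1 ce2]] : c <= 1 / 2 /\ c <= e1 /\ c <= e2.
  by move: ce; rewrite /e !le_min => /andP[-> /andP[-> ->]].
have e2E : e <= e2 by rewrite /e !ge_min lexx !orbT.
have near0 y : `|x - y| < r -> eball x0 r1 y.
  move=> xy; rewrite /eball/= (le_lt_trans (enorm_le_norm _))//.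
  have H : `|y - x0| <= 2 * e2.
    rewrite distrC (le_trans (ler_distD x _ _))//.
    by move: xe xy; set u := `|_|; set v := `|_|; lra.
  apply: (@le_lt_trans _ _ (d%:R * (2 * e2))); first by rewrite ler_wpM2l.
  rewrite /e2.
  have d0 : (0 : R) <= d%:R by [].
  rewrite -[d.+1]addn1 natrD.
  rewrite (_ : d%:R * _ = (d%:R / (2 * (d%:R + 1))) * r1); last first.
    by field; rewrite gt_eqF// ltr_wpDl.
  by rewrite gtr_pMl// ltr_pdivrMr; lra.
exists (x + (r / (2 * E)) *: ej) => y /in_ball; set h := _ - y => hy.
have yE : y = x + (r / (2 * E)) *: ej - h by rewrite /h opprB addrC subrK.
have ejE : `|(r / (2 * E)) *: ej| <= r / 2.
  rewrite normrZ ger0_norm ?divr_ge0 ?mulr_ge0 ?(ltW r0) ?(ltW E0)//.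
  rewrite (_ : r / 2 = r / (2 * E) * E); last by field; rewrite gt_eqF.
  by rewrite ler_pM2l ?divr_gt0 ?mulr_gt0// /E lerDr.
have xy : `|x - y| < r.
  rewrite yE opprB addrCA opprD [x + _]addrA subrr add0r.
  rewrite (le_lt_trans (ler_normB _ _))//.
  have : `|h| < r / 2 by rewrite (lt_le_trans hy)//; have := ler_wpM2r (ltW r0) c12; lra.
  by move: ejE; set u := `|_|; set v := `|_|; lra.
split; last by apply/in_ball.
apply/OmegaE; first exact: near0.
have /OmegaE Ogx : eball x0 r1 x by apply: near0; rewrite subrr normr0.
move/Ogx: Ox => Ox {Ogx}.
have yA : y *m A = x *m A + (r / (2 * E)) *: delta_mx 0 j - h *m A.
  by rewrite yE mulmxBl mulmxDl -scalemxAl ejA.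
have gxy : g (col' j (y *m A)) <= g (col' j (x *m A)) + L * (M * `|h|).
  rewrite -lerBlDl (le_trans (ler_norm _))// (le_trans (gL _ _))//.
  rewrite ler_wpM2l ?(ltW L0)//; apply: norm_leP; first by rewrite mulr_ge0// ltW.
  move=> i; have := AM h (lift j i); rewrite yA.
  move: (h *m A) (x *m A) => w v; rewrite !mxE /= [lift _ _ == _]eq_sym (negbTE (neq_lift _ _)) mulr0 addr0.
  by rewrite addrAC subrr add0r normrN.
rewrite (le_lt_trans gxy)// yA.
have := AM h j; set w := h *m A.
have -> : (x *m A + (r / (2 * E)) *: delta_mx 0 j - w) 0 j = (x *m A) 0 j + r / (2 * E) - w 0 j.
  by rewrite !mxE !eqxx mulr1.
rewrite ler_norml => /andP[_ wj].
have Hh : (L + 1) * (M * `|h|) <= r / (2 * E).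
  apply: (@le_trans _ _ ((L + 1) * (M * (e1 * r)))).
    rewrite ler_wpM2l ?addr_ge0 ?(ltW L0)// ler_wpM2l ?(ltW M0)// (le_trans (ltW hy))//.
    by rewrite ler_wpM2r ?(ltW r0).
  rewrite le_eqVlt; apply/orP; left; apply/eqP; rewrite /e1; field.
  by rewrite !gt_eqF// ltr_wpDl// (ltW L0).
move: Ox Hh wj; rewrite mulrDl mul1r.
by set a := L * _; set b := M * _; set g0 := g _; set x1 := (x *m A) 0 j; set t := r / _; lra.
Qed.

(** The same number [c] is the ratio of the radii and the largest scale, so the property persists
    when [c] decreases, and compactness of the closure merges the local constants into one. Near an
    interior point the small ball can be centred at x itself. *)
Lemma bounded_lipschitz_plump Omega : bounded_lipschitz_domain Omega ->
  exists c : R, 0 < c <= 1 /\ forall x r, Omega x -> 0 < r <= c ->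
    exists z, ball z (c * r) `<=` Omega `&` ball x r.
Proof.
move=> [oO _ bO bdO].
have cO : compact (closure Omega).
  apply: bounded_closed_compact; last exact: closed_closure.
  have [M0 [_ HM]] := bO.
  exists (`|M0| + 2); split; first by rewrite num_real.
  move=> M MM x /(_ _ (nbhsx_ballx x 1 ltr01))[y [Oy /in_ball xy]] /=.
  have : `|y| <= `|M0| + 1 by apply: HM => //; rewrite (le_lt_trans (ler_norm _))// ltrDl.
  have : `|x| <= `|x - y| + `|y| by rewrite -{1}(subrK y x) ler_normD.
  by move: xy MM; set u := `|_ - _|; set v := `|x|; set w := `|y|; set m := `|_|; lra.
pose P (c : R) x := Omega x -> forall r, 0 < r <= c ->
  exists z, ball z (c * r) `<=` Omega `&` ball x r.
have H x0 : closure Omega x0 -> exists2 e : R, 0 < e &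
    forall c x, 0 < c <= e -> ball x0 e x -> P c x.
  move=> cx0; have [Ox0|nOx0] := pselect (Omega x0).
    have /nbhs_ballP[e /= e0 xeO] : nbhs x0 Omega by exact: open_nbhs_nbhs.
    pose e' := Num.min 1 (e / 2).
    have e'0 : 0 < e' by rewrite lt_min ltr01 divr_gt0.
    have [e'1 e'e] : e' <= 1 /\ e' <= e / 2 by rewrite /e' !ge_min !lexx orbT.
    exists e' => // c x /andP[c0 ce] /in_ball xx0 Ox r /andP[r0 rc].
    exists x => y /in_ball xy.
    have xr : `|x - y| < r by rewrite (lt_le_trans xy)// ger_pMl//; lra.
    split; last by apply/in_ball.
    apply: xeO; apply/in_ball; rewrite (le_lt_trans (ler_distD x _ _))//.
    by move: xx0 xr; set u := `|_|; set v := `|_|; lra.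
  have [r1 [A [j [g [r10 AA lipg OE]]]]] := bdO x0 (conj cx0 nOx0).
  have [e e0 He] := plump_at_boundary r10 AA lipg OE.
  by exists e => // c x ce xe Ox r rc; apply: (He c).
have /compact_near_coveringP ncO := cO.
have : \forall c \near (0 : R)^'+, closure Omega `<=` P c.
  apply: (ncO _ _ P) => x0 /H[e e0 He].
  exists (ball x0 e, [set c | 0 < c <= e]) => /=.
    split; first exact: nbhsx_ballx.
    near=> c; apply/andP; split => //.
    near: c; exact: nbhs_right_le.
  by move=> [x c] [/= xe ce]; exact: He.
move=> nP.
have : \forall c \near (0 : R)^'+, 0 < c <= 1 /\ closure Omega `<=` P c.
  near=> c; split; last by near: c.
  apply/andP; split => //; near: c; exact: nbhs_right_le.
move/filter_ex => [c [c01 cP]]; exists c; split => // x r Ox rc.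
by apply: cP => //; exact: subset_closure.
Unshelve. all: by end_near. Qed.

End plump_domain.

(** * Volume of the tubes around K *)

Section tube_content.
Context {R : realType} {d : nat}.
Implicit Types (x y z : 'rV[R]_d) (Omega K : set 'rV[R]_d).
Local Notation mu := (lebesgue_rV (R := R) d).

Definition tube K (t : R) : set 'rV[R]_d := [set x | edistance K x < t].

(* Near x0 the set K is bi-Lipschitz to a subset of a coordinate plane of
   codimension k. *)
Definition flat_near (k : nat) (L : R) K x0 : Prop :=
  exists r (S : 'rV[R]_d -> 'rV[R]_d), [/\ 0 < r, 0 < L,
    (forall y z, K y -> eball x0 r y -> K z -> eball x0 r z ->
       `|S y - S z| <= L * `|y - z| /\ `|y - z| <= L * `|S y - S z|) &
    (forall y (i : 'I_d), K y -> eball x0 r y -> (i < k)%N -> S y 0 i = 0)].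

(** Each point x of the tube is sent to a point [Y x] of K within t, and the d - k free coordinates
    of [S (Y x)] are rounded at mesh t. Points with the same label are closer than (3 + L) t, and
    each coordinate takes at most 8 L rho / t + 1 values, so [measure_cells_le] applies. *)
Lemma tube_content_near (k : nat) (L : R) K x0 :
  (k <= d)%N -> K !=set0 -> flat_near k L K x0 ->
  exists2 e : R, 0 < e & forall z t rho, ball x0 e z -> 0 < t <= rho -> rho <= e ->
    (mu (tube K t `&` ball z rho) <=
     ((8 * L + 1) ^+ (d - k) * (2 * (3 + L)) ^+ d * t ^+ k * rho ^+ (d - k))%:E)%E.
Proof.
move=> kd K0 [r [S [r0 L0 bilip flat]]].
(* The three distances from x0 to z, from z to x and from x to [Y x] are at most e each, hence [Y x]
   stays in the chart. *)
pose e := r / (3 * d.+1%:R).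
have e0 : 0 < e by rewrite divr_gt0// mulr_gt0.
exists e => // z t rho /in_ball ze /andP[t0 trho] rhoe.
have rho0 : 0 < rho by exact: lt_le_trans trho.
have C0 : 0 <= (8 * L + 1) ^+ (d - k) * (2 * (3 + L)) ^+ d * t ^+ k * rho ^+ (d - k).
  by rewrite !mulr_ge0 ?exprn_ge0// ?mulr_ge0 ?addr_ge0 ?mulr_ge0 ?(ltW L0) ?(ltW t0) ?(ltW rho0).
set X := _ `&` _.
have mX : measurable X.
  apply: measurableI; last exact: measurable_ball_rV.
  by apply: open_measurable_rV; exact: open_edistance_lt.
have [->|/set0P[x1 Xx1]] := eqVneq X set0; first by rewrite measure0 lee_fin.
have [Y HY] : exists Y : 'rV[R]_d -> 'rV[R]_d, forall x, X x ->
    [/\ K (Y x), `|x - Y x| < t & eball x0 r (Y x)].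
  have H x : exists y, X x -> [/\ K y, `|x - y| < t & eball x0 r y].
    have [Xx|nX] := pselect (X x); last by exists x.
    have [xt /in_ball xz] := Xx.
    have [y Ky xy] := edistance_ltP K0 xt.
    have xy' := le_lt_trans (norm_le_enorm _) xy.
    exists y => _; split => //.
    rewrite /eball/= (le_lt_trans (enorm_le_norm _))//.
    apply: (@le_lt_trans _ _ (d%:R * (3 * e))).
      rewrite ler_wpM2l// distrC (le_trans (ler_distD z _ _))//.
      have := ler_distD x z y; rewrite -(distrC x z).
      by move: ze xz xy'; rewrite [`|x - z|]distrC; set u := `|_|; set v := `|_|; set w := `|_|; lra.
    rewrite /e -[d.+1]addn1 natrD.
    have d0 : (0 : R) <= d%:R by [].
    rewrite (_ : d%:R * _ = (d%:R / (d%:R + 1)) * r); last first.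
      by field; rewrite gt_eqF// ltr_wpDl.
    by rewrite gtr_pMl// ltr_pdivrMr; lra.
  by have [Y HY] := choice H; exists Y.
have XY x y : X x -> X y -> `|Y x - Y y| <= 2 * t + `|x - y|.
  move=> /HY[_ xY _] /HY[_ yY _].
  rewrite (le_trans (ler_distD x _ _))// distrC.
  have := ler_distD y x (Y y).
  by move: xY yY; set u := `|_|; set v := `|_|; set w := `|_|; lra.
have XX x y : X x -> X y -> `|x - y| < 2 * rho.
  move=> [_ /in_ball xz] [_ /in_ball yz]; rewrite (le_lt_trans (ler_distD z _ _))//.
  by move: xz yz; rewrite [`|x - z|]distrC; set u := `|_|; set v := `|_|; lra.
have XS x i : X x -> `|S (Y x) 0 i - S (Y x1) 0 i| <= 4 * L * rho.
  move=> Xx; have [Kx _ ex] := HY _ Xx; have [Kx1 _ ex1] := HY _ Xx1.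
  have [H _] := bilip _ _ Kx ex Kx1 ex1.
  have := coord_le_norm (S (Y x) - S (Y x1)) i; rewrite !mxE => /le_trans; apply.
  rewrite (le_trans H)// [4 * L]mulrC -mulrA ler_wpM2l ?(ltW L0)//.
  by rewrite (le_trans (XY _ _ Xx Xx1))//; have := XX _ _ Xx Xx1; lra.
have oP (j : 'I_(d - k)) : (k + j < d)%N by rewrite -ltn_subRL.
pose o j := Ordinal (oP j).
pose v x j := (S (Y x) 0 (o j) - S (Y x1) 0 (o j) + 4 * L * rho) / t.
pose N := (Num.truncn (8 * L * rho / t)).+1.
pose f x j : 'I_N := inord (Num.truncn (v x j)).
have v0 x j : X x -> 0 <= v x j /\ v x j <= 8 * L * rho / t.
  move=> Xx; have := XS _ (o j) Xx; rewrite ler_norml => /andP[H1 H2].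
  by split; [rewrite divr_ge0 ?(ltW t0)//; lra|rewrite ler_pM2r ?invr_gt0//; lra].
have fE x j : X x -> f x j = Num.truncn (v x j) :> nat.
  move=> Xx; rewrite inordK// ltnS; apply: le_truncn.
  by have [] := v0 _ j Xx.
have := @measure_cells_le _ _ (d - k) N X f ((3 + L) * t) _ mX.
have a0 : 0 < (3 + L) * t by rewrite mulr_gt0// addr_gt0.
move=> /(_ a0) H; apply: le_trans (H _) _ => [x y Xx Xy fxy|].
  have [Kx _ ex] := HY _ Xx; have [Ky _ ey] := HY _ Xy.
  have [_ H2] := bilip _ _ Kx ex Ky ey.
  have Sxy : `|S (Y x) - S (Y y)| <= t.
    apply: norm_leP => [|i]; first exact: ltW.
    rewrite !mxE; have [ik|ki] := ltnP i k.
      by rewrite (flat _ i Kx)// (flat _ i Ky)// subrr normr0 ltW.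
    have jP : (i - k < d - k)%N by rewrite ltn_sub2r// (leq_ltn_trans ki).
    have -> : i = o (Ordinal jP) by apply: val_inj; rewrite /= subnKC.
    set j := Ordinal jP.
    have := congr1 val (fxy j); rewrite /= !fE// => tE.
    have [vx0 _] := v0 _ j Xx; have [vy0 _] := v0 _ j Xy.
    have /andP[x1' x2'] := truncn_itv vx0; have /andP[y1' y2'] := truncn_itv vy0.
    rewrite tE in x1' x2'; move: x1' x2' y1' y2'.
    rewrite -natr1 => x1' x2' y1' y2'.
    have : `|v x j - v y j| <= 1 by rewrite ler_norml; apply/andP; split; lra.
    rewrite /v -mulrBl normrM [`|t^-1|]ger0_norm ?invr_ge0 ?(ltW t0)//.
    rewrite ler_pdivrMr// mul1r => H3; apply: le_trans H3.
    by rewrite opprD addrACA subrr addr0 opprB addrA subrK.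
  rewrite (le_lt_trans (ler_distD (Y x) _ _))//.
  have H4 : `|Y x - Y y| <= L * t by rewrite (le_trans H2)// ler_wpM2l// (ltW L0).
  have [_ Hx _] := HY _ Xx; have [_ Hy _] := HY _ Xy.
  have H5 := ler_distD (Y y) (Y x) y; rewrite [`|Y y - y|]distrC in H5.
  rewrite mulrDl; move: H4 H5 Hx Hy.
  by set a := `|_|; set b := `|_|; set c := `|_|; set g := `|_|; move: (L * t) => lt; lra.
rewrite lee_fin.
have NE : N%:R * t <= (8 * L + 1) * rho.
  rewrite /N -addn1 natrD.
  have : 0 <= 8 * L * rho / t by rewrite !mulr_ge0 ?invr_ge0 ?(ltW t0) ?(ltW L0) ?(ltW rho0).
  move=> /truncn_itv/andP[H1 _].
  rewrite [leLHS]mulrDl [leRHS]mulrDl !mul1r lerD//.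
  by rewrite -ler_pdivlMr.
have -> : (2 * ((3 + L) * t)) ^+ d = (2 * (3 + L)) ^+ d * (t ^+ k * t ^+ (d - k)).
  by rewrite mulrA exprMn -exprD subnKC.
have E1 (a b c g : R) : a * (b * (c * g)) = (a * g) * (b * c) by ring.
have E2 (a b c g : R) : a * b * c * g = (a * g) * (b * c) by ring.
rewrite E1 E2 -!exprMn.
rewrite ler_wpM2r ?mulr_ge0 ?exprn_ge0 ?(ltW t0)//.
  by rewrite mulr_ge0// addr_ge0// ltW.
apply: lerXn2r => //; rewrite nnegrE mulr_ge0 ?(ltW t0) ?(ltW rho0)//.
by rewrite addr_ge0// mulr_ge0// ltW.
Qed.

(** A ball that meets the tube lies in a ball of three times its radius centred on K, where
    compactness makes the local estimate uniform. The global bound sums the local one over a finite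
    cover of K. *)
Lemma tube_content (k : nat) (L : R) K : (k <= d)%N -> compact K -> K !=set0 ->
  (forall x0, K x0 -> flat_near k L K x0) ->
  exists rho0 C : R, [/\ 0 < rho0, 0 < C, forall z t rho, 0 < t <= rho -> rho <= rho0 ->
    (mu (tube K t `&` ball z rho) <= (C * t ^+ k * rho ^+ (d - k))%:E)%E
  & forall t, 0 < t <= rho0 -> (mu (tube K t) <= (C * t ^+ k)%:E)%E].
Proof.
move=> kd cK K0 flatK.
have L0 : 0 < L by have [x0 /flatK[r [S []]]] := K0.
have [C1 C10 C1E] : exists2 C1 : R, 0 < C1 &
    C1 = (8 * L + 1) ^+ (d - k) * (2 * (3 + L)) ^+ d.
  eexists; last by [].
  by rewrite mulr_gt0 ?exprn_gt0// ?mulr_gt0// ?addr_gt0// mulr_gt0.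
pose P (c : R) z := forall t rho, 0 < t <= rho -> rho <= c ->
    (mu (tube K t `&` ball z rho) <= (C1 * t ^+ k * rho ^+ (d - k))%:E)%E.
have [c0 [c00 PK]] : exists c, 0 < c /\ K `<=` P c.
  have /compact_near_coveringP ncK := cK.
  have nP : \forall c \near (0 : R)^'+, K `<=` P c.
    apply: (ncK _ _ P) => x0 Kx0.
    have [e e0 He] := tube_content_near kd K0 (flatK _ Kx0).
    exists (ball x0 e, [set c | c <= e]) => /=.
      by split; [exact: nbhsx_ballx|exact: nbhs_right_le].
    move=> [x c] [/= xe ce] t rho trho rhoc; rewrite C1E; apply: He => //.
    exact: le_trans ce.
  have : \forall c \near (0 : R)^'+, 0 < c /\ K `<=` P c.
    by near=> c; split => //; near: c.
  by move/filter_ex.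
have mtube t : measurable (tube K t).
  by apply: open_measurable_rV; exact: open_edistance_lt.
have loc z t rho : 0 < t <= rho -> rho <= c0 / 3 ->
    (mu (tube K t `&` ball z rho) <=
      (C1 * 3 ^+ d * t ^+ k * rho ^+ (d - k))%:E)%E.
  move=> /andP[t0 trho] rhoc; have rho0 : 0 < rho by exact: lt_le_trans trho.
  set X := _ `&` _; have [->|/set0P[x Xx]] := eqVneq X set0.
    by rewrite measure0 lee_fin !mulr_ge0 ?exprn_ge0 ?(ltW C10) ?(ltW t0) ?(ltW rho0).
  have [xt /in_ball xz] := Xx; have [y Ky xy] := edistance_ltP K0 xt.
  have xy' := le_lt_trans (norm_le_enorm _) xy.
  apply: (@le_trans _ _ (C1 * t ^+ k * (3 * rho) ^+ (d - k))%:E).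
    apply: le_trans (PK y Ky t (3 * rho) _ _).
    - apply: le_measure; rewrite ?inE; try by apply: measurableI => //; exact: measurable_ball_rV.
      move=> w [wt /in_ball wz]; split => //; apply/in_ball.
      rewrite (le_lt_trans (ler_distD z _ _))//; have := ler_distD x y z.
      rewrite [`|y - x|]distrC [`|x - z|]distrC.
      by move: xz xy' wz; set a := `|_|; set b := `|_|; set c := `|_|; lra.
    - by rewrite t0/=; lra.
    - by lra.
  rewrite lee_fin exprMn mulrA ler_wpM2r ?exprn_ge0 ?(ltW rho0)//.
  rewrite mulrAC ler_wpM2r ?exprn_ge0 ?(ltW t0)// ler_wpM2l ?(ltW C10)//.
  by rewrite ler_eXn2l ?leq_subr// ltr1n.
have [D KD] : exists D : seq 'rV[R]_d,
    forall y, K y -> exists2 z, z \in D & ball z (c0 / 6) y.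
  have := cK; rewrite compact_cover => /(_ _ K (fun z => (ball z (c0 / 6))°)).
  case.
  - by move=> z Kz; exact: open_interior.
  - by move=> y Ky; exists y => //; apply: nbhsx_ballx; rewrite divr_gt0.
  move=> D _ KD; exists (finmap.enum_fset D).
  by move=> y /KD[z zD /interior_subset yz]; exists z.
pose C2 := C1 * 3 ^+ d * (1 + (size D)%:R * (c0 / 3) ^+ (d - k)).
have C20 : 0 < C2.
  rewrite !mulr_gt0 ?exprn_gt0// ltr_pwDl// mulr_ge0// exprn_ge0// divr_ge0// ltW//.
exists (c0 / 6), C2; split => //; first by rewrite divr_gt0.
- move=> z t rho trho rhoc; apply: (le_trans (loc z t rho trho _)); first lra.
  move/andP: trho => [t0 /(lt_le_trans t0) rho0].
  rewrite lee_fin ler_wpM2r ?exprn_ge0 ?(ltW rho0)// ler_wpM2r ?exprn_ge0 ?(ltW t0)//.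
  rewrite /C2 ler_peMr ?mulr_ge0 ?(ltW C10) ?exprn_ge0// lerDl mulr_ge0// exprn_ge0//.
  by rewrite divr_ge0 ?(ltW c00).
- move=> t /andP[t0 tc].
  have := @measure_finite_cover_le _ _ _ mu 'I_(size D) (tube K t)
    (fun i : 'I_(size D) => tube K t `&` ball (nth 0 D i) (c0 / 3))
    (C1 * 3 ^+ d * t ^+ k * (c0 / 3) ^+ (d - k)).
  rewrite card_ord => H; apply: le_trans (H _ _ _ _) _.
  + by move=> i; apply: measurableI => //; exact: measurable_ball_rV.
  + exact: mtube.
  + move=> x xt; have [y Ky xy] := edistance_ltP K0 xt.
    have [z zD /in_ball yz] := KD _ Ky.
    have zs : (index z D < size D)%N by rewrite index_mem.
    exists (Ordinal zs) => //; split => //; apply/in_ball; rewrite /= nth_index//.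
    have xy' := le_lt_trans (norm_le_enorm _) xy.
    rewrite (le_lt_trans (ler_distD y _ _))// [`|y - x|]distrC.
    by move: xy' yz; set a := `|_|; set b := `|_|; lra.
  + by move=> i; apply: loc => //; rewrite t0/=; lra.
  rewrite lee_fin /C2 (_ : _%:R * _ = C1 * 3 ^+ d * ((size D)%:R * (c0 / 3) ^+ (d - k)) * t ^+ k); last by ring.
  rewrite ler_wpM2r ?exprn_ge0 ?(ltW t0)// ler_wpM2l ?mulr_ge0 ?exprn_ge0 ?(ltW C10)//.
  by rewrite lerDr.
Unshelve. all: by end_near. Qed.

End tube_content.

(** * Lipschitz surfaces and points as sets of tame codimension *)

Section surface.
Context {R : realType} {d : nat}.
Implicit Types (x y z xi : 'rV[R]_d) (Omega K : set 'rV[R]_d).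
Local Notation mu := (lebesgue_rV (R := R) d).

(** The image of K in the chart. For k = d it is the origin alone, so that surfaces and the single
    point share the same argument. *)
Definition flat_face (k : nat) : set 'rV[R]_d :=
  [set xi | forall i : 'I_d, if (i < k)%N then xi 0 i = 0 else 0 < xi 0 i < 1].

(** A grid of N^(d - k) points in the flat face, with N of order 1 / t, has images in K so far apart
    that the balls of radius t / (d + 1) around them are disjoint; all of them lie in the tube. *)
Lemma tube_content_ge (k : nat) (L : R) K (T : 'rV[R]_d -> 'rV[R]_d) :
  (k <= d)%N -> 0 < L -> K !=set0 ->
  (forall xi, flat_face k xi -> K (T xi)) ->
  (forall xi eta, flat_face k xi -> flat_face k eta ->
     `|xi - eta| <= L * `|T xi - T eta|) ->
  exists t0 c : R, [/\ 0 < t0, 0 < c & forall t, 0 < t <= t0 ->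
    ((c * t ^+ k)%:E <= mu (tube K t))%E].
Proof.
move=> kd L0 K0 TK TL.
pose D : R := d.+1%:R; have D0 : 0 < D by rewrite ltr0n.
pose t0 := D / (8 * L); pose c := (D / (4 * L)) ^+ (d - k) * (2 / D) ^+ d.
have t00 : 0 < t0 by rewrite divr_gt0// mulr_gt0.
exists t0, c; split => //.
  by rewrite mulr_gt0// exprn_gt0// divr_gt0// mulr_gt0.
move=> t /andP[tp tt0].
have aE : 0 < t / D by rewrite divr_gt0.
(* At mesh 1 / m = 2 L t / D the images are 2 t / D apart. The restriction t <= t0 means m >= 4, so
   that rounding down to N + 1 <= m still leaves N >= m / 2. *)
pose m := D / (2 * t * L).
have m4 : 4 <= m.
  rewrite /m ler_pdivlMr ?mulr_gt0//; move: tt0; rewrite /t0 ler_pdivlMr ?mulr_gt0//.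
  by rewrite (_ : t * (8 * L) = 4 * (2 * t * L))//; ring.
have [N [Nm mN]] : exists N : nat, (N.+1%:R : R) <= m /\ D / (4 * t * L) <= N%:R.
  exists (Num.truncn m).-1.
  have m0 : 0 <= m by lra.
  have /andP[H1 H2] := truncn_itv m0.
  have tr0 : (0 < Num.truncn m)%N.
    rewrite lt0n; apply/eqP => E; move: H2; rewrite E => H2; lra.
  rewrite prednK//; split => //.
  have {H2} : m < (Num.truncn m).-1%:R + 1 + 1 by rewrite !natr1 prednK.
  move=> H2.
  have -> : D / (4 * t * L) = m / 2 by rewrite /m; field; rewrite !gt_eqF.
  lra.
(* For i < k the truncated subtraction [i - k] is 0, which [insub] may accept; hence the second
   test. *)
pose xi (g : {ffun 'I_(d - k) -> 'I_N}) : 'rV[R]_d :=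
  \row_(i < d) if insub (i - k)%N is Some j then
    if (i < k)%N then 0 else ((g j).+1%:R / N.+1%:R) else 0.
have xiE g (j : 'I_(d - k)) (i : 'I_d) : i = (k + j)%N :> nat -> xi g 0 i = (g j).+1%:R / N.+1%:R.
  move=> ij; rewrite mxE.
  case: insubP => [j' _ j'E|]; last by rewrite ij addKn ltn_ord.
  rewrite ifF; last by rewrite ij ltnNge leq_addr.
  by congr ((g _).+1%:R / _); apply: val_inj; rewrite /= j'E ij addKn.
have xiF g : flat_face k (xi g).
  move=> i; case: ifPn => [ik|].
    by rewrite mxE; case: insubP => // j _ _; rewrite ik.
  rewrite -leqNgt => ki.
  have jP : (i - k < d - k)%N by rewrite ltn_sub2r// (leq_ltn_trans ki).
  rewrite (xiE _ (Ordinal jP)) ?subnKC// divr_gt0 ?ltr0n//=.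
  by rewrite ltr_pdivrMr// mul1r ltr_nat ltnS.
have sep g h : g != h -> N.+1%:R^-1 <= `|xi g - xi h|.
  move=> gh; have [j gj] : exists j, g j != h j.
    apply/existsP; move: gh; apply: contraNT; rewrite negb_exists => /forallP H.
    by apply/eqP/ffunP => j; have := H j; rewrite negbK => /eqP.
  have iP : (k + j < d)%N by rewrite -ltn_subRL.
  have := coord_le_norm (xi g - xi h) (Ordinal iP).
  rewrite [X in `|X| <= _](_ : _ = ((g j).+1%:R - (h j).+1%:R) / N.+1%:R); last first.
    by rewrite mulrBl -!(xiE _ j (Ordinal iP))// mxE [X in _ + X]mxE.
  apply: le_trans; rewrite normrM [`|_^-1|]ger0_norm ?invr_ge0 ?ler0n// ler_pMl ?invr_gt0//.
  rewrite -!natr1 opprD addrACA subrr addr0.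
  have /orP[H|H] : ((g j < h j) || (h j < g j))%N by rewrite -neq_ltn.
    have : (g j).+1%:R <= (h j)%:R :> R by rewrite ler_nat.
    by rewrite -natr1 distrC => ?; rewrite ger0_norm; lra.
  have : (h j).+1%:R <= (g j)%:R :> R by rewrite ler_nat.
  by rewrite -natr1 => ?; rewrite ger0_norm; lra.
have := @measure_packing_ge _ _ {ffun 'I_(d - k) -> 'I_N} (tube K t) (fun g => T (xi g)) _ aE.
rewrite card_ffun !card_ord natrX => H; apply: le_trans (H _ _ _) => {H}.
- rewrite lee_fin.
  have -> : c * t ^+ k = (D / (4 * t * L)) ^+ (d - k) * (2 * (t / D)) ^+ d.
    rewrite /c.
    have -> : D / (4 * L) = D / (4 * t * L) * t by field; rewrite !gt_eqF.
    have -> : 2 * (t / D) = 2 / D * t by rewrite mulrA mulrAC.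
    rewrite [(2 / D * t) ^+ d]exprMn -[in t ^+ d](subnK kd) [t ^+ (_ + _)]exprD.
    rewrite [(_ * t) ^+ _]exprMn; move: (_ ^+ d) (t ^+ k) (t ^+ (d - k)) (_ ^+ (d - k)) => a1 a2 a3 a4.
    by ring.
  rewrite ler_wpM2r ?exprn_ge0 ?mulr_ge0 ?invr_ge0 ?(ltW tp) ?(ltW D0)//.
  apply: lerXn2r => //; rewrite nnegrE ?ler0n//.
  by rewrite divr_ge0 ?(ltW D0)// !mulr_ge0 ?(ltW tp) ?(ltW L0).
- by apply: open_measurable_rV; exact: open_edistance_lt.
- move=> g y /in_ball yg; rewrite /tube/=.
  rewrite (le_lt_trans (edistance_le _ (TK _ (xiF g))))//.
  rewrite enorm_distC (le_lt_trans (enorm_le_norm _))//.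
  apply: (@le_lt_trans _ _ (d%:R * (t / D))); first by rewrite ler_wpM2l// ltW.
  by rewrite mulrCA gtr_pMr// ltr_pdivrMr// mul1r ltr_nat.
- move=> g h gh.
  have := le_trans (sep _ _ gh) (TL _ _ (xiF g) (xiF h)) => H.
  rewrite -(@ler_pM2l _ L)//; apply: le_trans H.
  rewrite -[leRHS]mul1r ler_pdivlMr//.
  have : L * (2 * (t / D)) * m = 1 by rewrite /m; field; rewrite !gt_eqF.
  by move=> E; rewrite -[leRHS]E ler_pM2l// !mulr_gt0 ?invr_gt0.
Qed.

Lemma C01_norm_ge0 m n (A : set 'rV[R]_m) (f : 'rV[R]_m -> 'rV[R]_n) :
  A !=set0 -> (0 <= C01_norm A f)%E.
Proof.
move=> [a Aa]; apply: adde_ge0.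
  apply: (@le_trans _ _ (enorm (f a))%:E); first by rewrite lee_fin enorm_ge0.
  by apply: ereal_sup_ubound; exists a.
apply: (@le_trans _ _ (enorm (f a - f a) / enorm (a - a))%:E).
  by rewrite lee_fin divr_ge0 ?enorm_ge0.
by apply: ereal_sup_ubound; exists (a, a).
Qed.

Lemma C01_norm_lipschitz m n (A : set 'rV[R]_m) (f : 'rV[R]_m -> 'rV[R]_n) (C : R) :
  (C01_norm A f <= C%:E)%E ->
  forall x y : 'rV[R]_m, A x -> A y -> `|f x - f y| <= C * m%:R * `|x - y|.
Proof.
move=> fC x y Ax Ay.
have sup0 : (0 <= ereal_sup [set (enorm (f x))%:E | x in A])%E.
  apply: (@le_trans _ _ (enorm (f x))%:E); first by rewrite lee_fin enorm_ge0.
  by apply: ereal_sup_ubound; exists x.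
have H : ((enorm (f x - f y) / enorm (x - y))%:E <= C%:E)%E.
  apply: le_trans fC; rewrite /C01_norm -[leLHS]add0e leeD//.
  by apply: ereal_sup_ubound; exists (x, y).
have [->|xy] := eqVneq x y; first by rewrite !subrr !normr0 mulr0.
rewrite lee_fin ler_pdivrMr in H; last by rewrite enorm_gt0// subr_eq0.
have C0 : 0 <= C.
  have := le_trans (enorm_ge0 _) H; rewrite pmulr_lge0//.
  by rewrite enorm_gt0// subr_eq0.
rewrite (le_trans (norm_le_enorm _))// (le_trans H)// -mulrA ler_wpM2l//.
exact: enorm_le_norm.
Qed.

Lemma normal_norm_eq0 k xi : normal_norm k xi = 0 <->
  forall i : 'I_d, (i < k)%N -> xi 0 i = 0.
Proof.
split=> [/eqP|xi0]; last first.
  by rewrite /normal_norm big1 ?sqrtr0// => i /xi0 ->; rewrite expr0n.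
rewrite sqrtr_eq0 => H i ik; apply/eqP; rewrite -sqrf_eq0 eq_le sqr_ge0 andbT.
apply: le_trans H; rewrite (bigD1 i)//= lerDl.
by apply: sumr_ge0 => j _; exact: sqr_ge0.
Qed.

(** Both summands of the chart norm are nonnegative, so each of T and S is Lipschitz; the factor d +
    1 passes from the Euclidean to the sup norm. As T inverts S on the ball, the image condition on
    [S] says that T maps the flat face into K. *)
Lemma C01_surface_flat Omega k K : C01_surface Omega k K ->
  exists2 L : R, 0 < L & (forall x0, K x0 -> flat_near k L K x0) /\
    exists T : 'rV[R]_d -> 'rV[R]_d, (forall xi, flat_face k xi -> K (T xi)) /\
      (forall xi eta, flat_face k xi -> flat_face k eta ->
         `|xi - eta| <= L * `|T xi - T eta|).
Proof.
move=> [cK [x1 Kx1] [C C0 HC]].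
pose L := C * d.+1%:R; have L0 : 0 < L by rewrite mulr_gt0.
have dL : C * d%:R <= L by rewrite ler_pM2l// ler_nat.
exists L => //.
have key x0 : K x0 -> exists r (T S : 'rV[R]_d -> 'rV[R]_d), [/\ 0 < r,
    (forall y z, K y -> eball x0 r y -> K z -> eball x0 r z ->
       `|S y - S z| <= L * `|y - z| /\ `|y - z| <= L * `|S y - S z|),
    (forall y (i : 'I_d), K y -> eball x0 r y -> (i < k)%N -> S y 0 i = 0),
    (forall xi, flat_face k xi -> K (T xi)) &
    (forall xi eta, flat_face k xi -> flat_face k eta ->
         `|xi - eta| <= L * `|T xi - T eta|)].
  move=> Kx0; have [r [T [S [r0 [[funT injT surjT] ST] norms SK _]]]] := HC _ Kx0.
  set Q := flat_cylinder k in funT injT surjT ST norms SK.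
  set B := eball x0 r in funT injT surjT ST norms SK.
  have B0 : closure B x0.
    by apply: subset_closure; rewrite /B/eball/= subrr enorm0.
  have [q Qq _] : (T @` Q) x0 by apply: surjT; rewrite /B/eball/= subrr enorm0.
  have Q0 : closure Q q by exact: subset_closure.
  have TS y : B y -> T (S y) = y /\ Q (S y).
    by move=> /surjT[xi Qxi <-]; rewrite ST.
  have lipT : (C01_norm (closure Q) T <= C%:E)%E.
    apply: le_trans norms; rewrite -[leLHS]adde0 leeD// C01_norm_ge0//.
    by exists x0.
  have lipS : (C01_norm (closure B) S <= C%:E)%E.
    apply: le_trans norms; rewrite -[leLHS]add0e leeD// C01_norm_ge0//.
    by exists q.
  have lT x y : Q x -> Q y -> `|T x - T y| <= L * `|x - y|.
    move=> Qx Qy; apply: le_trans (C01_norm_lipschitz lipT _ _) _; try exact: subset_closure.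
    by rewrite ler_wpM2r.
  have lS x y : B x -> B y -> `|S x - S y| <= L * `|x - y|.
    move=> Bx By; apply: le_trans (C01_norm_lipschitz lipS _ _) _; try exact: subset_closure.
    by rewrite ler_wpM2r.
  have faceQ xi : flat_face k xi -> K (T xi) /\ B (T xi) /\ Q xi.
    move=> face.
    have : [set xi | Q xi /\ normal_norm k xi = 0] xi.
      have n0 : normal_norm k xi = 0.
        by apply/normal_norm_eq0 => i ik; have := face i; rewrite ik.
      split => //; split; first by rewrite n0.
      by move=> i ki; have := face i; rewrite ltnNge ki.
    rewrite -SK => -[y [By Ky] yxi].
    by have [TSy QSy] := TS _ By; rewrite -yxi TSy.
  exists r, T, S; split => //.
  - move=> y z Ky By Kz Bz; split; first exact: lS.
    have [TSy QSy] := TS _ By; have [TSz QSz] := TS _ Bz.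
    by rewrite -{1}TSy -{1}TSz; exact: lT.
  - move=> y i Ky By ik; suff : normal_norm k (S y) = 0 by move/normal_norm_eq0; exact.
    have : [set xi | Q xi /\ normal_norm k xi = 0] (S y) by rewrite -SK; exists y.
    by case.
  - by move=> xi /faceQ[].
  - move=> xi eta /faceQ[_ [Bx Qx]] /faceQ[_ [Be Qe]].
    by rewrite -{1}(ST xi Qx) -{1}(ST eta Qe); exact: lS.
split; last by have [r [T [S [_ _ _ TK TL]]]] := key _ Kx1; exists T.
by move=> x0 /key[r [T [S [r0 H1 H2 _ _]]]]; exists r, S.
Qed.

(* The two-sided bound on the volume of the tubes is all that is used of K. *)
Definition tame_codim (k : nat) K := exists rho0 C c : R,
  [/\ 0 < rho0, 0 < C, 0 < c,
    forall z t rho, 0 < t <= rho -> rho <= rho0 ->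
      (mu (tube K t `&` ball z rho) <= (C * t ^+ k * rho ^+ (d - k))%:E)%E &
    forall t, 0 < t <= rho0 ->
      ((c * t ^+ k)%:E <= mu (tube K t))%E /\ (mu (tube K t) <= (C * t ^+ k)%:E)%E].

Lemma tame_codim_flat (k : nat) (L : R) K (T : 'rV[R]_d -> 'rV[R]_d) :
  (k <= d)%N -> compact K -> K !=set0 -> 0 < L ->
  (forall x0, K x0 -> flat_near k L K x0) ->
  (forall xi, flat_face k xi -> K (T xi)) ->
  (forall xi eta, flat_face k xi -> flat_face k eta ->
     `|xi - eta| <= L * `|T xi - T eta|) ->
  tame_codim k K.
Proof.
move=> kd cK K0 L0 Kf TK TL.
have [r0 [C [r00 C0 H1 H2]]] := tube_content kd cK K0 Kf.
have [t0 [c [t00 c0 H3]]] := tube_content_ge kd L0 K0 TK TL.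
exists (Num.min r0 t0), C, c; split => //; first by rewrite lt_min r00.
  by move=> z t rho trho; rewrite le_min => /andP[rr _]; exact: H1.
move=> t; rewrite le_min => /andP[tp /andP[tr tt]]; split.
  by apply: H3; rewrite tp.
by apply: H2; rewrite tp.
Qed.

Lemma tame_codim_surface Omega k K : (k <= d)%N -> C01_surface Omega k K ->
  tame_codim k K.
Proof.
move=> kd surf; have [cK K0 _] := surf.
have [L L0 [Kf [T [TK TL]]]] := C01_surface_flat surf.
exact: (tame_codim_flat kd cK K0 L0 Kf TK TL).
Qed.

Lemma tame_codim_point : tame_codim d [set 0 : 'rV[R]_d].
Proof.
apply: (@tame_codim_flat d 1 _ (cst 0)) => //.
- exact: compact_set1.
- by exists 0.
- move=> x0 _; exists 1, (cst 0); split => //.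
    by move=> y z -> _ -> _; rewrite !subrr normr0 mulr0.
  by move=> y i _ _ _; rewrite mxE.
move=> xi eta xi0 eta0; suff -> : xi = eta by rewrite subrr normr0 mulr_ge0.
apply/rowP => i; have := xi0 i; have := eta0 i; rewrite ltn_ord.
by move=> -> ->.
Qed.

End surface.

(** * Averages over rings *)

Section real_inequalities.
Context {R : realType}.
Implicit Types a b t p X : R.

(** With a free parameter this elementary inequality replaces those of Jensen and Hoelder: it is
    integrated first, and [le_optimize] then takes lam = X^(1 / p), at the cost of a factor 2. *)
Lemma le_young (lam t p : R) : 0 < lam -> 0 <= t -> 1 <= p ->
  t <= lam + lam / lam `^ p * t `^ p.
Proof.
move=> l0 t0 p1.
have [tl|lt] := leP t lam.
  by rewrite (le_trans tl)// lerDl !mulr_ge0 ?invr_ge0 ?powR_ge0 ?(ltW l0).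
have tl1 : 1 <= t / lam by rewrite ler_pdivlMr// mul1r ltW.
have tE : t = lam * (t / lam) by field; rewrite gt_eqF.
rewrite -[leLHS]add0r lerD ?(ltW l0)//.
have -> : lam / lam `^ p * t `^ p = lam * (t / lam) `^ p.
  have lE : lam^-1 `^ p = (lam `^ p)^-1.
    by rewrite -powR_inv1 ?(ltW l0)// -powRrM mulN1r powRN.
  rewrite powRM ?invr_ge0 ?(ltW l0)// lE.
  by rewrite mulrAC mulrA.
rewrite {1}tE ler_pM2l//.
by rewrite -{1}[t / lam]powRr1 ?ler_powR// (le_trans _ tl1).
Qed.

Lemma le_optimize (a b X p : R) : 1 <= p -> 0 <= X ->
  (forall lam, 0 < lam -> a <= b + lam + lam / lam `^ p * X) ->
  a <= b + 2 * X `^ p^-1.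
Proof.
move=> p1 X0 H.
have p0 : p != 0 by rewrite gt_eqF// (lt_le_trans ltr01).
have [X00|Xn0] := eqVneq X 0.
  rewrite X00 powR0 ?invr_eq0// mulr0 addr0; apply/ler_addgt0Pr => e e0.
  by have := H _ e0; rewrite X00 mulr0 addr0.
have Xp : 0 < X by rewrite lt_def Xn0.
have l0 : 0 < X `^ p^-1 by rewrite powR_gt0.
have := H _ l0; rewrite -powRrM mulVf// powRr1//.
by rewrite divfK// => /le_trans; apply; lra.
Qed.

Lemma le_powR2 a b t : 0 <= t -> 0 <= a -> a <= b -> a `^ t <= b `^ t.
Proof. by move=> t0 a0 ab; rewrite ge0_ler_powR// nnegrE (le_trans a0). Qed.

Lemma powR_add a s t : 0 < a -> a `^ (s + t) = a `^ s * a `^ t.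
Proof. by move=> a0; rewrite powRD// (gt_eqF a0) implybT. Qed.

End real_inequalities.

Section averages.
Context {R : realType} {dd : measure_display} {T : measurableType dd}.
Variable mu : {measure set T -> \bar R}.
Variables (u : T -> R) (p : R).
Hypotheses (mu_u : measurable_fun setT u) (p1 : 1 <= p).
Implicit Types A B : set T.

Definition abs_average A : R := fine (\int[mu]_(x in A) `|u x|%:E) / fine (mu A).

Let measurable_absu A : measurable_fun A (fun x => `|u x|%:E).
Proof.
apply: measurableT_comp => //; apply: measurableT_comp => //.
exact: measurable_funS mu_u.
Qed.

Let measurable_diff A x : measurable_fun A (fun y => (`|u x - u y| `^ p)%:E).
Proof.
apply: measurableT_comp => //; apply: (measurableT_comp (measurable_powR p)).
apply: measurableT_comp => //; apply: measurable_funB => //.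
exact: measurable_funS mu_u.
Qed.

(** The bound stays in the extended reals because the integral of |u x - u y|^p may be infinite at
    single points x; [average_le_average] integrates it once more, over x. *)
Lemma le_integral_young A (a m : R) x lam : measurable A -> mu A = m%:E ->
  (\int[mu]_(y in A) `|u y|%:E)%E = a%:E -> 0 < lam ->
  ((m * `|u x|)%:E <= (a + lam * m)%:E +
     (lam / lam `^ p)%:E * \int[mu]_(y in A) (`|u x - u y| `^ p)%:E)%E.
Proof.
move=> mA Am Aa l0.
have c0 : 0 <= lam / lam `^ p by rewrite divr_ge0 ?powR_ge0 ?ltW.
rewrite mulrC EFinM -Am -integral_cst//.
apply: (@le_trans _ _ (\int[mu]_(y in A) ((`|u y|%:E + lam%:E) +
    (lam / lam `^ p)%:E * (`|u x - u y| `^ p)%:E))%E).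
  apply: ge0_le_integral => //.
  - by move=> y _; rewrite lee_fin.
  - apply: emeasurable_funD; first exact: emeasurable_funD.
    by apply: measurable_funeM; exact: measurable_diff.
  - move=> y _; rewrite -EFinM -!EFinD lee_fin.
    have := le_young l0 (normr_ge0 (u x - u y)) p1.
    have : `|u x| <= `|u y| + `|u x - u y| by rewrite -{1}(subrK (u y) (u x)) addrC ler_normD.
    by move=> /le_trans H1 /(lerD (lexx `|u y|)) /H1; rewrite addrA.
rewrite ge0_integralD//; last 4 first.
- by move=> y _; rewrite adde_ge0// lee_fin// ltW.
- exact: emeasurable_funD.
- by move=> y _; rewrite mule_ge0 ?lee_fin ?powR_ge0.
- by apply: measurable_funeM; exact: measurable_diff.
rewrite ge0_integralD//; last first.
  by move=> y _; rewrite lee_fin ltW.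
rewrite Aa integral_cst// Am -EFinM -EFinD ge0_integralZl_EFin//.
Qed.

Lemma point_le_average A (m X : R) x : measurable A -> mu A = m%:E -> 0 < m ->
  (\int[mu]_(y in A) `|u y|%:E < +oo)%E -> 0 <= X ->
  (\int[mu]_(y in A) (`|u x - u y| `^ p)%:E <= (X * m)%:E)%E ->
  `|u x| <= abs_average A + 2 * X `^ p^-1.
Proof.
move=> mA Am m0 Aoo X0 AX.
have fI : (\int[mu]_(y in A) `|u y|%:E)%E \is a fin_num.
  by rewrite ge0_fin_numE//; apply: integral_ge0 => y _; rewrite lee_fin.
have := fineK fI; rewrite /abs_average Am /=.
set a := fine _ => /esym aE.
apply: le_optimize => // lam l0.
have := le_integral_young x mA Am aE l0.
move=> /le_trans H.
have {H} : ((m * `|u x|)%:E <= (a + lam * m)%:E + (lam / lam `^ p * (X * m))%:E)%E.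
  apply: H; rewrite leeD2l// [X in (_ <= X)%E]EFinM lee_wpmul2l// lee_fin.
  by rewrite divr_ge0 ?powR_ge0 ?ltW.
rewrite -EFinD lee_fin => H; rewrite -(@ler_pM2l _ m)//; apply: le_trans H _.
by rewrite le_eqVlt; apply/orP; left; apply/eqP; field; rewrite !gt_eqF ?powR_gt0.
Qed.

Lemma average_le_average A B (m m' X : R) : measurable A -> measurable B ->
  mu A = m%:E -> mu B = m'%:E -> 0 < m -> 0 < m' ->
  (\int[mu]_(y in A) `|u y|%:E < +oo)%E -> (\int[mu]_(y in B) `|u y|%:E < +oo)%E ->
  0 <= X ->
  measurable_fun A (fun x => \int[mu]_(y in B) (`|u x - u y| `^ p)%:E)%E ->
  (\int[mu]_(x in A) \int[mu]_(y in B) (`|u x - u y| `^ p)%:E <= (X * m * m')%:E)%E ->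
  abs_average A <= abs_average B + 2 * X `^ p^-1.
Proof.
move=> mA mB Am Bm m0 m'0 Aoo Boo X0 mJ ABX.
have fI C : (\int[mu]_(y in C) `|u y|%:E < +oo)%E -> (\int[mu]_(y in C) `|u y|%:E)%E \is a fin_num.
  by move=> ?; rewrite ge0_fin_numE//; apply: integral_ge0 => y _; rewrite lee_fin.
have := fineK (fI _ Aoo); have := fineK (fI _ Boo); rewrite /abs_average Am Bm /=.
set b := fine _ => /esym bE; set a := fine _ => /esym aE.
apply: le_optimize => // lam l0.
have c0 : 0 <= lam / lam `^ p by rewrite divr_ge0 ?powR_ge0 ?ltW.
have b0 : 0 <= b by rewrite -lee_fin -bE; apply: integral_ge0 => y _; rewrite lee_fin.
have blm : 0 <= b + lam * m' by rewrite addr_ge0// mulr_ge0// ltW.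
have J0 x : (0 <= \int[mu]_(y in B) (`|u x - u y| `^ p)%:E)%E.
  by apply: integral_ge0 => y _; rewrite lee_fin powR_ge0.
have H : ((m' * a)%:E <= ((b + lam * m') * m)%:E + (lam / lam `^ p * (X * m * m'))%:E)%E.
  rewrite [X in (X <= _)%E]EFinM -aE -ge0_integralZl_EFin//; last by rewrite ltW.
  apply: (@le_trans _ _ (\int[mu]_(x in A) ((b + lam * m')%:E +
      (lam / lam `^ p)%:E * \int[mu]_(y in B) (`|u x - u y| `^ p)%:E))%E).
    apply: ge0_le_integral => //.
    - by move=> y _; rewrite mule_ge0// lee_fin// ltW.
    - exact: measurable_funeM.
    - by apply: emeasurable_funD => //; apply: measurable_funeM.
    - by move=> x _; rewrite -EFinM; exact: le_integral_young.
  rewrite ge0_integralD//; last 2 first.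
  - by move=> x _; rewrite mule_ge0// lee_fin.
  - by apply: measurable_funeM.
  rewrite integral_cst// Am -EFinM ge0_integralZl_EFin//.
  by rewrite leeD2l// [X in (_ <= X)%E]EFinM lee_wpmul2l// lee_fin.
rewrite -EFinD lee_fin in H.
rewrite -(@ler_pM2l _ (m * m')) ?mulr_gt0//.
have -> : m * m' * (a / m) = m' * a by field; rewrite gt_eqF.
apply: le_trans H _.
by rewrite le_eqVlt; apply/orP; left; apply/eqP; field; rewrite !gt_eqF ?powR_gt0.
Qed.

End averages.

(** * Tonelli's theorem on rectangles *)

Section slices.
Context {d1 d2 : measure_display} {T1 : measurableType d1} {T2 : measurableType d2}.
Context {R : realType}.
Variables (m1 : {sigma_finite_measure set T1 -> \bar R})
  (m2 : {sigma_finite_measure set T2 -> \bar R}).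
Variable f : T1 * T2 -> \bar R.
Hypotheses (mf : measurable_fun setT f) (f0 : forall z, (0 <= f z)%E).
Variables (A : set T1) (B : set T2).
Hypotheses (mA : measurable A) (mB : measurable B).

Let fAB := f \_ (A `*` B).

Let measurable_fAB : measurable_fun setT fAB.
Proof.
have mAB : measurable (A `*` B) by exact: measurableX.
by apply: (proj1 (measurable_restrictT f mAB)); exact: measurable_funS mf.
Qed.

Let fAB0 z : (0 <= fAB z)%E.
Proof. by rewrite /fAB patchE; case: ifP. Qed.

Let in_setXE (x : T1) (y : T2) : ((x, y) \in A `*` B) = (x \in A) && (y \in B).
Proof.
apply/idP/idP => [|/andP[]]; rewrite ?inE; first by move=> [/= Ax By]; rewrite !mem_set.
by move=> Ax By; split.
Qed.

Let slice1 x : (\int[m2]_y fAB (x, y) = ((fun x => \int[m2]_(y in B) f (x, y)) \_ A) x)%E.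
Proof.
rewrite patchE; case: ifPn => xA.
  rewrite [RHS]integral_mkcond; apply: eq_integral => y _.
  by rewrite /fAB !patchE in_setXE xA.
by rewrite integral0_eq// => y _; rewrite /fAB patchE in_setXE (negbTE xA).
Qed.

Let slice2 y : (\int[m1]_x fAB (x, y) = ((fun y => \int[m1]_(x in A) f (x, y)) \_ B) y)%E.
Proof.
rewrite patchE; case: ifPn => yB.
  rewrite [RHS]integral_mkcond; apply: eq_integral => x _.
  by rewrite /fAB !patchE in_setXE yB andbT.
by rewrite integral0_eq// => x _; rewrite /fAB patchE in_setXE (negbTE yB) andbF.
Qed.

Lemma tonelli_setX :
  (\int[m1]_(x in A) \int[m2]_(y in B) f (x, y) =
   \int[m2]_(y in B) \int[m1]_(x in A) f (x, y))%E.
Proof.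
rewrite [LHS]integral_mkcond [RHS]integral_mkcond.
under eq_integral do rewrite -slice1.
under [RHS]eq_integral do rewrite -slice2.
exact: fubini_tonelli.
Qed.

Lemma measurable_slice : measurable_fun A (fun x => \int[m2]_(y in B) f (x, y))%E.
Proof.
apply/(measurable_restrictT _ mA).
rewrite (_ : _ \_ A = (fun x => \int[m2]_y fAB (x, y))%E); last by apply/funext => x; rewrite slice1.
exact: measurable_fun_fubini_tonelli_F.
Qed.

End slices.

(** The half-open intervals are disjoint: their indicators add up to that of the interval from r n
    to r 0. *)
Lemma sum_between_le1 {R : realType} (r : nat -> R) n (t : R) : (forall i, r i.+1 <= r i) ->
  \sum_(i < n) ((r i.+1 <= t < r i)%R)%:R <= 1 :> R.
Proof.
move=> rS; have rn m : r m <= r 0%N by elim: m => // m; apply: le_trans.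
suff : \sum_(i < n) ((r i.+1 <= t < r i)%R)%:R = ((r n <= t < r 0%N)%R)%:R :> R.
  by move=> ->; case: (_ && _).
elim: n => [|n IH].
  by rewrite big_ord0; case: ltP; rewrite ?andbF// => H; rewrite leNgt H.
rewrite big_ord_recr/= IH; have := rS n; have := rn n => H1 H2.
by case: (leP (r n) t); case: (ltP t (r 0%N)); case: (leP (r n.+1) t); rewrite /= ?addr0 ?add0r//; lra.
Qed.

(** * The Gagliardo kernel and its bands of distances *)

Section gagliardo_kernel.
Context {R : realType} {d : nat}.
Local Notation mu := (lebesgue_rV (R := R) d).
Variables (p D : R) (u : 'rV[R]_d -> R) (Omega : set 'rV[R]_d).
Hypotheses (p1 : 1 <= p) (D0 : 0 <= D).
Hypotheses (mu_u : measurable_fun setT u) (mO : measurable Omega).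
Implicit Types (x y : 'rV[R]_d) (z : 'rV[R]_d * 'rV[R]_d).

Definition gkernel z : R := `|u z.1 - u z.2| `^ p / enorm (z.1 - z.2) `^ D.

Lemma kernel_ge0 z : 0 <= gkernel z.
Proof. by rewrite divr_ge0 ?powR_ge0. Qed.

Lemma measurable_diffp :
  measurable_fun setT (fun z => `|u z.1 - u z.2| `^ p).
Proof.
apply: (measurableT_comp (measurable_powR p)); apply: measurableT_comp => //.
apply: measurable_funB.
  exact: (measurableT_comp mu_u measurable_fst).
exact: (measurableT_comp mu_u measurable_snd).
Qed.

Lemma measurable_kernel : measurable_fun setT gkernel.
Proof.
rewrite (_ : gkernel = (fun z => `|u z.1 - u z.2| `^ p * enorm (z.1 - z.2) `^ (- D))).
  apply: measurable_funM; first exact: measurable_diffp.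
  apply: (measurableT_comp (measurable_powR (- D))); exact: measurable_enorm_sub.
by apply/funext => z; rewrite powRN.
Qed.

Lemma diffp_le_kernel x y rho : 0 < `|x - y| -> `|x - y| <= rho ->
  `|u x - u y| `^ p <= (d%:R * rho) `^ D * gkernel (x, y).
Proof.
move=> xy xyr.
have e0 : 0 < enorm (x - y) by rewrite enorm_gt0// -normr_gt0.
rewrite /gkernel /= mulrCA ler_peMr ?powR_ge0//.
rewrite ler_pdivlMr ?powR_gt0// mul1r le_powR2 ?enorm_ge0//.
by rewrite (le_trans (enorm_le_norm _))// ler_wpM2l.
Qed.

Definition in_band (a b : R) z : bool := a <= `|z.1 - z.2| < b.

Lemma measurable_in_band a b : measurable_fun setT (fun z => (in_band a b z)%:R : R).
Proof.
rewrite (_ : (fun z => _) = \1_((fun z => `|z.1 - z.2|) @^-1` `[a, b[%classic)); last first.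
  apply/funext => z; rewrite indicE; congr (nat_of_bool _)%:R.
  by apply/idP/idP; rewrite inE/= in_itv.
apply: measurable_indic; rewrite -[X in measurable X]setTI.
by apply: measurable_norm_sub.
Qed.

Definition energy x : \bar R := (\int[mu]_(y in Omega) (gkernel (x, y))%:E)%E.

Definition band a b x : \bar R :=
  (\int[mu]_(y in Omega) (gkernel (x, y) * (in_band a b (x, y))%:R)%:E)%E.

Lemma energy_ge0 x : (0 <= energy x)%E.
Proof. by apply: integral_ge0 => y _; rewrite lee_fin kernel_ge0. Qed.

Lemma band_ge0 a b x : (0 <= band a b x)%E.
Proof. by apply: integral_ge0 => y _; rewrite lee_fin mulr_ge0// kernel_ge0. Qed.

Lemma measurable_kernel_band a b :
  measurable_fun setT (fun z => (gkernel z * (in_band a b z)%:R)%:E).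
Proof.
apply: measurableT_comp => //; apply: measurable_funM; first exact: measurable_kernel.
exact: measurable_in_band.
Qed.

Lemma measurable_band a b A : measurable A -> measurable_fun A (band a b).
Proof.
move=> mA.
apply: (measurable_slice mu (f := fun z => (gkernel z * (in_band a b z)%:R)%:E)) => //.
  exact: measurable_kernel_band.
by move=> z; rewrite lee_fin mulr_ge0// kernel_ge0.
Qed.

Lemma measurable_energy A : measurable A -> measurable_fun A energy.
Proof.
move=> mA; apply: (measurable_slice mu (f := fun z => (gkernel z)%:E)) => //.
  by apply: measurableT_comp => //; exact: measurable_kernel.
by move=> z; rewrite lee_fin kernel_ge0.
Qed.

Lemma measurable_kernelr x A : measurable A -> measurable_fun A (fun y => (gkernel (x, y))%:E).
Proof.
move=> mA; apply: measurableT_comp => //; apply: (measurable_funS measurableT) => //.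
exact: (measurableT_comp measurable_kernel (pair1_measurable x)).
Qed.

Lemma measurable_kernel_bandr a b x A : measurable A ->
  measurable_fun A (fun y => (gkernel (x, y) * (in_band a b (x, y))%:R)%:E).
Proof.
move=> mA; apply: (measurable_funS measurableT) => //.
exact: (measurableT_comp (measurable_kernel_band a b) (pair1_measurable x)).
Qed.

Lemma sum_band_le_energy (r : nat -> R) n x : (forall i, r i.+1 <= r i) ->
  (\sum_(i < n) band (r i.+1) (r i) x <= energy x)%E.
Proof.
move=> rS; rewrite /band -ge0_integral_sum//; last 2 first.
- by move=> i; exact: measurable_kernel_bandr.
- by move=> i y _; rewrite lee_fin mulr_ge0// kernel_ge0.
apply: ge0_le_integral => //.
- by move=> y _; apply: sume_ge0 => i _; rewrite lee_fin mulr_ge0// kernel_ge0.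
- by apply: emeasurable_sum => i; exact: measurable_kernel_bandr.
- exact: measurable_kernelr.
move=> y _; rewrite sumEFin lee_fin -mulr_sumr ler_piMr ?kernel_ge0//.
exact: sum_between_le1.
Qed.

Lemma sum_int_band_le (r : nat -> R) n : (forall i, r i.+1 <= r i) ->
  (\sum_(i < n) \int[mu]_(x in Omega) band (r i.+1) (r i) x <=
   \int[mu]_(x in Omega) energy x)%E.
Proof.
move=> rS; rewrite -ge0_integral_sum//; last 2 first.
- by move=> i; exact: measurable_band.
- by move=> i y _; exact: band_ge0.
apply: ge0_le_integral => //.
- by move=> y _; apply: sume_ge0 => i _; exact: band_ge0.
- by apply: emeasurable_sum => i; exact: measurable_band.
- exact: measurable_energy.
by move=> y _; exact: sum_band_le_energy.
Qed.

End gagliardo_kernel.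

(** * Averages over consecutive rings *)

Section chain_of_averages.
Context {R : realType} {d : nat}.
Local Notation mu := (lebesgue_rV (R := R) d).
Variables (p D : R) (u : 'rV[R]_d -> R) (Omega : set 'rV[R]_d).
Hypotheses (p1 : 1 <= p) (D0 : 0 <= D).
Hypotheses (mu_u : measurable_fun setT u) (mO : measurable Omega).
Variables (r0 eps kap : R).
Hypotheses (r00 : 0 < r0) (eps0 : 0 < eps) (eps1 : eps < 1) (kap0 : 0 < kap).
Implicit Types (x y : 'rV[R]_d) (r : R).

Definition ring_in x r : set 'rV[R]_d := (Omega `&` ball x r) `\` ball x (eps * r).

Hypothesis ringP : forall x r, Omega x -> 0 < r <= r0 ->
  ((kap * r ^+ d)%:E <= mu (ring_in x r))%E.

(** The ratio eps / 4 separates the rings: ring i lies outside radius eps r_i = 4 r_(i+1) and ring i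
    + 1 inside r_(i+1), so a pair taken from both has distance in [2 r_(i+1), 2 r_i). These bands
    are disjoint. *)
Definition geo_radius (i : nat) : R := r0 * (eps / 4) ^+ i.

Lemma geo_radius_gt0 i : 0 < geo_radius i.
Proof. by rewrite mulr_gt0// exprn_gt0// divr_gt0. Qed.

Lemma geo_radiusS i : geo_radius i.+1 = eps / 4 * geo_radius i.
Proof. by rewrite /geo_radius exprS mulrCA. Qed.

Lemma geo_radiusS_le i : geo_radius i.+1 <= geo_radius i.
Proof. rewrite geo_radiusS ler_piMl ?(ltW (geo_radius_gt0 i))//; have := eps1; lra. Qed.

Lemma geo_radius_le0 i : geo_radius i <= r0.
Proof.
elim: i => [|i]; first by rewrite /geo_radius expr0 mulr1.
exact/le_trans/geo_radiusS_le.
Qed.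

Lemma measurable_ring_in x r : measurable (ring_in x r).
Proof. by apply: measurableD; [apply: measurableI => //|]; exact: measurable_ball_rV. Qed.

Lemma measure_ring_in x r : Omega x -> 0 < r <= r0 ->
  exists2 m : R, mu (ring_in x r) = m%:E & 0 < kap * r ^+ d <= m.
Proof.
move=> Ox rr; have /andP[rp _] := rr.
have := ringP Ox rr.
have : (mu (ring_in x r) <= ((2 * r) ^+ d)%:E)%E.
  apply: (@measure_le_ball _ _ x) => //; first exact: measurable_ring_in.
  by move=> y [[]].
case E : (mu _) => [m| |] //= _; rewrite lee_fin => H.
by exists m => //; rewrite H andbT mulr_gt0// exprn_gt0.
Qed.

Hypothesis Iu : (\int[mu]_(x in Omega) `|u x|%:E < +oo)%E.

Let Iring x r : (\int[mu]_(y in ring_in x r) `|u y|%:E < +oo)%E.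
Proof.
apply: le_lt_trans Iu; apply: ge0_subset_integral => //.
- exact: measurable_ring_in.
- by do 2 apply: measurableT_comp => //; exact: measurable_funS mu_u.
- by move=> y [[]].
Qed.

Let powRdd r : 0 < r -> r `^ (D - d%:R - d%:R) * (r ^+ d * r ^+ d) = r `^ D.
Proof.
move=> rp; rewrite -!powR_mulrn ?(ltW rp)// -!powR_add//.
by congr (_ `^ _); ring.
Qed.

Let powRd r : 0 < r -> r `^ (D - d%:R) * r ^+ d = r `^ D.
Proof.
move=> rp; rewrite -!powR_mulrn ?(ltW rp)// -!powR_add//.
by rewrite subrK.
Qed.

(** The two summands are the constants of [average_ring_step] and of [point_le_ring]. *)
Definition chain_cst : R := (d%:R * 2) `^ D / (kap ^+ 2 * (eps / 4) ^+ d) + d%:R `^ D / kap.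

Lemma chain_cst_ge0 : 0 <= chain_cst.
Proof.
by rewrite addr_ge0// divr_ge0 ?powR_ge0 ?mulr_ge0 ?exprn_ge0 ?divr_ge0 ?(ltW eps0) ?(ltW kap0).
Qed.

(** On the pairs in play |u z - u y|^p is at most a multiple of r_i^D times the kernel; dividing by
    two volumes of order r_i^d leaves the exponent D - 2 d. The energy is kept local to the ball of
    radius r_i, which is what the tube bounds exploit later. *)
Lemma average_ring_step x i e : Omega x ->
  (\int[mu]_(y in Omega `&` ball x (geo_radius i))
     band p D u Omega (2 * geo_radius i.+1) (2 * geo_radius i) y <= e%:E)%E ->
  abs_average mu u (ring_in x (geo_radius i.+1)) <=
  abs_average mu u (ring_in x (geo_radius i)) +
  2 * (chain_cst * geo_radius i `^ (D - d%:R - d%:R) * e) `^ p^-1.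
Proof.
move=> Ox He.
have ri0 := geo_radius_gt0 i; have ri1 := geo_radius_gt0 i.+1.
have th0 : 0 < eps / 4 by rewrite divr_gt0.
have [m mE /andP[m0 mle]] := measure_ring_in Ox (introT andP (conj ri0 (geo_radius_le0 i))).
have [m' m'E /andP[m'0 m'le]] := measure_ring_in Ox (introT andP (conj ri1 (geo_radius_le0 i.+1))).
have e0 : 0 <= e.
  by rewrite -lee_fin (le_trans _ He)//; apply: integral_ge0 => y _; exact: band_ge0.
have dff A y : measurable A -> measurable_fun A (fun z => (`|u y - u z| `^ p)%:E).
  move=> mA; apply: measurableT_comp => //; apply: (measurable_funS measurableT) => //.
  exact: (measurableT_comp (measurable_diffp p mu_u) (pair1_measurable y)).
apply: (average_le_average (p := p) mu_u p1 (measurable_ring_in _ _) (measurable_ring_in _ _) m'E mE) => //.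
- exact: lt_le_trans m'le.
- exact: lt_le_trans mle.
- by rewrite !mulr_ge0 ?powR_ge0 ?chain_cst_ge0.
- apply: (measurable_slice mu (f := fun z => (`|u z.1 - u z.2| `^ p)%:E)).
  + by apply: measurableT_comp => //; exact: measurable_diffp.
  + by move=> z; rewrite lee_fin powR_ge0.
  + exact: measurable_ring_in.
  + exact: measurable_ring_in.
pose c := (d%:R * (2 * geo_radius i)) `^ D.
have c0 : 0 <= c by exact: powR_ge0.
have step z : ring_in x (geo_radius i.+1) z ->
    (\int[mu]_(y in ring_in x (geo_radius i)) (`|u z - u y| `^ p)%:E <=
     c%:E * band p D u Omega (2 * geo_radius i.+1) (2 * geo_radius i) z)%E.
  move=> [[Oz /in_ball xz] _].
  rewrite -ge0_integralZl_EFin//; last 2 first.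
  - by move=> y _; rewrite lee_fin mulr_ge0 ?kernel_ge0.
  - exact: measurable_kernel_bandr.
  apply: (@le_trans _ _ (\int[mu]_(y in ring_in x (geo_radius i)) (c%:E *
      (gkernel p D u (z, y) * (in_band (2 * geo_radius i.+1) (2 * geo_radius i) (z, y))%:R)%:E))%E).
    apply: ge0_le_integral => //.
    - exact: measurable_ring_in.
    - by apply: dff; exact: measurable_ring_in.
    - by apply: measurable_funeM; apply: measurable_kernel_bandr => //; exact: measurable_ring_in.
    - move=> y [[Oy /in_ball xy] /in_ball/negP]; rewrite -leNgt => xy2.
      have rS : eps * geo_radius i = 4 * geo_radius i.+1 by rewrite geo_radiusS; field.
      have zy1 : 2 * geo_radius i.+1 <= `|z - y|.
        have := ler_distD z x y.
        by move: xz xy xy2; rewrite rS; set a := `|_|; set b := `|_|; lra.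
      have zy2 : `|z - y| < 2 * geo_radius i.
        have := ler_distD x z y; rewrite [`|z - x|]distrC; have := geo_radiusS_le i.
        by move: xz xy xy2; set a := `|_|; set b := `|_|; lra.
      rewrite -EFinM lee_fin /in_band /= zy1 zy2 mulr1.
      apply: diffp_le_kernel => //; last exact: ltW.
      by rewrite (lt_le_trans _ zy1)// mulr_gt0.
  apply: ge0_subset_integral => //.
  - exact: measurable_ring_in.
  - by apply: measurable_funeM; exact: measurable_kernel_bandr.
  - by move=> y _; rewrite mule_ge0// lee_fin mulr_ge0 ?kernel_ge0.
  - by move=> y [[]].
have mOb : measurable (Omega `&` ball x (geo_radius i)).
  by apply: measurableI => //; exact: measurable_ball_rV.
apply: (@le_trans _ _ (c%:E * e%:E)%E).
  apply: (@le_trans _ _ (c%:E * \int[mu]_(y in Omega `&` ball x (geo_radius i))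
      band p D u Omega (2 * geo_radius i.+1) (2 * geo_radius i) y)%E); last first.
    by rewrite lee_wpmul2l.
  rewrite -ge0_integralZl_EFin//; last 2 first.
  - by move=> y _; exact: band_ge0.
  - exact: measurable_band.
  apply: (@le_trans _ _ (\int[mu]_(y in ring_in x (geo_radius i.+1))
      (c%:E * band p D u Omega (2 * geo_radius i.+1) (2 * geo_radius i) y))%E).
    apply: ge0_le_integral => //.
    - exact: measurable_ring_in.
    - by move=> y _; apply: integral_ge0 => w _; rewrite lee_fin powR_ge0.
    - apply: (measurable_slice mu (f := fun z => (`|u z.1 - u z.2| `^ p)%:E)).
      + by apply: measurableT_comp => //; exact: measurable_diffp.
      + by move=> z; rewrite lee_fin powR_ge0.
      + exact: measurable_ring_in.
      + exact: measurable_ring_in.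
    - by apply: measurable_funeM; apply: measurable_band => //; exact: measurable_ring_in.
  apply: ge0_subset_integral => //.
  - exact: measurable_ring_in.
  - by apply: measurable_funeM; exact: measurable_band.
  - by move=> y _; rewrite mule_ge0// band_ge0.
  - move=> y [[Oy /in_ball xy] _]; split => //; apply/in_ball.
    by rewrite (lt_le_trans xy)// geo_radiusS_le.
rewrite -EFinM lee_fin.
have ccE : c = (d%:R * 2) `^ D * geo_radius i `^ D.
  by rewrite /c mulrA [LHS]powRM ?(ltW ri0)// mulr_ge0.
pose K1 := (d%:R * 2) `^ D / (kap ^+ 2 * (eps / 4) ^+ d).
have K10 : 0 <= K1.
  by rewrite divr_ge0 ?powR_ge0 ?mulr_ge0 ?exprn_ge0 ?divr_ge0 ?(ltW eps0) ?(ltW kap0).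
apply: (@le_trans _ _ (K1 * geo_radius i `^ (D - d%:R - d%:R) * e *
    (kap * geo_radius i.+1 ^+ d) * (kap * geo_radius i ^+ d))).
  rewrite le_eqVlt; apply/orP; left; apply/eqP.
  rewrite ccE geo_radiusS [(_ * geo_radius i) ^+ d]exprMn -(powRdd ri0) /K1.
  have : (eps / 4) ^+ d != 0 by rewrite gt_eqF ?exprn_gt0.
  move: ((eps / 4) ^+ d) (geo_radius i ^+ d) (_ `^ (_ - _)) (_ `^ D) => a1 a2 a3 a4 a10.
  by field; rewrite a10 gt_eqF.
have HK : K1 <= chain_cst by rewrite /chain_cst lerDl divr_ge0 ?powR_ge0 ?(ltW kap0).
clearbody K1.
have X0 : 0 <= K1 * geo_radius i `^ (D - d%:R - d%:R) * e by rewrite !mulr_ge0 ?powR_ge0.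
rewrite -!mulrA; apply: ler_pM => //.
- by rewrite !mulr_ge0 ?powR_ge0 ?exprn_ge0 ?(ltW kap0) ?(ltW ri0) ?(ltW ri1).
rewrite ler_wpM2l ?powR_ge0// ler_wpM2l// [kap * (_ * _)]mulrA ler_pM//.
- by rewrite mulr_ge0 ?exprn_ge0 ?(ltW kap0) ?(ltW ri1).
- by rewrite mulr_ge0 ?exprn_ge0 ?(ltW kap0) ?(ltW ri0).
Qed.

(** The chain of averages is closed at a finite scale by the energy at x itself. Only one volume is
    divided out, hence the exponent D - d. *)
Lemma point_le_ring x i g : Omega x -> (energy p D u Omega x <= g%:E)%E ->
  `|u x| <= abs_average mu u (ring_in x (geo_radius i)) +
  2 * (chain_cst * geo_radius i `^ (D - d%:R) * g) `^ p^-1.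
Proof.
move=> Ox Hg.
have ri0 := geo_radius_gt0 i.
have [m mE /andP[m0 mle]] := measure_ring_in Ox (introT andP (conj ri0 (geo_radius_le0 i))).
have g0 : 0 <= g by rewrite -lee_fin (le_trans _ Hg)// energy_ge0.
apply: (point_le_average (p := p) mu_u p1 (measurable_ring_in _ _) mE) => //.
- exact: lt_le_trans mle.
- by rewrite !mulr_ge0 ?powR_ge0 ?chain_cst_ge0.
pose c := (d%:R * geo_radius i) `^ D.
have c0 : 0 <= c by exact: powR_ge0.
apply: (@le_trans _ _ (c%:E * g%:E)%E).
  apply: (@le_trans _ _ (c%:E * energy p D u Omega x)%E); last by rewrite lee_wpmul2l.
  rewrite -ge0_integralZl_EFin//; last 2 first.
  - by move=> y _; rewrite lee_fin kernel_ge0.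
  - exact: measurable_kernelr.
  apply: (@le_trans _ _ (\int[mu]_(y in ring_in x (geo_radius i)) (c%:E * (gkernel p D u (x, y))%:E))%E).
    apply: ge0_le_integral => //.
    - exact: measurable_ring_in.
    - apply: measurableT_comp => //; apply: (measurable_funS measurableT) => //.
      exact: (measurableT_comp (measurable_diffp p mu_u) (pair1_measurable x)).
    - by apply: measurable_funeM; apply: measurable_kernelr => //; exact: measurable_ring_in.
    - move=> y [[Oy /in_ball xy] /in_ball/negP]; rewrite -leNgt => xy2.
      rewrite -EFinM lee_fin; apply: diffp_le_kernel => //; last exact: ltW.
      by rewrite (lt_le_trans _ xy2)// mulr_gt0.
  apply: ge0_subset_integral => //.
  - exact: measurable_ring_in.
  - by apply: measurable_funeM; exact: measurable_kernelr.
  - by move=> y _; rewrite mule_ge0// lee_fin kernel_ge0.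
  - by move=> y [[]].
rewrite -EFinM lee_fin.
pose K2 := d%:R `^ D / kap.
have K20 : 0 <= K2 by rewrite divr_ge0 ?powR_ge0 ?(ltW kap0).
apply: (@le_trans _ _ (K2 * geo_radius i `^ (D - d%:R) * g * (kap * geo_radius i ^+ d))).
  rewrite le_eqVlt; apply/orP; left; apply/eqP.
  rewrite /c powRM ?(ltW ri0)// -(powRd ri0) /K2.
  move: (geo_radius i ^+ d) (_ `^ (_ - _)) (_ `^ D) => a2 a3 a4.
  by field; rewrite gt_eqF.
have HK : K2 <= chain_cst.
  by rewrite /chain_cst lerDr divr_ge0 ?powR_ge0 ?mulr_ge0 ?exprn_ge0 ?divr_ge0 ?(ltW kap0) ?(ltW eps0).
clearbody K2.
rewrite -!mulrA; apply: ler_pM => //.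
- by rewrite !mulr_ge0 ?powR_ge0 ?exprn_ge0 ?(ltW kap0) ?(ltW ri0).
by rewrite ler_wpM2l ?powR_ge0// ler_wpM2l.
Qed.

Lemma average_ring0 x (M : R) : Omega x -> (\int[mu]_(x in Omega) `|u x|%:E <= M%:E)%E ->
  abs_average mu u (ring_in x (geo_radius 0)) <= M / (kap * r0 ^+ d).
Proof.
move=> Ox HM; have ri0 := geo_radius_gt0 0.
have [m mE /andP[m0 mle]] := measure_ring_in Ox (introT andP (conj ri0 (geo_radius_le0 0))).
have := le_trans _ HM => /(_ (\int[mu]_(y in ring_in x (geo_radius 0)) `|u y|%:E)%E) => H.
have {}H : (\int[mu]_(y in ring_in x (geo_radius 0)) `|u y|%:E <= M%:E)%E.
  apply: H; apply: ge0_subset_integral => //.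
  - exact: measurable_ring_in.
  - by do 2 apply: measurableT_comp => //; exact: measurable_funS mu_u.
  - by move=> y [[]].
have I0 : (0 <= \int[mu]_(y in ring_in x (geo_radius 0)) `|u y|%:E)%E.
  by apply: integral_ge0 => y _; rewrite lee_fin.
rewrite /abs_average [X in _ / fine X](_ : _ = m%:E)//=.
move: I0 H; case: (integral _ _ _) => [I| |] //=; rewrite !lee_fin => I0 H.
have -> : r0 = geo_radius 0 by rewrite /geo_radius expr0 mulr1.
by rewrite ler_pM// ?invr_ge0 ?(le_trans (ltW m0))// lef_pV2// posrE (lt_le_trans m0).
Qed.

End chain_of_averages.

(** * Pointwise bound *)

Section hedberg.
Context {R : realType}.
Implicit Types (T th eta sg p tau : R).

Let one_powR (t : R) : 1 `^ t = 1.
Proof. by rewrite powR1. Qed.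

Lemma powR_ge1 (a t : R) : 1 <= a -> 0 <= t -> 1 <= a `^ t.
Proof. by move=> a1 t0; rewrite -[leLHS](one_powR t); apply: le_powR2. Qed.

Lemma powR_gt1 (a t : R) : 1 < a -> 0 < t -> 1 < a `^ t.
Proof.
by move=> a1 t0; rewrite -[ltLHS](one_powR t); apply: gt0_ltr_powR; rewrite ?nnegrE// ltW// (lt_trans ltr01).
Qed.

Lemma powR_lt1 (a t : R) : 0 <= a < 1 -> 0 < t -> a `^ t < 1.
Proof.
move=> /andP[a0 a1] t0; rewrite -[ltRHS](one_powR t); apply: gt0_ltr_powR; rewrite ?nnegrE//.
Qed.

Lemma sum_geometric_le (B : R) m : 1 < B -> \sum_(j < m) B ^+ j <= B ^+ m / (B - 1).
Proof.
move=> B1; have B10 : 0 < B - 1 by rewrite subr_gt0.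
elim: m => [|m IH]; first by rewrite big_ord0 expr0 divr_ge0// ltW.
rewrite big_ord_recr/= (le_trans (lerD IH (lexx _)))//.
rewrite ler_pdivlMr// mulrDl divfK ?gt_eqF// exprS.
by rewrite mulrBr mulr1 addrC subrK mulrC.
Qed.

Lemma exists_expr_le (a e : R) : 0 <= a < 1 -> 0 < e -> exists m : nat, a ^+ m <= e.
Proof.
move=> /andP[a0 a1] e0.
have a1' : `|a| < 1 by rewrite ger0_norm.
have /cvgrPdist_le/(_ _ e0) := @cvg_expr _ a a1'.
move=> [N _ HN]; exists N; have := HN N (leqnn N).
by rewrite /= sub0r normrN ger0_norm ?exprn_ge0.
Qed.

(** The sum grows like th^(- eta m) while the last term decays, and they meet when T^(1/p) th^(m (sg
    + eta)) is about 1. At this m the sum is of order T to the power eta / (p (sg + eta)), which the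
    last hypothesis compares with 1 / tau. For T <= 1 the choice m = 0 suffices. *)
Lemma hedberg_balance th eta sg p tau : 0 < th < 1 -> 0 < eta -> 0 <= sg ->
  1 <= p -> p <= tau -> eta * tau <= p * (sg + eta) ->
  exists2 C : R, 0 < C & forall T, 0 <= T -> exists m : nat,
    \sum_(j < m) (th ^+ j) `^ (- eta) + T `^ p^-1 * (th ^+ m) `^ sg <= C * T `^ tau^-1.
Proof.
move=> /andP[th0 th1] eta0 sg0 p1 ptau etau.
have p0 : 0 < p by exact: lt_le_trans p1.
have tau0 : 0 < tau by exact: lt_le_trans ptau.
have se0 : 0 < sg + eta by rewrite ltr_wpDl.
have t0 j : 0 < th ^+ j by rewrite exprn_gt0.
have t1 j : th ^+ j <= 1 by rewrite exprn_ile1 ?ltW.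
pose B := th `^ (- eta).
have B1 : 1 < B.
  by rewrite /B powRN invf_gt1 ?powR_gt0// powR_lt1// (ltW th0).
have BE j : (th ^+ j) `^ (- eta) = B ^+ j.
  by rewrite -powR_mulrn ?(ltW th0)// -powRrM mulrC powRrM powR_mulrn// powR_ge0.
have B0 : 0 < B by exact: lt_trans B1.
pose C := 1 + (B / (B - 1) + B).
have B10 : 0 < B - 1 by rewrite subr_gt0.
have BB0 : 0 < B / (B - 1) + B by rewrite addr_gt0// divr_gt0.
exists C; first by rewrite ltr_pwDl// ltW.
move=> T T0; have [T1|T1] := leP T 1.
  exists 0%N; rewrite big_ord0 add0r expr0 powR1 mulr1.
  apply: (@le_trans _ _ (T `^ tau^-1)); last by rewrite ler_peMl ?powR_ge0// lerDl ltW.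
  have [->|Tn0] := eqVneq T 0; first by rewrite !powR0// invr_eq0 gt_eqF.
  by apply: ger_powR; [rewrite T1 lt_def Tn0 T0|rewrite lef_pV2].
have T00 : 0 < T by exact: lt_trans T1.
have Tp1 : 1 < T `^ p^-1 by rewrite powR_gt1// invr_gt0.
have Ex : exists m : nat, T `^ p^-1 * (th ^+ m) `^ (sg + eta) <= 1.
  have a01 : 0 <= th `^ (sg + eta) < 1.
    by rewrite powR_ge0/= powR_lt1// (ltW th0).
  have e0 : 0 < (T `^ p^-1)^-1 by rewrite invr_gt0 powR_gt0.
  have [m Hm] := exists_expr_le a01 e0.
  exists m; rewrite -ler_pdivlMl ?powR_gt0// mulr1; apply: le_trans Hm.
  by rewrite -[th ^+ m]powR_mulrn ?(ltW th0)// -powRrM mulrC powRrM powR_mulrn ?powR_ge0.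
(* The inequality at m bounds the last term by B^m; its failure at m - 1 bounds B^(m-1) by a power
   of T. *)
case: (ex_minnP Ex) => m Hm minm.
exists m.
have m0 : m != 0%N.
  by apply/eqP => m0; move: Hm; rewrite m0 expr0 powR1 mulr1 leNgt Tp1.
have [m' mE] : exists m', m = m'.+1 by exists m.-1; rewrite prednK// lt0n.
have Hm' : 1 < T `^ p^-1 * (th ^+ m') `^ (sg + eta).
  by rewrite ltNge; apply/negP => /minm; rewrite mE ltnn.
have Bm' : B ^+ m' <= T `^ tau^-1.
  have E : B ^+ m' = ((th ^+ m') `^ (- (sg + eta))) `^ (eta / (sg + eta)).
    by rewrite -BE -powRrM; congr (_ `^ _); field; rewrite gt_eqF.
  rewrite E; apply: (@le_trans _ _ ((T `^ p^-1) `^ (eta / (sg + eta)))).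
    apply: le_powR2; rewrite ?powR_ge0 ?divr_ge0 ?(ltW eta0) ?(ltW se0)//.
    by rewrite powRN -[leLHS]mul1r ler_pdivrMr ?powR_gt0// ltW.
  rewrite -powRrM ler_powR ?(ltW T1)//.
  have -> : p^-1 * (eta / (sg + eta)) = eta / (p * (sg + eta)) by field; rewrite !gt_eqF.
  by rewrite ler_pdivrMr ?mulr_gt0// mulrC ler_pdivlMr.
have T2 : T `^ p^-1 * (th ^+ m) `^ sg <= B ^+ m.
  rewrite -BE powRN -[leRHS]mul1r ler_pdivlMr ?powR_gt0// -mulrA -powR_add//.
have T3 : \sum_(j < m) (th ^+ j) `^ (- eta) <= B ^+ m / (B - 1).
  by under eq_bigr do rewrite BE; exact: sum_geometric_le.
apply: (le_trans (lerD T3 T2)); rewrite mE exprS.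
have -> : B * B ^+ m' / (B - 1) + B * B ^+ m' = (B / (B - 1) + B) * B ^+ m'.
  by field; rewrite gt_eqF.
rewrite /C [leRHS]mulrDl; apply: le_trans (ler_wpM2l (ltW BB0) Bm') _.
by rewrite mul1r lerDr powR_ge0.
Qed.

(* Hedberg's trick: the scale at which the two sources of error balance. *)
Lemma hedberg th p tau (kr dr : R) : 0 < th < 1 -> 1 <= p -> p <= tau ->
  0 <= kr <= dr -> 0 < dr -> tau * (dr - kr) <= dr * p ->
  exists2 C : R, 0 < C & forall rho G, 0 < rho -> 0 <= G -> exists m : nat,
    \sum_(j < m) ((rho * th ^+ j) `^ (kr - dr)) `^ p^-1 +
      ((rho * th ^+ m) `^ kr * G) `^ p^-1 <=
    C * (rho `^ (dr + (kr - dr) * (tau / p)) * G) `^ tau^-1.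
Proof.
move=> th01 p1 ptau /andP[kr0 krdr] dr0 tkd.
have p0 : 0 < p by exact: lt_le_trans p1.
have tau0 : 0 < tau by exact: lt_le_trans ptau.
have /andP[th0 th1] := th01.
(* With this value the condition of [hedberg_balance] and the bound (dr - kr) / p <= eta are both
   the hypothesis on tau (dr - kr). *)
pose eta := dr / tau.
have eta0 : 0 < eta by rewrite divr_gt0.
have etaE : (dr - kr) / p <= eta.
  by rewrite /eta ler_pdivrMr// mulrAC ler_pdivlMr// mulrC.
have H1 : eta * tau <= p * (kr / p + eta).
  rewrite /eta divfK ?gt_eqF// mulrDr mulrCA divff ?gt_eqF// mulr1.
  by rewrite -lerBlDl mulrA ler_pdivlMr// mulrC [p * dr]mulrC.
have kp0 : 0 <= kr / p by rewrite divr_ge0// ltW.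
have [C C0 HC] := hedberg_balance th01 eta0 kp0 p1 ptau H1.
exists C => // rho G rho0 G0.
have T0 : 0 <= rho `^ dr * G by rewrite mulr_ge0// powR_ge0.
have [m Hm] := HC _ T0; exists m.
set a := rho `^ ((kr - dr) / p).
have a0 : 0 <= a by exact: powR_ge0.
have t0 j : 0 < th ^+ j by rewrite exprn_gt0.
have t1 j : th ^+ j <= 1 by rewrite exprn_ile1 ?ltW.
have RE : (rho `^ (dr + (kr - dr) * (tau / p)) * G) `^ tau^-1 = a * (rho `^ dr * G) `^ tau^-1.
  rewrite powRM ?powR_ge0// [in RHS]powRM ?powR_ge0// [RHS]mulrA; congr (_ * _).
  rewrite -!powRrM -powR_add//; congr (_ `^ _).
  by field; rewrite !gt_eqF.
rewrite RE mulrCA; apply: le_trans (ler_wpM2l a0 Hm); rewrite mulrDr lerD//.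
  rewrite mulr_sumr; apply: ler_sum => j _.
  rewrite powRM ?(ltW rho0) ?(ltW (t0 j))// powRM ?powR_ge0// -!powRrM ler_wpM2l//.
  apply: ger_powR; first by rewrite t0 t1.
  by rewrite lerNl; apply: le_trans etaE; rewrite -mulNr opprB.
rewrite le_eqVlt; apply/orP; left; apply/eqP.
rewrite [LHS]powRM ?powR_ge0// [(rho * _) `^ kr]powRM ?(ltW rho0) ?(ltW (t0 m))//.
rewrite [(rho `^ kr * _) `^ _]powRM ?powR_ge0//.
rewrite [(rho `^ dr * G) `^ _]powRM ?powR_ge0// -!powRrM.
have -> : rho `^ (kr / p) = a * rho `^ (dr / p).
  by rewrite /a -powR_add//; congr (_ `^ _); field; rewrite gt_eqF.
by rewrite -!mulrA; congr (_ * (_ * _)); rewrite mulrC.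
Qed.

End hedberg.

Section hardy_weights.
Context {R : realType}.
Implicit Types (h J : nat -> R) (tau : R).

(* A discrete Hoelder inequality, up to the factor 2 ^ tau. *)
Lemma powR_sum_le h J (H tau : R) n : 1 <= tau -> (forall i, 0 < h i) ->
  (forall i, 0 <= J i) -> 0 < H -> \sum_(i < n) h i <= H ->
  (\sum_(i < n) J i) `^ tau <=
  2 `^ tau * (H `^ (tau - 1) * \sum_(i < n) h i `^ (1 - tau) * J i `^ tau).
Proof.
move=> tau1 h0 J0 H0 hH.
have tau0 : 0 < tau by exact: lt_le_trans tau1.
set X := \sum_(i < n) h i `^ (1 - tau) * _.
have X0 : 0 <= X by apply: sumr_ge0 => i _; rewrite mulr_ge0 ?powR_ge0.
(* Young's inequality is applied to J_i / h_i and summed with the masses h_i, whose total is at most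
   H. *)
have key : (\sum_(i < n) J i) / H <= 0 + 2 * (X / H) `^ tau^-1.
  apply: le_optimize => //; first by rewrite divr_ge0// ltW.
  move=> lam l0; rewrite add0r ler_pdivrMr//.
  have c0 : 0 <= lam / lam `^ tau by rewrite divr_ge0 ?powR_ge0 ?ltW.
  apply: (@le_trans _ _ (\sum_(i < n) (lam * h i + lam / lam `^ tau * (h i `^ (1 - tau) * J i `^ tau)))).
    apply: ler_sum => i _.
    have Jh0 : 0 <= J i / h i by rewrite divr_ge0// ltW.
    have := ler_wpM2l (ltW (h0 i)) (le_young l0 Jh0 tau1).
    rewrite mulrCA divff ?gt_eqF// mulr1 => /le_trans; apply.
    rewrite mulrDr [h i * lam]mulrC lerD2l.
    rewrite powRM ?invr_ge0 ?(ltW (h0 i))// powR_add// powRr1 ?(ltW (h0 i))//.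
    have -> : (h i)^-1 `^ tau = h i `^ (- tau).
      by rewrite -powR_inv1 ?(ltW (h0 i))// -powRrM mulN1r.
    rewrite le_eqVlt; apply/orP; left; apply/eqP; ring.
  rewrite big_split/= -!mulr_sumr -/X mulrDl -[X in _ <= _ + X]mulrA divfK ?gt_eqF//.
  by rewrite lerD2r ler_wpM2l// ltW.
rewrite add0r ler_pdivrMr// in key.
have S0 : 0 <= \sum_(i < n) J i by apply: sumr_ge0.
apply: (le_trans (le_powR2 (ltW tau0) S0 key)).
rewrite -[2 * _ * H]mulrA powRM ?mulr_ge0 ?powR_ge0 ?(ltW H0)// ler_wpM2l ?powR_ge0//.
rewrite powRM ?powR_ge0 ?(ltW H0)// -powRrM mulVf ?gt_eqF// powRr1 ?divr_ge0 ?(ltW H0)//.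
rewrite powR_add// powRN powRr1 ?(ltW H0)//.
by rewrite le_eqVlt; apply/orP; left; apply/eqP; ring.
Qed.

Lemma powR_add3_le (a b c tau : R) : 0 <= a -> 0 <= b -> 0 <= c -> 0 <= tau ->
  (a + b + c) `^ tau <= 3 `^ tau * (a `^ tau + b `^ tau + c `^ tau).
Proof.
move=> a0 b0 c0 tau0.
have [m [m0 am bm cm mE]] : exists m, [/\ 0 <= m, a <= m, b <= m, c <= m &
    m `^ tau <= a `^ tau + b `^ tau + c `^ tau].
  have a' := powR_ge0 a tau; have b' := powR_ge0 b tau; have c' := powR_ge0 c tau.
  have [ab|/ltW ba] := leP a b.
    have [bc|/ltW cb] := leP b c; [exists c|exists b]; split => //; try lra; exact: le_trans bc.
  have [ac|/ltW ca] := leP a c; [exists c|exists a]; split => //; try lra; exact: le_trans ac.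
apply: (@le_trans _ _ ((3 * m) `^ tau)).
  by apply: le_powR2; rewrite ?addr_ge0//; lra.
by rewrite powRM// ler_wpM2l ?powR_ge0.
Qed.

(* Summation by parts. *)
Lemma abel_sum_le (a b E P : nat -> R) (C : R) n :
  (forall i, 0 <= b i) -> (forall i, 0 <= E i) -> (forall i, 0 <= P i) ->
  (forall i, 0 <= a i <= P i - P i.+1) -> (forall i, P i * b i <= C) ->
  \sum_(l < n) a l * \sum_(i < l) b i * E i <= C * \sum_(i < n) E i.
Proof.
move=> b0 E0 P0 aP PC.
(* The boundary term P n makes the induction close. *)
suff : \sum_(l < n) a l * (\sum_(i < l) b i * E i) + P n * \sum_(i < n) b i * E i <=
    C * \sum_(i < n) E i.
  by apply: le_trans; rewrite lerDl mulr_ge0// sumr_ge0// => i _; rewrite mulr_ge0.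
elim: n => [|n IH]; first by rewrite !big_ord0 !mulr0 addr0.
rewrite !big_ord_recr/=; set S := \sum_(i < n) b i * E i in IH *.
have S0 : 0 <= S by apply: sumr_ge0 => i _; rewrite mulr_ge0.
have /andP[an0 anP] := aP n.
have H1 : a n * S + P n.+1 * S <= P n * S.
  by rewrite -mulrDl ler_wpM2r// -lerBrDr.
have H2 : P n.+1 * (b n * E n) <= C * E n.
  rewrite mulrA ler_wpM2r// (le_trans _ (PC n))// ler_wpM2r//; lra.
rewrite !mulrDr; lra.
Qed.

End hardy_weights.

Section pointwise_bound.
Context {R : realType} {d : nat}.
Local Notation mu := (lebesgue_rV (R := R) d).
Variables (k : nat) (p tau : R) (Omega : set 'rV[R]_d).
Hypotheses (k0 : (0 < k)%N) (kd : (k <= d)%N).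
Hypotheses (p1 : 1 <= p) (ptau : p <= tau) (tkd : tau * (d%:R - k%:R) <= d%:R * p).
Hypothesis mO : measurable Omega.
Variables (r0 eps kap M : R).
Hypotheses (r00 : 0 < r0) (eps0 : 0 < eps) (eps1 : eps < 1) (kap0 : 0 < kap) (M0 : 0 <= M).
Hypothesis ringP : forall (x : 'rV[R]_d) r, Omega x -> 0 < r <= r0 ->
  ((kap * r ^+ d)%:E <= mu (ring_in Omega eps x r))%E.

Let D : R := d%:R + k%:R.
Let alpha : R := d%:R + (k%:R - d%:R) * (tau / p).
Local Notation rad := (geo_radius r0 eps).

Definition local_energy (u : 'rV[R]_d -> R) i x : \bar R :=
  (\int[mu]_(y in Omega `&` ball x (rad i)) band p D u Omega (2 * rad i.+1) (2 * rad i) y)%E.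

Lemma local_energy_ge0 u i x : (0 <= local_energy u i x)%E.
Proof. by apply: integral_ge0 => y _; exact: band_ge0. Qed.

(** The three terms on the right stem from the average over the coarsest ring, the scales i < l, and
    Hedberg's trick at radius r_l. The parameters l, H and h stay free, to be fitted to the shell
    that contains x. *)
Lemma pointwise_bound : exists2 C : R, 0 < C & forall u : 'rV[R]_d -> R,
  measurable_fun setT u ->
  (\int[mu]_(x in Omega) `|u x|%:E <= M%:E)%E ->
  (\int[mu]_(x in Omega) energy p D u Omega x <= 1)%E ->
  forall x l H (h : nat -> R), Omega x -> (forall i, 0 < h i) -> 0 < H ->
  \sum_(i < l) h i <= H ->
  ((`|u x| `^ tau)%:E <= C%:E * (1 +
    (\sum_(i < l) (H `^ (tau - 1) * (h i `^ (1 - tau) * rad i `^ (alpha - d%:R)))%:E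
       * local_energy u i x) + (rad l `^ alpha)%:E * energy p D u Omega x))%E.
Proof.
have th0 : 0 < eps / 4 by rewrite divr_gt0.
have th01 : 0 < eps / 4 < 1 by rewrite th0/=; have := eps1; lra.
have p0 : 0 < p by exact: lt_le_trans p1.
have tau0 : 0 < tau by exact: lt_le_trans ptau.
have tau1 : 1 <= tau by exact: le_trans ptau.
have D0 : 0 <= D by rewrite addr_ge0.
have d0 : 0 < d%:R :> R by rewrite ltr0n (leq_trans k0).
have kdR : (0 <= (k%:R : R)) && ((k%:R : R) <= (d%:R : R)) by apply/andP; split; [exact: ler0n|rewrite ler_nat].
have [CH CH0 hed] := hedberg th01 p1 ptau kdR d0 tkd.
have rad0 i : 0 < rad i by exact: geo_radius_gt0.
pose K := chain_cst (d := d) D eps kap.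
have K0 : 0 <= K by exact: chain_cst_ge0.
pose a0 := M / (kap * r0 ^+ d).
have a00 : 0 <= a0 by rewrite divr_ge0 ?mulr_ge0 ?exprn_ge0 ?(ltW kap0) ?(ltW r00).
pose c := 2 * K `^ p^-1.
have c0 : 0 <= c by rewrite mulr_ge0 ?powR_ge0.
pose C1 := a0 `^ tau + 2 `^ tau * c `^ tau + (c * CH) `^ tau + 1.
have C10 : 0 < C1.
  by rewrite ltr_wpDl// !addr_ge0 ?mulr_ge0 ?powR_ge0.
exists (3 `^ tau * C1); first by rewrite mulr_gt0 ?powR_gt0.
move=> u mu_u Mu enu x l H h Ox h0 H0 hH.
have Iu : (\int[mu]_(x in Omega) `|u x|%:E < +oo)%E by rewrite (le_lt_trans Mu)// ltry.
set EE := energy p D u Omega x.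
have EE0 : (0 <= EE)%E by exact: energy_ge0.
have bandle i : (local_energy u i x <= 1)%E.
  apply: (@le_trans _ _ (\int[mu]_(y in Omega) energy p D u Omega y)%E) => //.
  apply: (@le_trans _ _ (\int[mu]_(y in Omega) band p D u Omega (2 * rad i.+1) (2 * rad i) y)%E).
    apply: ge0_subset_integral => //.
    - by apply: measurableI => //; exact: measurable_ball_rV.
    - exact: measurable_band.
    - by move=> y _; exact: band_ge0.
  have := @sum_int_band_le _ _ p D u Omega mu_u mO (fun j => 2 * rad (i + j)%N) 1.
  rewrite big_ord1 addn0 addn1; apply => j.
  by rewrite ler_pM2l// addnS geo_radiusS_le.
pose e i := fine (local_energy u i x).
have eE i : local_energy u i x = (e i)%:E.
  rewrite /e fineK// ge0_fin_numE ?local_energy_ge0//.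
  by rewrite (le_lt_trans (bandle i))// ltry.
have e0 i : 0 <= e i by rewrite -lee_fin -eE local_energy_ge0.
have e1 i : e i <= 1 by rewrite -lee_fin -eE.
pose w i := H `^ (tau - 1) * (h i `^ (1 - tau) * rad i `^ (alpha - d%:R)).
have w0 i : 0 <= w i by rewrite !mulr_ge0 ?powR_ge0.
have sumE : (\sum_(i < l) (w i)%:E * local_energy u i x = (\sum_(i < l) w i * e i)%:E)%E.
  by rewrite -sumEFin; apply: eq_bigr => i _; rewrite eE.
rewrite -/EE sumE.
have S0 : 0 <= \sum_(i < l) w i * e i by apply: sumr_ge0 => i _; rewrite mulr_ge0.
(* An infinite energy at x makes the right-hand side infinite. *)
case EEE : EE EE0 => [g| |//] EE0; last first.
  rewrite mulry gtr0_sg ?powR_gt0// mul1e -EFinD addey// gt0_muley ?leey//.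
  by rewrite lte_fin mulr_gt0 ?powR_gt0.
rewrite -[X in (1 + _ + X)%E]EFinM -[1%E]/(1%:E) -!EFinD -EFinM lee_fin; rewrite lee_fin in EE0.
pose J i := 2 * (K * rad i `^ (k%:R - d%:R) * e i) `^ p^-1.
have J0 i : 0 <= J i by rewrite mulr_ge0 ?powR_ge0.
have avn n : abs_average mu u (ring_in Omega eps x (rad n)) <= a0 + \sum_(i < n) J i.
  elim: n => [|n IH]; first by rewrite big_ord0 addr0; apply: average_ring0.
  rewrite big_ord_recr/= addrA.
  have He : (local_energy u n x <= (e n)%:E)%E by rewrite eE.
  have := average_ring_step p1 D0 mu_u mO r00 eps0 eps1 kap0 ringP Iu Ox He.
  have -> : D - d%:R - d%:R = k%:R - d%:R by rewrite /D; ring.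
  by move=> /le_trans; apply; rewrite lerD2r.
have [m Hm] := hed (rad l) g (rad0 l) EE0.
have radD j : rad (l + j)%N = rad l * (eps / 4) ^+ j by rewrite /geo_radius exprD mulrA.
have ub : `|u x| <= a0 + \sum_(i < l) J i + c * CH * (rad l `^ alpha * g) `^ tau^-1.
  have HE : (energy p D u Omega x <= g%:E)%E by rewrite -/EE EEE.
  have := point_le_ring p1 D0 mu_u mO r00 eps0 eps1 kap0 ringP Iu (l + m) Ox HE.
  have -> : D - d%:R = k%:R by rewrite /D; ring.
  move=> /le_trans; apply.
  rewrite (le_trans (lerD (avn _) (lexx _)))// big_split_ord/= -!addrA lerD2l lerD2l.
  rewrite -[c * CH * _]mulrA; apply: le_trans (ler_wpM2l c0 Hm).
  (* At the scales from l on, the local energies are bounded by 1; what is left is the geometric sum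
     of [hedberg]. *)
  rewrite mulrDr mulr_sumr; apply: lerD.
    apply: ler_sum => j _; rewrite /J /c -[2 * _ * _]mulrA ler_pM2l ?ltr0n//.
    rewrite -powRM ?powR_ge0// -radD; apply: le_powR2.
    - by rewrite invr_ge0 ltW.
    - by rewrite !mulr_ge0 ?powR_ge0.
    - by rewrite ler_piMr// mulr_ge0 ?powR_ge0.
  by rewrite /c -[2 * _ * _]mulrA -powRM ?mulr_ge0 ?powR_ge0// -radD mulrA.
apply: (le_trans (le_powR2 (ltW tau0) (normr_ge0 _) ub)).
rewrite (le_trans (powR_add3_le _ _ _ (ltW tau0)))//.
- by apply: sumr_ge0.
- by rewrite !mulr_ge0 ?powR_ge0 ?(ltW CH0).
rewrite -[leRHS]mulrA ler_wpM2l ?powR_ge0//.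
have T2 : (\sum_(i < l) J i) `^ tau <= 2 `^ tau * c `^ tau * \sum_(i < l) w i * e i.
  apply: (le_trans (powR_sum_le tau1 h0 J0 H0 hH)).
  rewrite -[_ * c `^ tau * _]mulrA ler_pM2l ?powR_gt0// !mulr_sumr; apply: ler_sum => i _.
  have Ji : J i `^ tau <= c `^ tau * (rad i `^ (alpha - d%:R) * e i).
    have -> : J i = c * (rad i `^ (k%:R - d%:R) * e i) `^ p^-1.
      by rewrite /J /c -[2 * _ * _]mulrA -powRM ?mulr_ge0 ?powR_ge0// mulrA.
    rewrite powRM ?powR_ge0// ler_wpM2l ?powR_ge0// -powRrM powRM ?powR_ge0// -powRrM.
    have -> : (k%:R - d%:R) * (p^-1 * tau) = alpha - d%:R.
      by rewrite /alpha; field; rewrite gt_eqF.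
    rewrite ler_wpM2l ?powR_ge0//.
    (* Since e i <= 1 and tau / p >= 1, the power of e i is at most e i; the estimate becomes linear
       in the energy. *)
    have pt1 : 1 <= p^-1 * tau by rewrite mulrC ler_pdivlMr// mul1r.
    have [->|en0] := eqVneq (e i) 0; first by rewrite powR0// gt_eqF// (lt_le_trans ltr01).
    rewrite -[leRHS]powRr1//; apply: ger_powR => //.
    by rewrite e1 lt_def en0 e0.
  apply: (@le_trans _ _ (H `^ (tau - 1) * (h i `^ (1 - tau) * (c `^ tau * (rad i `^ (alpha - d%:R) * e i))))).
    by rewrite ler_wpM2l ?powR_ge0// ler_wpM2l ?powR_ge0.
  by rewrite /w le_eqVlt; apply/orP; left; apply/eqP; ring.
have T3 : (c * CH * (rad l `^ alpha * g) `^ tau^-1) `^ tau = (c * CH) `^ tau * (rad l `^ alpha * g).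
  rewrite powRM ?mulr_ge0 ?powR_ge0 ?(ltW CH0)// -powRrM mulVf ?gt_eqF// powRr1//.
  by rewrite mulr_ge0 ?powR_ge0.
rewrite T3; apply: (le_trans (lerD (lerD (lexx _) T2) (lexx _))).
set S := \sum_(i < l) _ in S0 *; set G := rad l `^ alpha * g.
have G0 : 0 <= G by rewrite mulr_ge0 ?powR_ge0.
rewrite /C1.
have A1 := powR_ge0 a0 tau; have A2 : 0 <= 2 `^ tau * c `^ tau by rewrite mulr_ge0 ?powR_ge0.
have A3 := powR_ge0 (c * CH) tau.
move: (a0 `^ tau) (2 `^ tau * c `^ tau) ((c * CH) `^ tau) A1 A2 A3 => b1 b2 b3 A1 A2 A3.
have -> : (b1 + b2 + b3 + 1) * (1 + S + G) =
    (b1 + b2 * S + b3 * G) + (b1 * S + b1 * G + b2 + b2 * G + b3 + b3 * S + 1 + S + G) by ring.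
by rewrite lerDl !addr_ge0// mulr_ge0.
Qed.

End pointwise_bound.

(** * Hardy inequality *)

Lemma mem_ball_in_band {R : realType} {d : nat} (x y : 'rV[R]_d) r :
  (y \in (ball x r : set 'rV[R]_d)) = in_band 0 r (x, y).
Proof. by rewrite /in_band /= normr_ge0/=; apply/idP/idP; rewrite inE => /in_ball. Qed.

Section shell_integrals.
Context {R : realType} {d : nat}.
Local Notation mu := (lebesgue_rV (R := R) d).
Variables (k : nat) (p : R) (Omega : set 'rV[R]_d) (r0 eps : R).
Hypothesis mO : measurable Omega.
Variable u : 'rV[R]_d -> R.
Hypothesis mu_u : measurable_fun setT u.
Local Notation rad := (geo_radius r0 eps).
Local Notation LE := (local_energy k p Omega r0 eps u).
Let bnd i := band p (d%:R + k%:R) u Omega (2 * rad i.+1) (2 * rad i).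

Let mf i : measurable_fun setT (fun z : 'rV[R]_d * 'rV[R]_d =>
  (bnd i z.2 * (in_band 0 (rad i) z)%:R%:E)%E).
Proof.
apply: emeasurable_funM.
  by apply: (measurableT_comp _ measurable_snd); exact: measurable_band.
by apply: measurableT_comp => //; exact: measurable_in_band.
Qed.

Let f0 i (z : 'rV[R]_d * 'rV[R]_d) : (0 <= bnd i z.2 * (in_band 0 (rad i) z)%:R%:E)%E.
Proof. by rewrite mule_ge0// ?lee_fin// band_ge0. Qed.

(** The dependence of the domain on x is moved into the integrand, where joint measurability and
    Tonelli's theorem are available. *)
Lemma local_energyE i (x : 'rV[R]_d) :
  LE i x = (\int[mu]_(y in Omega) (bnd i y * (in_band 0 (rad i) (x, y))%:R%:E))%E.
Proof.
rewrite /local_energy integral_mkcondr; apply: eq_integral => y _.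
rewrite patchE mem_ball_in_band.
by case: in_band; rewrite ?mule1 ?mule0.
Qed.

Lemma measurable_local_energy i A : measurable A -> measurable_fun A (LE i).
Proof.
move=> mA; rewrite (_ : LE i = fun x => \int[mu]_(y in Omega)
    (bnd i y * (in_band 0 (rad i) (x, y))%:R%:E))%E; last first.
  by apply/funext => x; exact: local_energyE.
exact: (measurable_slice mu (mf i) (f0 i) mA mO).
Qed.

(** After exchanging the integrals, y is weighted by the volume of the part of A within r_i of y. *)
Lemma integral_local_energy_le i (A : set 'rV[R]_d) (m : R) : measurable A ->
  (forall y : 'rV[R]_d, (mu (A `&` ball y (rad i)) <= m%:E)%E) ->
  (\int[mu]_(x in A) LE i x <= m%:E * \int[mu]_(y in Omega) bnd i y)%E.
Proof.
move=> mA Am.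
have m0 : 0 <= m by rewrite -lee_fin (le_trans _ (Am 0)).
under eq_integral do rewrite local_energyE.
rewrite (tonelli_setX _ _ (mf i) (f0 i) mA mO) /=.
rewrite -ge0_integralZl_EFin//; last 2 first.
- by move=> y _; exact: band_ge0.
- exact: measurable_band.
apply: ge0_le_integral => //.
- by move=> y _; apply: integral_ge0 => x _; exact: (f0 i (x, y)).
- have mf' : measurable_fun setT (fun z : 'rV[R]_d * 'rV[R]_d =>
      (bnd i z.1 * (in_band 0 (rad i) (z.2, z.1))%:R%:E)%E).
    have := measurableT_comp (mf i) (@measurable_swap _ _ _ _); exact.
  have f0' (z : 'rV[R]_d * 'rV[R]_d) : (0 <= bnd i z.1 * (in_band 0 (rad i) (z.2, z.1))%:R%:E)%E.
    by rewrite mule_ge0// ?lee_fin// band_ge0.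
  exact: (measurable_slice mu mf' f0' mO mA).
- by apply: measurable_funeM; exact: measurable_band.
move=> y _; rewrite ge0_integralZl//.
  rewrite muleC lee_wpmul2r ?band_ge0//; apply: le_trans (Am y).
  rewrite -[leRHS]mul1e -integral_cst; last by apply: measurableI => //; exact: measurable_ball_rV.
  rewrite integral_mkcondr le_eqVlt; apply/orP; left; apply/eqP.
  apply: eq_integral => x _; rewrite patchE mem_ball_in_band /in_band /= distrC.
  by case: (_ && _).
  apply: measurableT_comp => //.
  apply: (measurable_funS measurableT) => //.
  exact: (measurableT_comp (measurable_in_band 0 (rad i)) (@pair2_measurable _ _ _ _ y)).
exact: band_ge0.
Qed.

End shell_integrals.

Section hardy_unit.
Context {R : realType} {d : nat}.
Local Notation mu := (lebesgue_rV (R := R) d).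
Variables (k : nat) (p tau : R) (Omega K : set 'rV[R]_d).
Hypotheses (k0 : (0 < k)%N) (kd : (k <= d)%N).
Hypotheses (p1 : 1 <= p) (ptau : p <= tau) (tkd : tau * (d%:R - k%:R) <= d%:R * p).
Hypothesis mO : measurable Omega.
Variables (r0 eps kap M : R).
Hypotheses (r00 : 0 < r0) (eps0 : 0 < eps) (eps1 : eps < 1) (kap0 : 0 < kap) (M0 : 0 <= M).
Hypothesis ringP : forall (x : 'rV[R]_d) r, Omega x -> 0 < r <= r0 ->
  ((kap * r ^+ d)%:E <= mu (ring_in Omega eps x r))%E.
Local Notation rad := (geo_radius r0 eps).
Let alpha : R := d%:R + (k%:R - d%:R) * (tau / p).

Hypothesis (K0 : K !=set0) (cK : compact K).
Variables (CK MO : R).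
Hypotheses (CK0 : 0 < CK) (MO0 : 0 <= MO) (muO : (mu Omega <= MO%:E)%E).
Hypothesis tubeloc : forall z t rho, 0 < t <= rho -> rho <= r0 ->
  (mu (tube K t `&` ball z rho) <= (CK * t ^+ k * rho ^+ (d - k))%:E)%E.
Hypothesis tubeglob : forall t, 0 < t <= r0 -> (mu (tube K t) <= (CK * t ^+ k)%:E)%E.

Lemma measurable_tube t : measurable (tube K t).
Proof. by apply: open_measurable_rV; exact: open_edistance_lt. Qed.

Lemma measurable_compact_rV : measurable K.
Proof.
rewrite -[K]setCK; apply: measurableC; apply: open_measurable_rV.
rewrite openC; apply: compact_closed => //; exact: norm_hausdorff.
Qed.

Lemma measure_compact_tube0 : mu K = 0.
Proof.
apply/eqP; rewrite eq_le measure_ge0 andbT; apply/lee_addgt0Pr => e e0; rewrite add0e.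
have [t [t0 tr te]] : exists t, [/\ 0 < t, t <= r0 & CK * t <= e /\ t <= 1].
  exists (Num.min r0 (Num.min 1 (e / CK))).
  rewrite !lt_min r00 ltr01 divr_gt0//= !ge_min !lexx ?orbT; split => //; split => //.
  rewrite mulrC -ler_pdivlMr// !ge_min lexx !orbT//.
have [te1 t1] := te.
apply: (@le_trans _ _ (mu (tube K t))).
  apply: le_measure; rewrite ?inE; [exact: measurable_compact_rV|exact: measurable_tube|].
  by move=> x Kx; rewrite /tube /= edistance_eq0.
apply: (le_trans (tubeglob _)); first by rewrite t0.
rewrite lee_fin (le_trans _ te1)// ler_pM2l//.
by rewrite -[leRHS]expr1 ler_wiXn2l ?(ltW t0).
Qed.

(** Shell 0 has no outer bound, so that the shells cover the whole complement of K. *)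
Definition shell (l : nat) : set 'rV[R]_d :=
  [set x | rad l.+1 <= edistance K x /\ (l != 0%N -> edistance K x < rad l)].

Lemma measurable_shell l : measurable (shell l).
Proof.
have -> : shell l = (~` tube K (rad l.+1)) `&` (if l == 0%N then setT else tube K (rad l)).
  apply/seteqP; split => x /=; rewrite /shell/=.
    by move=> [H1 H2]; split; [rewrite /tube/=; apply/negP; rewrite -leNgt|case: eqVneq H2 => //= _; exact].
  move=> [/negP]; rewrite -leNgt => H1 H2; split => // l0.
  by move: H2; rewrite (negbTE l0).
apply: measurableI; first by apply: measurableC; exact: measurable_tube.
by case: ifP => // _; exact: measurable_tube.
Qed.

Lemma shell_cover x : ~ K x -> exists l, shell l x.
Proof.
move=> nKx.
have e0 : 0 < edistance K x.
  rewrite lt_def edistance_ge0 andbT; apply/eqP => E; apply: nKx.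
  have clK : closed K by apply: compact_closed => //; exact: norm_hausdorff.
  apply: clK => A /nbhs_ballP[e /= e0 xA].
  have [y Ky xy] : exists2 y, K y & enorm (x - y) < e by apply: edistance_ltP => //; rewrite E.
  exists y; split => //; apply: xA; apply/in_ball.
  by rewrite (le_lt_trans (norm_le_enorm _)).
have Ex : exists l : nat, rad l.+1 <= edistance K x.
  have th : 0 <= eps / 4 < 1 by rewrite divr_ge0 ?(ltW eps0)//=; have := eps1; lra.
  have [m Hm] := exists_expr_le th (divr_gt0 e0 r00).
  exists m; rewrite (le_trans (geo_radiusS_le r00 eps0 eps1 m))//.
  by rewrite /geo_radius mulrC -ler_pdivlMr.
case: (ex_minnP Ex) => l Hl minl; exists l; split => // l0.
rewrite ltNge; apply/negP => H.
have := minl l.-1; rewrite prednK ?lt0n// => /(_ H).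
by rewrite leqNgt ltn_predL lt0n l0.
Qed.

Variables (om h H P : nat -> R) (w : 'rV[R]_d -> R) (Cw Cs : R).
Hypotheses (h0 : forall i, 0 < h i) (hH : forall l, \sum_(i < l) h i <= H l)
  (H1 : forall l, 1 <= H l) (om01 : forall l, 0 <= om l <= 1) (P0 : forall l, 0 <= P l)
  (omP : forall l, om l * rad l `^ (k%:R - alpha) * H l `^ (tau - 1) <= P l - P l.+1)
  (Ps : forall i, P i * (h i `^ (1 - tau) * rad i `^ (alpha - k%:R)) <= Cs).
Hypotheses (mw : measurable_fun Omega w) (w0 : forall x, 0 <= w x) (Cw0 : 0 < Cw)
  (wle : forall x l, Omega x -> ~ K x -> shell l x -> w x <= Cw * (om l * rad l `^ (- alpha))).

(** Integrating local energy i over shell l costs r_l^k r_i^(d - k) times the band energy e_i. The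
    double sum then has the shape a_l b_i e_i of [abel_sum_le]: [omP] bounds a_l by the decrease of
    P, [Ps] bounds P_i b_i, and the e_i add up to at most 1. *)
Lemma hardy_unit : exists2 C : R, 0 < C & forall u : 'rV[R]_d -> R,
  measurable_fun setT u ->
  (\int[mu]_(x in Omega) `|u x|%:E <= M%:E)%E ->
  (\int[mu]_(x in Omega) energy p (d%:R + k%:R) u Omega x <= 1)%E ->
  (\int[mu]_(x in Omega) (`|u x| `^ tau * w x)%:E <= C%:E)%E.
Proof.
have [C0 C00 pw] := pointwise_bound k0 kd p1 ptau tkd mO r00 eps0 eps1 kap0 M0 ringP.
have rad0 i : 0 < rad i by exact: geo_radius_gt0.
have Cs0 : 0 <= Cs by apply: le_trans (Ps 0); rewrite !mulr_ge0 ?powR_ge0.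
have tau1 : 0 <= tau - 1 by rewrite subr_ge0 (le_trans p1).
(* The second summand accounts for shell 0, which is controlled only by the volume of Omega. *)
pose M2 := CK + MO / r0 ^+ k.
have M20 : 0 < M2 by rewrite ltr_pwDl// divr_ge0 ?exprn_ge0 ?(ltW r00).
pose c1 := C0 * Cw; have c10 : 0 < c1 by rewrite mulr_gt0.
pose C := 2 * c1 + 2 * (c1 * (M2 * P 0 + CK * Cs)).
exists C.
  by rewrite ltr_pwDl ?mulr_gt0// mulr_ge0// mulr_ge0 ?(ltW c10)// addr_ge0// mulr_ge0 ?(ltW M20) ?(ltW CK0).
move=> u mu_u Mu enu.
pose E x := energy p (d%:R + k%:R) u Omega x.
pose LE i x := local_energy k p Omega r0 eps u i x.
pose v l i := H l `^ (tau - 1) * (h i `^ (1 - tau) * rad i `^ (alpha - d%:R)).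
pose cl l := c1 * (om l * rad l `^ (- alpha)).
have om0 l : 0 <= om l by case/andP: (om01 l).
have cl0 l : 0 <= cl l by rewrite !mulr_ge0 ?powR_ge0 ?(ltW C00) ?(ltW Cw0).
have v0 l i : 0 <= v l i by rewrite !mulr_ge0 ?powR_ge0.
pose A l x : \bar R := ((cl l)%:E * (1 + \sum_(i < l) (v l i)%:E * LE i x))%E.
(* The integrand on shell l is at most [A l] plus a multiple of the energy [E], hence twice the
   larger one. Index 0 collects, over all of Omega, the points where [E] wins; index l + 1 those of
   shell l where [A l] wins. *)
pose t j x : \bar R := (2%:E * (if j is l.+1 then A l x else c1%:E * E x))%E.
pose S j : set 'rV[R]_d := if j is l.+1 then shell l else setT.
have mK : measurable K by exact: measurable_compact_rV.
have mOK : measurable (Omega `\` K) by exact: measurableD.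
have mF : measurable_fun Omega (fun x => (`|u x| `^ tau * w x)%:E).
  apply: measurableT_comp => //; apply: measurable_funM => //.
  apply: (measurable_funS measurableT) => //.
  by apply: (measurableT_comp (measurable_powR tau)); exact: measurableT_comp.
have F0 x : (0 <= (`|u x| `^ tau * w x)%:E)%E by rewrite lee_fin mulr_ge0 ?powR_ge0.
have E0 x : (0 <= E x)%E by exact: energy_ge0.
have LE0 i x : (0 <= LE i x)%E by exact: local_energy_ge0.
have sum0 l x : (0 <= \sum_(i < l) (v l i)%:E * LE i x)%E.
  by apply: sume_ge0 => i _; rewrite mule_ge0 ?lee_fin.
have A0 l x : (0 <= A l x)%E by rewrite /A mule_ge0 ?lee_fin// adde_ge0.
have mLE i B : measurable B -> measurable_fun B (LE i).
  by move=> mB; exact: measurable_local_energy.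
have mA l B : measurable B -> measurable_fun B (A l).
  move=> mB; apply: measurable_funeM; apply: emeasurable_funD => //.
  by apply: emeasurable_sum => i; apply: measurable_funeM; exact: mLE.
have mE B : measurable B -> measurable_fun B E by move=> mB; exact: measurable_energy.
have -> : (\int[mu]_(x in Omega) (`|u x| `^ tau * w x)%:E =
           \int[mu]_(x in Omega `\` K) (`|u x| `^ tau * w x)%:E)%E.
  rewrite -ge0_negligible_integral//.
  exact: measure_compact_tube0.
apply: (integral_le_cover mOK _ _ (S := S) (t := t)) => //.
- by apply: measurable_funS mF.
- by case=> [|l]; [exact: measurableT|exact: measurable_shell].
- case=> [|l]; apply: measurable_funeM; last exact: mA.
  by apply: measurable_funeM; exact: mE.
- by case=> [|l] x _; rewrite /t mule_ge0// mule_ge0// lee_fin ltW.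
- move=> x [Ox nKx]; have [l xl] := shell_cover nKx.
  have Hl0 : 0 < H l by exact: lt_le_trans (H1 l).
  have := pw u mu_u Mu enu x l (H l) h Ox h0 Hl0 (hH l).
  rewrite -/(alpha) -/(E x) => pwx.
  have FAB : ((`|u x| `^ tau * w x)%:E <= A l x + c1%:E * E x)%E.
    have wx := wle Ox nKx xl.
    have X0 : (0 <= C0%:E * (1 + (\sum_(i < l) (v l i)%:E * LE i x) + (rad l `^ alpha)%:E * E x))%E.
      by rewrite mule_ge0 ?lee_fin ?(ltW C00)// !adde_ge0// mule_ge0// lee_fin powR_ge0.
    rewrite mulrC EFinM.
    apply: (@le_trans _ _ ((Cw * (om l * rad l `^ (- alpha)))%:E *
       (C0%:E * (1 + (\sum_(i < l) (v l i)%:E * LE i x) + (rad l `^ alpha)%:E * E x)))%E).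
      by apply: lee_pmul => //; rewrite ?lee_fin ?powR_ge0.
    rewrite muleA -EFinM (_ : Cw * _ * C0 = cl l); last by rewrite /cl /c1; ring.
    rewrite ge0_muleDr; last 2 first.
    - by rewrite adde_ge0.
    - by rewrite mule_ge0// lee_fin powR_ge0.
    apply: leeD2l; rewrite muleA -EFinM lee_wpmul2r// lee_fin.
    have -> : cl l * rad l `^ alpha = c1 * om l.
      by rewrite /cl powRN; field; rewrite gt_eqF// powR_gt0.
    by rewrite ler_piMr ?(ltW c10)//; case/andP: (om01 l).
  have [AE|EA] := leP (A l x) (c1%:E * E x)%E.
    exists 0%N => //=; rewrite /t; apply: (le_trans FAB).
    by rewrite mule_natl mule2n; exact: leeD2r.
  exists l.+1 => //=; rewrite /t; apply: (le_trans FAB).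
  by rewrite mule_natl mule2n; apply: leeD2l; exact: ltW.
pose Eb i : \bar R := (\int[mu]_(y in Omega) band p (d%:R + k%:R) u Omega (2 * rad i.+1) (2 * rad i) y)%E.
have Eb0 i : (0 <= Eb i)%E by apply: integral_ge0 => y _; exact: band_ge0.
have sumEb n : (\sum_(i < n) Eb i <= 1)%E.
  apply: le_trans enu; apply: (sum_int_band_le p (d%:R + k%:R) mu_u mO (r := fun i => 2 * rad i)) => i.
  by rewrite ler_pM2l// geo_radiusS_le.
have Eb1 i : (Eb i <= 1)%E.
  apply: le_trans (sumEb i.+1); rewrite big_ord_recr/= -[leLHS]add0e leeD2r//.
  exact: sume_ge0.
pose e i := fine (Eb i).
have eE i : Eb i = (e i)%:E.
  by rewrite /e fineK// ge0_fin_numE// (le_lt_trans (Eb1 i))// ltry.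
have e0 i : 0 <= e i by rewrite -lee_fin -eE.
have sume n : \sum_(i < n) e i <= 1.
  by rewrite -lee_fin -sumEFin; under eq_bigr do rewrite -eE; exact: sumEb.
pose b i := h i `^ (1 - tau) * rad i `^ (alpha - k%:R).
pose a l := om l * rad l `^ (k%:R - alpha) * H l `^ (tau - 1).
have a0 l : 0 <= a l by rewrite !mulr_ge0 ?powR_ge0.
have b0 l : 0 <= b l by rewrite !mulr_ge0 ?powR_ge0.
have mul l : (mu ((Omega `\` K) `&` shell l) <= (M2 * rad l ^+ k)%:E)%E.
  have [->|l0] := eqVneq l 0%N.
    apply: (@le_trans _ _ MO%:E).
      apply: le_trans muO; apply: le_measure; rewrite ?inE//; last by move=> x [[]].
      by apply: measurableI => //; exact: measurable_shell.
    rewrite lee_fin /geo_radius expr0 mulr1 /M2 mulrDl divfK; last by rewrite gt_eqF ?exprn_gt0.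
    by rewrite lerDr mulr_ge0 ?exprn_ge0 ?(ltW CK0) ?(ltW r00).
  apply: (@le_trans _ _ (mu (tube K (rad l)))).
    apply: le_measure; rewrite ?inE//; last by move=> x [_ [_ /(_ l0)]].
      by apply: measurableI => //; exact: measurable_shell.
    exact: measurable_tube.
  apply: (le_trans (tubeglob _)); first by rewrite rad0 (geo_radius_le0 r00 eps0 eps1).
  by rewrite lee_fin ler_pM2r ?exprn_gt0// /M2 lerDl divr_ge0 ?exprn_ge0 ?(ltW r00).
have radle i l : (i <= l)%N -> rad l <= rad i.
  move=> /subnK <-; elim: (l - i)%N => // n IH; rewrite addSn.
  exact: le_trans (geo_radiusS_le r00 eps0 eps1 _) IH.
(* Here l > i >= 0, so shell l has an outer bound and lies in the tube of radius r_l. *)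
have intLE l i : (i < l)%N -> (\int[mu]_(x in (Omega `\` K) `&` shell l) LE i x <=
    (CK * rad l ^+ k * rad i ^+ (d - k) * e i)%:E)%E.
  move=> il; rewrite EFinM -eE; apply: integral_local_energy_le => //.
    by apply: measurableI => //; exact: measurable_shell.
  move=> y; apply: le_trans (tubeloc y (t := rad l) (rho := rad i) _ _).
  - apply: le_measure; rewrite ?inE.
    + apply: measurableI; last exact: measurable_ball_rV.
      by apply: measurableI => //; exact: measurable_shell.
    + by apply: measurableI; [exact: measurable_tube|exact: measurable_ball_rV].
    + move=> x [[_ [_ xl]] xy]; split => //; apply: xl.
      by rewrite -lt0n (leq_ltn_trans _ il).
  - by rewrite rad0 radle// ltnW.
  - exact: geo_radius_le0.
have intA l : (\int[mu]_(x in (Omega `\` K) `&` shell l) A l x <=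
    (c1 * (M2 * a l + CK * (a l * \sum_(i < l) b i * e i)))%:E)%E.
  have mD : measurable ((Omega `\` K) `&` shell l).
    by apply: measurableI => //; exact: measurable_shell.
  rewrite /A ge0_integralZl_EFin//; last 2 first.
  - by move=> x _; rewrite adde_ge0.
  - apply: emeasurable_funD => //.
    by apply: emeasurable_sum => i; apply: measurable_funeM; exact: mLE.
  rewrite ge0_integralD//; last by apply: emeasurable_sum => i; apply: measurable_funeM; exact: mLE.
  rewrite integral_cst// mul1e ge0_integral_sum//; last 2 first.
  - by move=> i; apply: measurable_funeM; exact: mLE.
  - by move=> i x _; rewrite mule_ge0 ?lee_fin.
  apply: (@le_trans _ _ ((cl l)%:E * ((M2 * rad l ^+ k)%:E +
      (\sum_(i < l) v l i * (CK * rad l ^+ k * rad i ^+ (d - k) * e i))%:E))%E).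
    apply: lee_wpmul2l; first by rewrite lee_fin.
    apply: leeD; first exact: mul.
    rewrite -sumEFin; apply: lee_sum => i _.
    rewrite ge0_integralZl_EFin//; last exact: mLE.
    by rewrite [X in (_ <= X)%E]EFinM; apply: lee_wpmul2l; rewrite ?lee_fin// intLE.
  rewrite -EFinD -EFinM lee_fin /cl -[c1 * _ * _]mulrA ler_pM2l//.
  have rk : rad l `^ (- alpha) * rad l ^+ k = rad l `^ (k%:R - alpha).
    by rewrite -powR_mulrn ?(ltW (rad0 l))// -powR_add// addrC.
  rewrite mulrDr; apply: lerD.
    rewrite mulrCA ler_pM2l// -mulrA rk /a ler_peMr ?mulr_ge0 ?powR_ge0//.
    exact: powR_ge1.
  rewrite !mulr_sumr; apply: ler_sum => i _.
  have ri : rad i `^ (alpha - d%:R) * rad i ^+ (d - k) = rad i `^ (alpha - k%:R).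
    rewrite -powR_mulrn ?(ltW (rad0 i))// -powR_add// natrB//.
    by congr (_ `^ _); ring.
  rewrite /v /a /b -rk -ri le_eqVlt; apply/orP; left; apply/eqP.
  move: (rad l `^ _) (rad l ^+ k) (H l `^ _) (h i `^ _) (rad i `^ _) (rad i ^+ _) => x1 x2 x3 x4 x5 x6.
  by ring.
move=> n.
have A0' (j : nat) : (0 <= \int[mu]_(x in (Omega `\` K) `&` S j) t j x)%E.
  by apply: integral_ge0 => x _; case: j => [|l]; rewrite /t mule_ge0// mule_ge0// lee_fin ltW.
(* One more term makes the sum nonempty, so that the energy term j = 0 can be split off. *)
apply: (@le_trans _ _ (\sum_(j < n.+1) \int[mu]_(x in (Omega `\` K) `&` S j) t j x)%E).
  by rewrite big_ord_recr/= leeDl.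
rewrite big_ord_recl /C EFinD leeD//.
  rewrite /t /S setIT.
  rewrite ge0_integralZl_EFin//; last 2 first.
  - by move=> x _; rewrite mule_ge0// lee_fin ltW.
  - by apply: measurable_funeM; exact: mE.
  rewrite [X in (_ <= X)%E]EFinM; apply: lee_wpmul2l; first by rewrite lee_fin.
  rewrite ge0_integralZl_EFin ?(ltW c10)//; last exact: mE.
  rewrite -[leRHS]mule1; apply: lee_wpmul2l; first by rewrite lee_fin (ltW c10).
  apply: le_trans enu.
  by apply: ge0_subset_integral => //; exact: mE.
apply: (@le_trans _ _ (\sum_(l < n) (2 * (c1 * (M2 * a l + CK * (a l * \sum_(i < l) b i * e i))))%:E)%E).
  apply: lee_sum => l _; rewrite /t /S /= ge0_integralZl_EFin//.
  - by rewrite [X in (_ <= X)%E]EFinM; apply: lee_wpmul2l; rewrite ?lee_fin// intA.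
  - by apply: measurableI => //; exact: measurable_shell.
  - by apply: mA; apply: measurableI => //; exact: measurable_shell.
rewrite sumEFin lee_fin -!mulr_sumr ler_pM2l// ler_pM2l// big_split/= -!mulr_sumr.
apply: lerD.
  rewrite ler_pM2l//.
  have : \sum_(l < n) a l <= P 0 - P n.
    elim: (n) => [|m IH]; first by rewrite big_ord0 subrr.
    by rewrite big_ord_recr/=; have := omP m; rewrite -/(a m) => ?; lra.
  by move=> /le_trans; apply; rewrite lerBlDr lerDl.
rewrite ler_pM2l//.
have aP l : 0 <= a l <= P l - P l.+1 by rewrite a0/=; exact: omP.
apply: (le_trans (abel_sum_le n b0 e0 P0 aP Ps)).
by rewrite ler_piMr.
Qed.

End hardy_unit.

(** * Hoelder weights in the subcritical and the critical regime *)

Section weight_sequences.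
Context {R : realType}.
Variables (th r0 tau : R).
Hypotheses (th0 : 0 < th) (th1 : th < 1) (r00 : 0 < r0) (tau1 : 1 < tau).

(** The conditions on the sequences in [hardy_unit], with kappa = k - alpha and r0 th^l for the
    radii. P plays the part of the tail sums of the first product. *)
Definition weight_sequence (kappa : R) (om h H P : nat -> R) (Cs : R) : Prop :=
  [/\ forall i, 0 < h i, forall l, \sum_(i < l) h i <= H l, forall l, 1 <= H l,
   forall l, 0 <= P l &
   (forall l, om l * (r0 * th ^+ l) `^ kappa * H l `^ (tau - 1) <= P l - P l.+1) /\
   (forall i, P i * (h i `^ (1 - tau) * (r0 * th ^+ i) `^ (- kappa)) <= Cs)].

(** Here h_i = a^i, where a > 1 keeps the partial sums comparable to their last terms and a is close
    enough to 1 that q = th^kappa a^(tau - 1) < 1. P is the tail of the geometric series of ratio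
    q. *)
Lemma weight_sequence_power kappa : 0 < kappa ->
  exists h H P Cs, weight_sequence kappa (fun=> 1) h H P Cs.
Proof.
move=> kap0.
pose a := th `^ (- (kappa / (2 * tau))).
have tau0 : 0 < tau by exact: lt_trans tau1.
have a1 : 1 < a.
  by rewrite /a powRN invf_gt1 ?powR_gt0// powR_lt1 ?(ltW th0)// divr_gt0// mulr_gt0.
have a0 : 0 < a by exact: lt_trans a1.
have a10 : 0 < a - 1 by rewrite subr_gt0.
pose c := a / (a - 1).
have c1 : 1 <= c by rewrite /c ler_pdivlMr// mul1r gerBl.
have c0 : 0 < c by exact: lt_le_trans c1.
pose q := th `^ kappa * a `^ (tau - 1).
have q0 : 0 < q by rewrite mulr_gt0 ?powR_gt0.
have q1 : q < 1.
  rewrite /q /a -powRrM -powR_add// powR_lt1 ?(ltW th0)//.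
  have -> : kappa + - (kappa / (2 * tau)) * (tau - 1) = kappa * ((tau + 1) / (2 * tau)).
    by field; rewrite gt_eqF.
  by rewrite mulr_gt0// divr_gt0// ?mulr_gt0// addr_gt0.
pose B := r0 `^ kappa * c `^ (tau - 1).
have B0 : 0 < B by rewrite mulr_gt0 ?powR_gt0.
have q10 : 0 < 1 - q by rewrite subr_gt0.
have pX (b t : R) l : 0 < b -> (b ^+ l) `^ t = (b `^ t) ^+ l.
  by move=> b0; rewrite -powR_mulrn ?(ltW b0)// -powRrM mulrC powRrM powR_mulrn ?powR_ge0.
have t0 l : 0 < th ^+ l by rewrite exprn_gt0.
exists (fun i => a ^+ i), (fun l => c * a ^+ l), (fun l => B * q ^+ l / (1 - q)),
  (B / (1 - q) * r0 `^ (- kappa)).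
split.
- by move=> i; rewrite exprn_gt0.
- move=> l; apply: (le_trans (sum_geometric_le l a1)).
  rewrite /c mulrAC ler_pM2r ?invr_gt0// ler_peMl ?exprn_ge0 ?(ltW a0)//; exact: ltW.
- by move=> l; apply: (le_trans c1); rewrite ler_peMr ?(ltW c0)// exprn_ege1// ltW.
- by move=> l; rewrite divr_ge0 ?(ltW q10)// mulr_ge0 ?(ltW B0)// exprn_ge0// (ltW q0).
split.
- move=> l; rewrite mul1r powRM ?(ltW r00) ?(ltW (t0 l))// powRM ?(ltW c0) ?exprn_ge0 ?(ltW a0)//.
  rewrite !pX// exprS le_eqVlt; apply/orP; left; apply/eqP.
  rewrite /B [q ^+ l]exprMn; move: (_ ^+ l) (_ ^+ l) => x y.
  by field; rewrite gt_eqF.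
- move=> i; rewrite powRM ?(ltW r00) ?(ltW (t0 i))// !pX//.
  have -> : q ^+ i = (th `^ kappa) ^+ i * (a `^ (tau - 1)) ^+ i by rewrite exprMn.
  have -> : 1 - tau = - (tau - 1) by rewrite opprB.
  rewrite [th `^ (- _)]powRN [a `^ (- _)]powRN !exprVn le_eqVlt; apply/orP; left; apply/eqP.
  have x0 : th `^ kappa ^+ i != 0 by rewrite expf_neq0// gt_eqF ?powR_gt0.
  have y0 : a `^ (tau - 1) ^+ i != 0 by rewrite expf_neq0// gt_eqF ?powR_gt0.
  move: (th `^ kappa ^+ i) (a `^ (tau - 1) ^+ i) x0 y0 => x y x0 y0; field.
  by rewrite x0 y0 gt_eqF.
Qed.

(** The mean value inequality for the convex function x^(- sg), obtained from exp y >= 1 + y and ln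
    y <= y - 1. *)
Lemma powRN_diff_ge (sg x : R) : 0 < sg -> 0 < x ->
  sg * (x + 1) `^ (- (1 + sg)) <= x `^ (- sg) - (x + 1) `^ (- sg).
Proof.
move=> sg0 x0; have x1 : 0 < x + 1 by rewrite addr_gt0.
have xE : x = (x + 1) * (x / (x + 1)) by field; rewrite gt_eqF.
have y0 : 0 < x / (x + 1) by rewrite divr_gt0.
have -> : x `^ (- sg) = (x + 1) `^ (- sg) * (x / (x + 1)) `^ (- sg).
  by rewrite -powRM ?(ltW x1) ?(ltW y0)// -xE.
have -> : (x + 1) `^ (- (1 + sg)) = (x + 1) `^ (- sg) / (x + 1).
  have -> : - (1 + sg) = - sg + -1 by ring.
  by rewrite powR_add// powR_inv1// ltW.
rewrite mulrCA -[X in _ <= _ - X]mulr1 -mulrBr ler_wpM2l ?powR_ge0//.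
rewrite lerBrDr /powR gt_eqF// mulNr.
apply: (@le_trans _ _ (expR (sg / (x + 1)))).
  by rewrite addrC expR_ge1Dx.
rewrite ler_expR -mulrN ler_wpM2l ?(ltW sg0)//.
have := @le_ln1Dx R (x / (x + 1) - 1).
rewrite addrCA subrr addr0 => /(_ _) H.
rewrite lerNr; apply: le_trans (H _) _; first by rewrite ltrBrDl subrr.
by rewrite le_eqVlt; apply/orP; left; apply/eqP; field; rewrite gt_eqF.
Qed.

(** With h_i of order i^(-1/2) one has H_l of order l^(1/2), and l^(-tau) H_l^(tau - 1) is l^(-1 -
    sg) for sg = (tau - 1) / 2. This is summable with tail l^(- sg), and the tail exactly
    compensates the growth i^sg of h_i^(1 - tau). *)
Lemma weight_sequence_log :
  exists h H P Cs, weight_sequence 0 (fun l => (l.+1%:R) `^ (- tau)) h H P Cs.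
Proof.
pose sg := (tau - 1) / 2.
have sg0 : 0 < sg by rewrite divr_gt0// subr_gt0.
have tauE : tau - 1 = 2 * sg by rewrite /sg; field.
(* The power of 2 pays for replacing l + 2 by l + 1, the factor 1 / sg for the derivative of x^(-
   sg). *)
pose B := 2 `^ (1 + sg) / sg.
have B0 : 0 < B by rewrite divr_gt0 ?powR_gt0.
have n0 (i : nat) : (0 : R) < i.+1%:R by rewrite ltr0n.
exists (fun i => Num.sqrt i.+1%:R - Num.sqrt i%:R), (fun l => Num.sqrt l.+1%:R),
  (fun l => B * (l.+1%:R) `^ (- sg)), (B * 2 `^ (2 * sg)).
split.
- by move=> i; rewrite subr_gt0 ltr_sqrt ?ltr_nat.
- move=> l; apply: (@le_trans _ _ (Num.sqrt l%:R)); last by rewrite ler_wsqrtr// ler_nat.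
  elim: l => [|l IH]; first by rewrite big_ord0 sqrtr0.
  rewrite big_ord_recr/= (le_trans (lerD IH (lexx _)))//.
  by rewrite addrC subrK.
- by move=> l; rewrite -[leLHS]sqrtr1 ler_wsqrtr// ler1n.
- by move=> l; rewrite mulr_ge0 ?powR_ge0 ?(ltW B0).
have sq (i : nat) : Num.sqrt (i.+1%:R : R) = i.+1%:R `^ 2^-1 by rewrite powR12_sqrt.
split.
- move=> l; rewrite powRr0 mulr1 sq -powRrM -powR_add//.
  have -> : - tau + 2^-1 * (tau - 1) = - (1 + sg) by rewrite /sg; field.
  have := powRN_diff_ge sg0 (n0 l); rewrite natr1 -mulrBr => H.
  apply: le_trans (ler_wpM2l (ltW B0) H).
  rewrite mulrA /B divfK ?gt_eqF//.
  have -> : l.+1%:R `^ (- (1 + sg)) = 2 `^ (1 + sg) * (2 * l.+1%:R) `^ (- (1 + sg)) :> R.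
    by rewrite powRM// mulrA -powR_add// subrr powRr0 mul1r.
  rewrite ler_pM2l ?powR_gt0// [in leLHS]powRN [leRHS]powRN.
  have b0 : (0 : R) < 2 * l.+1%:R by rewrite mulr_gt0.
  rewrite lef_pV2 ?posrE ?powR_gt0//.
  apply: le_powR2 => //; first by rewrite addr_ge0// ltW.
  by have l0 := ler0n R l; rewrite -[l.+2%:R]natr1 -[l.+1%:R]natr1; lra.
- move=> i; rewrite oppr0 powRr0 mulr1.
  have -> : 1 - tau = - (2 * sg) by rewrite -tauE opprB.
  have hE : (2 * Num.sqrt i.+1%:R)^-1 <= Num.sqrt i.+1%:R - Num.sqrt i%:R :> R.
    have s0 : 0 < Num.sqrt i.+1%:R :> R by rewrite sqrtr_gt0.
    have le_s : Num.sqrt i%:R <= Num.sqrt i.+1%:R :> R by rewrite ler_wsqrtr// ler_nat.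
    have s1 : (Num.sqrt i.+1%:R - Num.sqrt i%:R) * (Num.sqrt i.+1%:R + Num.sqrt i%:R) = 1 :> R.
      by rewrite -subr_sqr !sqr_sqrtr// -natr1 addrAC subrr add0r.
    rewrite -[leLHS]mul1r -[X in X / _]s1 ler_pdivrMr ?mulr_gt0// ler_wpM2l ?subr_ge0//.
    by rewrite mulrDl mul1r lerD2l.
  rewrite -mulrA ler_wpM2l ?(ltW B0)//.
  apply: (@le_trans _ _ (i.+1%:R `^ (- sg) * (2 * Num.sqrt i.+1%:R) `^ (2 * sg))).
    have s2 : 0 < 2 * Num.sqrt i.+1%:R :> R by rewrite mulr_gt0// sqrtr_gt0.
    have h2 : 0 < Num.sqrt i.+1%:R - Num.sqrt i%:R :> R.
      by rewrite subr_gt0 ltr_sqrt ?ltr_nat.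
    rewrite ler_wpM2l ?powR_ge0// powRN -[leRHS]invrK lef_pV2 ?posrE ?invr_gt0 ?powR_gt0//.
    have -> : ((2 * Num.sqrt i.+1%:R) `^ (2 * sg))^-1 = (2 * Num.sqrt i.+1%:R)^-1 `^ (2 * sg) :> R.
      by rewrite -[in RHS]powR_inv1 ?(ltW s2)// -powRrM mulN1r powRN.
    by apply: le_powR2; [rewrite mulr_ge0 ?(ltW sg0)|rewrite invr_ge0 (ltW s2)|exact: hE].
  rewrite powRM ?sqrtr_ge0// sq -powRrM (_ : 2^-1 * (2 * sg) = sg); last by field.
  rewrite mulrCA -powR_add//.
  by rewrite addNr powRr0 mulr1.
Qed.

End weight_sequences.

Section scaling.
Context {R : realType} {d : nat}.
Local Notation mu := (lebesgue_rV (R := R) d).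
Variables (s p tau : R) (Omega : set 'rV[R]_d) (MO : R) (w : 'rV[R]_d -> R).
Hypotheses (p1 : 1 <= p) (tau0 : 0 < tau) (mO : measurable Omega).
Hypotheses (MO0 : 0 <= MO) (muO : (mu Omega <= MO%:E)%E).
Hypotheses (mw : measurable_fun Omega w) (w0 : forall x, 0 <= w x).

Let D := d%:R + s * p.

Lemma le_powR_add1 (t : R) : 0 <= t -> t <= 1 + t `^ p.
Proof.
move=> t0; have [t1|t1] := leP t 1; first by rewrite (le_trans t1)// lerDl powR_ge0.
by rewrite -[leLHS]add0r lerD// -{1}[t]powRr1// ler_powR// ltW.
Qed.

(** By homogeneity u is divided by b with b^p at least the p-th power of its norm. The bound t <= 1
    + t^p then gives the integral of |u| / b at most MO + 1, and the energy is at most 1. *)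
Lemma scaled_hardy (C : R) : 0 < C ->
  (forall u : 'rV[R]_d -> R, measurable_fun setT u ->
    (\int[mu]_(x in Omega) `|u x|%:E <= (MO + 1)%:E)%E ->
    (\int[mu]_(x in Omega) energy p D u Omega x <= 1)%E ->
    (\int[mu]_(x in Omega) (`|u x| `^ tau * w x)%:E <= C%:E)%E) ->
  forall u, sobolev s p Omega u ->
    ((\int[mu]_(x in Omega) (`|u x| `^ tau * w x)%:E) `^ tau^-1
      <= (C `^ tau^-1)%:E * (gagliardo s p Omega u
                 + \int[mu]_(x in Omega) (`|u x| `^ p)%:E) `^ p^-1)%E.
Proof.
move=> C0 unit u [mu_u Iu gu].
have p0 : 0 < p by exact: lt_le_trans p1.
set Lp := (\int[mu]_(x in Omega) (`|u x| `^ p)%:E)%E in Iu *.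
set G := gagliardo s p Omega u in gu *.
set I := (\int[mu]_(x in Omega) (`|u x| `^ tau * w x)%:E)%E.
have Lp0 : (0 <= Lp)%E by apply: integral_ge0 => x _; rewrite lee_fin powR_ge0.
have G0 : (0 <= G)%E.
  apply: integral_ge0 => x _; apply: integral_ge0 => y _.
  by rewrite lee_fin divr_ge0 ?powR_ge0.
have I0 : (0 <= I)%E by apply: integral_ge0 => x _; rewrite lee_fin mulr_ge0 ?powR_ge0.
have [l lE] : exists l, Lp = l%:E.
  by exists (fine Lp); rewrite fineK// ge0_fin_numE.
have [g gE] : exists g, G = g%:E.
  by exists (fine G); rewrite fineK// ge0_fin_numE.
rewrite lE gE -EFinD poweR_EFin -EFinM.
rewrite lE lee_fin in Lp0; rewrite gE lee_fin in G0.
(* Extension by zero makes the function measurable on the whole space. *)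
pose v := u \_ Omega.
have mv : measurable_fun setT v by apply/(measurable_restrictT _ mO).
have vE x : Omega x -> v x = u x by move=> Ox; rewrite /v patchE mem_set.
have key (b : R) : 0 < b -> g + l <= b `^ p -> (I <= (C * b `^ tau)%:E)%E.
  move=> b0 glb.
  have bp0 : 0 < b `^ p by exact: powR_gt0.
  pose vb x := b^-1 * v x.
  have mvb : measurable_fun setT vb by exact: measurable_funM.
  have binv (t : R) : 0 <= t -> b^-1 `^ t = (b `^ t)^-1.
    by move=> _; rewrite -powR_inv1 ?(ltW b0)// -powRrM mulN1r powRN.
  have vbE x (t : R) : 0 <= t -> Omega x -> `|vb x| `^ t = (b `^ t)^-1 * `|u x| `^ t.
    move=> t0 Ox; rewrite /vb vE// normrM ger0_norm ?invr_ge0 ?(ltW b0)//.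
    by rewrite powRM ?invr_ge0 ?(ltW b0)// binv.
  have mup : measurable_fun Omega (fun x => (`|u x| `^ p)%:E).
    apply: measurableT_comp => //; apply: (measurableT_comp (measurable_powR p)).
    exact: measurableT_comp.
  have H1 : (\int[mu]_(x in Omega) `|vb x|%:E <= (MO + 1)%:E)%E.
    apply: (@le_trans _ _ (\int[mu]_(x in Omega) (1 + ((b `^ p)^-1)%:E * (`|u x| `^ p)%:E))%E).
      apply: ge0_le_integral => //.
      - by do 2 apply: measurableT_comp => //; exact: measurable_funS mvb.
      - by apply: emeasurable_funD => //; exact: measurable_funeM.
      - move=> x Ox; rewrite -EFinM -EFinD lee_fin -vbE ?(ltW p0)//.
        exact: le_powR_add1.
    rewrite ge0_integralD//; last 2 first.
    - by move=> x _; rewrite mule_ge0 ?lee_fin ?powR_ge0// invr_ge0 powR_ge0.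
    - exact: measurable_funeM.
    rewrite integral_cst// mul1e ge0_integralZl_EFin// ?invr_ge0 ?powR_ge0//.
    rewrite -/Lp lE -EFinM EFinD; apply: leeD => //.
    rewrite lee_fin mulrC ler_pdivrMr// mul1r; apply: le_trans glb.
    by rewrite lerDr.
  have H2 : (\int[mu]_(x in Omega) energy p D vb Omega x <= 1)%E.
    have -> : (\int[mu]_(x in Omega) energy p D vb Omega x =
        \int[mu]_(x in Omega) (((b `^ p)^-1)%:E * energy p D v Omega x))%E.
      apply: eq_integral => x _; rewrite /energy -ge0_integralZl_EFin//; last 3 first.
      - by move=> y _; rewrite lee_fin kernel_ge0.
      - exact: measurable_kernelr.
      - by rewrite invr_ge0 powR_ge0.
      apply: eq_integral => y _; rewrite -EFinM /gkernel /= mulrA; congr (_ / _)%:E.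
      rewrite /vb -mulrBr normrM ger0_norm ?invr_ge0 ?(ltW b0)//.
      by rewrite powRM ?invr_ge0 ?(ltW b0)// binv// ltW.
    rewrite ge0_integralZl_EFin//; last 3 first.
    - by move=> x _; exact: energy_ge0.
    - exact: measurable_energy.
    - by rewrite invr_ge0 powR_ge0.
    have -> : (\int[mu]_(x in Omega) energy p D v Omega x = G)%E.
      apply: eq_integral => x /set_mem Ox; apply: eq_integral => y /set_mem Oy.
      by rewrite /gkernel /= !vE.
    rewrite gE -EFinM lee_fin mulrC ler_pdivrMr// mul1r; apply: le_trans glb.
    by rewrite lerDl.
  have := unit vb mvb H1 H2.
  have -> : (\int[mu]_(x in Omega) (`|vb x| `^ tau * w x)%:E = ((b `^ tau)^-1)%:E * I)%E.
    rewrite /I -ge0_integralZl_EFin//; last 3 first.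
    - by move=> x _; rewrite lee_fin mulr_ge0 ?powR_ge0.
    - apply: measurableT_comp => //; apply: measurable_funM => //.
      by apply: (measurableT_comp (measurable_powR tau)); exact: measurableT_comp.
    - by rewrite invr_ge0 powR_ge0.
    by apply: eq_integral => x /set_mem Ox; rewrite vbE ?(ltW tau0)// -EFinM mulrA.
  by rewrite muleC lee_pdivrMr ?powR_gt0// EFinM.
have gl0 : 0 <= g + l by rewrite addr_ge0.
have Ible : (I <= (C * ((g + l) `^ p^-1) `^ tau)%:E)%E.
  have [gl|gln] := eqVneq (g + l) 0; last first.
    apply: key; first by rewrite powR_gt0// lt_def gln.
    by rewrite -powRrM mulVf ?gt_eqF// powRr1.
  apply/lee_addgt0Pr => e e0.
  rewrite gl powR0 ?invr_eq0 ?gt_eqF// powR0 ?gt_eqF// mulr0 add0e.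
  (* If the norm vanishes, every b > 0 is admissible; this one makes the bound equal to e. *)
  pose b := (e / C) `^ tau^-1.
  have eC : 0 < e / C by rewrite divr_gt0.
  have := key b (powR_gt0 _ eC); rewrite gl => /(_ (powR_ge0 _ _)).
  by rewrite /b -powRrM mulVf ?gt_eqF// powRr1 ?(ltW eC)// mulrC divfK// gt_eqF.
apply: (@le_trans _ _ ((C * ((g + l) `^ p^-1) `^ tau)%:E `^ tau^-1)%E).
  apply: gt0_ler_poweR; rewrite ?invr_ge0 ?(ltW tau0)//.
  - by rewrite in_itv/= I0 leey.
  - by rewrite in_itv/= leey andbT lee_fin mulr_ge0 ?powR_ge0 ?(ltW C0).
rewrite poweR_EFin lee_fin powRM ?powR_ge0 ?(ltW C0)// -[(_ `^ tau) `^ _]powRrM.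
by rewrite mulfV ?gt_eqF// powRr1// powR_ge0.
Qed.

End scaling.

Section hardy_inequality.
Context {R : realType} {d : nat}.
Local Notation mu := (lebesgue_rV (R := R) d).
Implicit Types (Omega K : set 'rV[R]_d).

Lemma bounded_measure_le Omega : bounded_set Omega -> measurable Omega ->
  exists2 M : R, 0 <= M & (mu Omega <= M%:E)%E.
Proof.
move=> [M0 [_ HM]] mO.
have r0 : 0 < `|M0| + 2 by rewrite ltr_wpDl.
exists ((2 * (`|M0| + 2)) ^+ d); first by rewrite exprn_ge0// mulr_ge0// ltW.
apply: (@measure_le_ball _ _ 0) => // x Ox; apply/in_ball.
rewrite sub0r normrN (@le_lt_trans _ _ (`|M0| + 1))//; last by rewrite ltrD2l ltr1n.
by apply: HM => //; rewrite (le_lt_trans (ler_norm _))// ltrDl.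
Qed.

(** The plump ball has volume (2 c r)^d and the removed one (c r)^d, so at least (2^d - 1) (c r)^d
    remains. *)
Lemma plump_ring Omega (c : R) : (0 < d)%N -> measurable Omega -> 0 < c <= 1 ->
  (forall x r, Omega x -> 0 < r <= c -> exists z, ball z (c * r) `<=` Omega `&` ball x r) ->
  forall x r, Omega x -> 0 < r <= c ->
    ((c ^+ d * r ^+ d)%:E <= mu (ring_in Omega (c / 2) x r))%E.
Proof.
move=> d0 mO /andP[c0 c1] plump x r Ox rc; have /andP[r0 _] := rc.
have [z zx] := plump x r Ox rc.
have mring : measurable (ring_in Omega (c / 2) x r) by exact: measurable_ring_in.
have cr : 0 < c * r by rewrite mulr_gt0.
have cr2 : 0 < c / 2 * r by rewrite mulr_gt0// divr_gt0.
have : (mu (ball z (c * r)) <= mu (ring_in Omega (c / 2) x r `|` ball x (c / 2 * r)))%E.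
  apply: le_measure; rewrite ?inE; first exact: measurable_ball_rV.
    by apply: measurableU => //; exact: measurable_ball_rV.
  move=> y /zx Oy; have [yx|yx] := pselect (ball x (c / 2 * r) y); first by right.
  by left.
rewrite measure_ball_rV// => /le_trans/(_ (measureU2 _ mring (measurable_ball_rV _ _))).
rewrite [X in (_ + X)%E]measure_ball_rV//.
have -> : 2 * (c / 2 * r) = c * r by field.
rewrite addeC -leeBlDl// -EFinB => /(le_trans _); apply.
rewrite lee_fin [(2 * _) ^+ d]exprMn -[_ - _](_ : (2 ^+ d - 1) * (c * r) ^+ d = _); last first.
  by rewrite mulrBl mul1r.
rewrite -exprMn ler_peMl ?exprn_ge0 ?(ltW cr)//.
rewrite lerBrDr; apply: (@le_trans _ _ (2 ^+ 1)); first by rewrite expr1.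
by rewrite ler_weXn2l// ler1n.
Qed.

Lemma hardy_weight_ge0 K (R0 alpha beta : R) x : 0 <= hardy_weight K R0 alpha beta x.
Proof. by rewrite invr_ge0 mulr_ge0 ?powR_ge0. Qed.

Lemma measurable_hardy_weight K (R0 alpha beta : R) : K !=set0 ->
  measurable_fun setT (hardy_weight K R0 alpha beta).
Proof.
move=> K0.
have me := measurable_edistance K0.
rewrite (_ : hardy_weight K R0 alpha beta = (fun x => edistance K x `^ (- alpha) *
    (ln (2 * R0 * edistance K x `^ (-1))) `^ (- beta))); last first.
  apply/funext => x; rewrite /hardy_weight invfM !powRN powRr1//.
  exact: edistance_ge0.
apply: measurable_funM; first exact: (measurableT_comp (measurable_powR _) me).
apply: (measurableT_comp (measurable_powR _)).
apply: measurableT_comp; first exact: measurable_ln.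
apply: measurable_funM => //.
exact: (measurableT_comp (measurable_powR _) me).
Qed.

(** Each further shell shrinks the distance by eps / 4 <= 1/2, so the logarithm is at least (l + 1)
    ln 2. The extra 1, which keeps it positive on shell 0, comes from the 2 in 2 R0 and from dist <
    R0. *)
Lemma hardy_weight_le_shell Omega K (R0 r0 eps alpha beta : R) :
  0 < r0 <= R0 -> 0 < eps < 1 -> 0 <= alpha -> 0 <= beta ->
  (forall x, Omega x -> edistance K x < R0) ->
  exists2 Cw : R, 0 < Cw & forall x l, Omega x -> shell K r0 eps l x ->
    hardy_weight K R0 alpha beta x <=
    Cw * (l.+1%:R `^ (- beta) * geo_radius r0 eps l `^ (- alpha)).
Proof.
move=> /andP[r00 rR] /andP[eps0 eps1] al0 be0 dR.
have th0 : 0 < eps / 4 by rewrite divr_gt0.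
have ln20 : 0 < ln 2 :> R by rewrite ln_gt0// ltr1n.
have R00 : 0 < R0 by exact: lt_le_trans rR.
exists ((eps / 4) `^ (- alpha) * ln 2 `^ (- beta)); first by rewrite mulr_gt0 ?powR_gt0.
move=> x l Ox [xl1 xl2].
have rl0 : 0 < geo_radius r0 eps l by exact: geo_radius_gt0.
have rl1 : 0 < geo_radius r0 eps l.+1 by exact: geo_radius_gt0.
have e0 : 0 < edistance K x by exact: lt_le_trans xl1.
have lnle : ln 2 * l.+1%:R <= ln (2 * R0 / edistance K x).
  have H : 2 ^+ l.+1 <= 2 * R0 / edistance K x.
    rewrite ler_pdivlMr// exprS -mulrA ler_pM2l//.
    have [->|l0] := eqVneq l 0%N; first by rewrite expr0 mul1r ltW// dR.
    have := xl2 l0; rewrite /geo_radius => xl.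
    have : 2 ^+ l * (eps / 4) ^+ l <= 1 :> R.
      rewrite -exprMn exprn_ile1//; first by rewrite mulr_ge0// ltW.
      by lra.
    move=> H; apply: (@le_trans _ _ (2 ^+ l * (r0 * (eps / 4) ^+ l))).
      by rewrite ler_pM2l ?exprn_gt0// ltW.
    rewrite mulrCA; apply: le_trans rR; rewrite ler_piMr// ltW//.
  have : ln (2 ^+ l.+1) <= ln (2 * R0 / edistance K x).
    by rewrite ler_ln ?posrE ?exprn_gt0 ?divr_gt0 ?mulr_gt0.
  by rewrite lnXn// mulr_natr.
have ln0 : 0 < ln (2 * R0 / edistance K x).
  by apply: lt_le_trans lnle; rewrite mulr_gt0// ltr0n.
rewrite /hardy_weight invfM -!powRN.
have -> : (eps / 4) `^ (- alpha) * ln 2 `^ (- beta) *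
    (l.+1%:R `^ (- beta) * geo_radius r0 eps l `^ (- alpha)) =
    geo_radius r0 eps l.+1 `^ (- alpha) * (ln 2 * l.+1%:R) `^ (- beta).
  rewrite geo_radiusS [(eps / 4 * _) `^ _]powRM ?(ltW th0) ?(ltW rl0)//.
  rewrite [(ln 2 * _) `^ _]powRM ?(ltW ln20)//.
  by ring.
apply: ler_pM; rewrite ?powR_ge0// !powRN lef_pV2 ?posrE ?powR_gt0//.
- by apply: le_powR2 => //; exact: ltW.
- by apply: le_powR2 => //; rewrite mulr_ge0 ?(ltW ln20).
by rewrite mulr_gt0 ?ltr0n.
Qed.

Lemma hardy_inequality (k : nat) (s p R0 tau beta : R) Omega K :
  (0 < k <= d)%N -> 1 <= p -> p <= tau -> 1 < tau -> tau * (d%:R - k%:R) <= d%:R * p ->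
  s * p = k%:R -> bounded_lipschitz_domain Omega ->
  compact K -> K !=set0 -> tame_codim k K -> 0 < R0 ->
  (forall x, Omega x -> edistance K x < R0) ->
  let alpha := d%:R + (k%:R - d%:R) * (tau / p) in
  (alpha < k%:R /\ 0 <= beta \/ alpha = k%:R /\ beta = tau) ->
  exists2 C : R, 0 < C &
    forall u, sobolev s p Omega u ->
    ((\int[mu]_(x in Omega)
        (`|u x| `^ tau * hardy_weight K R0 alpha beta x)%:E) `^ tau^-1
      <= C%:E * (gagliardo s p Omega u
                 + \int[mu]_(x in Omega) (`|u x| `^ p)%:E) `^ p^-1)%E.
Proof.
move=> /andP[k0 kd] p1 ptau tau1 tkd spk lipO cK K0 [rho0 [CK [ck [rho00 CK0 _ tl tg]]]] R00 dR alpha cases.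
have d0 : (0 < d)%N by exact: leq_trans kd.
have p0 : 0 < p by exact: lt_le_trans p1.
have tau0 : 0 < tau by exact: lt_trans tau1.
have [oO _ bO _] := lipO.
have mO : measurable Omega by exact: open_measurable_rV.
have [MO MO0 muO] := bounded_measure_le bO mO.
have [c [c01 plump]] := bounded_lipschitz_plump lipO.
have ringc := plump_ring d0 mO c01 plump.
have /andP[c0 c1] := c01.
pose r0 := Num.min c (Num.min rho0 R0).
have r00 : 0 < r0 by rewrite !lt_min c0 rho00.
have [rc [rrho rR]] : r0 <= c /\ r0 <= rho0 /\ r0 <= R0 by rewrite /r0 !ge_min !lexx !orbT.
pose eps := c / 2.
have eps0 : 0 < eps by rewrite divr_gt0.
have eps1 : eps < 1 by rewrite /eps; lra.
have kap0 : 0 < c ^+ d by rewrite exprn_gt0.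
have ringP x r : Omega x -> 0 < r <= r0 -> ((c ^+ d * r ^+ d)%:E <= mu (ring_in Omega eps x r))%E.
  by move=> Ox /andP[rp rr]; apply: ringc => //; rewrite rp (le_trans rr).
have tubeloc z t rho : 0 < t <= rho -> rho <= r0 ->
    (mu (tube K t `&` ball z rho) <= (CK * t ^+ k * rho ^+ (d - k))%:E)%E.
  by move=> tr rr; apply: tl => //; exact: le_trans rrho.
have tubeglob t : 0 < t <= r0 -> (mu (tube K t) <= (CK * t ^+ k)%:E)%E.
  by move=> /andP[tp tr]; case: (tg t) => //; rewrite tp (le_trans tr).
have alE : k%:R - alpha = (d%:R - k%:R) * (tau / p - 1) by rewrite /alpha; ring.
(* This is the hypothesis tau (d - k) <= d p, divided by p. *)
have al0 : 0 <= alpha.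
  rewrite /alpha mulrA -[X in 0 <= X + _](@mulfK _ p _ d%:R) ?gt_eqF// -mulrDl divr_ge0 ?(ltW p0)//.
  by rewrite mulrBl; move: tkd; rewrite mulrBr ![tau * _]mulrC; lra.
have be0 : 0 <= beta by case: cases => [[]//|[_ ->]]; exact: ltW.
have rR' : 0 < r0 <= R0 by rewrite r00.
have eps01 : 0 < eps < 1 by rewrite eps0.
have [Cw Cw0 wle] := hardy_weight_le_shell rR' eps01 al0 be0 dR.
have th0 : 0 < eps / 4 by rewrite divr_gt0.
have th1 : eps / 4 < 1 by lra.
(* For alpha < k the logarithm is bounded away (om = 1); for alpha = k its decay (l + 1)^(-tau) is
   kept. *)
have [h [H [P [Cs [om [om01 omb [h0 hH H1 P0 [omP Ps]]]]]]]] :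
    exists h H P Cs om, [/\ forall l, 0 <= om l <= 1,
      forall l, l.+1%:R `^ (- beta) <= om l &
      weight_sequence (eps / 4) r0 tau (k%:R - alpha) om h H P Cs].
  have nb l : l.+1%:R `^ (- beta) <= 1 :> R.
    by rewrite powRN invf_le1 ?powR_gt0 ?ltr0n// powR_ge1// ler1n.
  case: cases => [[ak _]|[ak bt]].
    have ka0 : 0 < k%:R - alpha by rewrite subr_gt0.
    have [h [H [P [Cs HW]]]] := weight_sequence_power th0 th1 r00 tau1 ka0.
    exists h, H, P, Cs, (fun=> 1); split => //.
    by move=> l; rewrite ler01 lexx.
  have [h [H [P [Cs HW]]]] := weight_sequence_log (eps / 4) r0 tau1.
  exists h, H, P, Cs, (fun l => l.+1%:R `^ (- tau)); split => //.
  - by move=> l; rewrite powR_ge0/= -bt.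
  - by move=> l; rewrite bt.
  - by rewrite ak subrr.
have M0 : 0 <= MO + 1 by rewrite addr_ge0.
have mw : measurable_fun Omega (hardy_weight K R0 alpha beta).
  exact: measurable_funS (measurable_hardy_weight _ _ _ K0).
have wle' x l : Omega x -> ~ K x -> shell K r0 eps l x ->
    hardy_weight K R0 alpha beta x <= Cw * (om l * geo_radius r0 eps l `^ (- alpha)).
  move=> Ox _ xl; apply: (le_trans (wle x l Ox xl)).
  by rewrite ler_pM2l// ler_wpM2r ?powR_ge0.
have Ps' i : P i * (h i `^ (1 - tau) * geo_radius r0 eps i `^ (alpha - k%:R)) <= Cs.
  by have := Ps i; rewrite opprB.
have [C C0 HC] := hardy_unit k0 kd p1 ptau tkd mO r00 eps0 eps1 kap0 M0 ringP K0 cK CK0 MO0 muO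
  tubeloc tubeglob h0 hH H1 om01 P0 omP Ps' mw (hardy_weight_ge0 K R0 alpha beta) Cw0 wle'.
exists (C `^ tau^-1); first exact: powR_gt0.
move=> u uS.
have unit (v : 'rV[R]_d -> R) : measurable_fun setT v ->
    (\int[mu]_(x in Omega) `|v x|%:E <= (MO + 1)%:E)%E ->
    (\int[mu]_(x in Omega) energy p (d%:R + s * p) v Omega x <= 1)%E ->
    (\int[mu]_(x in Omega) (`|v x| `^ tau * hardy_weight K R0 alpha beta x)%:E <= C%:E)%E.
  by rewrite spk; exact: HC.
exact: (scaled_hardy p1 tau0 mO muO mw (hardy_weight_ge0 K R0 alpha beta) C0 unit uS).
Qed.

End hardy_inequality.

(** * Logarithmic test functions *)

Section radial_integrals.
Context {R : realType} {d : nat}.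
Local Notation mu := (lebesgue_rV (R := R) d).
Implicit Types (x y : 'rV[R]_d) (a q : R).

Lemma powR_exprn (b t : R) l : 0 < b -> (b ^+ l) `^ t = (b `^ t) ^+ l.
Proof.
by move=> b0; rewrite -powR_mulrn ?(ltW b0)// -powRrM mulrC powRrM powR_mulrn ?powR_ge0.
Qed.

Lemma powR_invl (b t : R) : 0 < b -> b^-1 `^ t = b `^ (- t).
Proof. by move=> b0; rewrite -powR_inv1 ?(ltW b0)// -powRrM mulN1r. Qed.

Lemma dyadic_bracket (z : R) : 1 <= z -> exists j : nat, 2 ^+ j <= z < 2 ^+ j.+1.
Proof.
move=> z1; have z0 : 0 < z by exact: lt_le_trans z1.
have h01 : 0 <= (2^-1 : R) < 1 by rewrite invr_ge0 ler0n/= invf_lt1// ltr1n.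
have e0 : 0 < (2 * z)^-1 by rewrite invr_gt0 mulr_gt0.
have Ex : exists m : nat, z < 2 ^+ m.+1.
  have [m Hm] := exists_expr_le h01 e0; exists m.
  rewrite exprVn lef_pV2 ?posrE ?exprn_gt0 ?mulr_gt0// in Hm.
  by rewrite exprS; lra.
case: (ex_minnP Ex) => j Hj minj; exists j; rewrite Hj andbT.
case: j Hj minj => [|j] _ minj; first by rewrite expr0.
by rewrite leNgt; apply/negP => /minj; rewrite ltnn.
Qed.

Lemma measurable_norm_powR x (t : R) :
  measurable_fun setT (fun y => (`|x - y| `^ t)%:E).
Proof.
apply: measurableT_comp => //; apply: (measurableT_comp (measurable_powR t)).
exact: (measurableT_comp measurable_norm_sub (pair1_measurable x)).
Qed.

Lemma sum_geometric_lt1 (r : R) n : 0 <= r < 1 -> \sum_(j < n) r ^+ j <= (1 - r)^-1.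
Proof.
move=> /andP[r0 r1]; have r10 : 0 < 1 - r by rewrite subr_gt0.
suff -> : \sum_(j < n) r ^+ j = (1 - r ^+ n) / (1 - r).
  by rewrite -[leRHS]mul1r ler_pM2r ?invr_gt0// lerBlDr lerDl exprn_ge0.
elim: n => [|n IH]; first by rewrite big_ord0 expr0 subrr mul0r.
by rewrite big_ord_recr/= IH exprS; field; rewrite gt_eqF.
Qed.

(** Dyadic shells replace polar coordinates: |x - y|^q is estimated at the outer radius and |x -
    y|^(-d) at the inner one, which leaves a geometric series of ratio 2^(-q). The factor 8^d is the
    ratio of the volume 4^d R^d of the covering cube to (R / 2)^d, for outer radius R. *)
Lemma integral_norm_near q : 0 < q -> exists2 C : R, 0 < C & forall x a A, 0 < a ->
  measurable A -> (forall y, A y -> 0 < `|x - y| <= a) ->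
  (\int[mu]_(y in A) (`|x - y| `^ (q - d%:R))%:E <= (C * a `^ q)%:E)%E.
Proof.
move=> q0; pose r := 2 `^ (- q) : R.
have r01 : 0 <= r < 1.
  by rewrite /r powR_ge0/= powRN invf_lt1 ?powR_gt0// powR_gt1// ltr1n.
have r1 : 0 < 1 - r by case/andP: r01 => _ ?; rewrite subr_gt0.
exists (8 ^+ d / (1 - r)); first by rewrite divr_gt0// exprn_gt0.
move=> x a A a0 mA Aa.
have p2 j : 0 < 2 ^+ j :> R by rewrite exprn_gt0.
pose c j := (a / 2 ^+ j) `^ q * ((a / 2 ^+ j.+1) ^+ d)^-1.
pose m j := (2 * (2 * (a / 2 ^+ j))) ^+ d.
have aj j : 0 < a / 2 ^+ j by rewrite divr_gt0.
apply: (integral_le_shells (S := fun j => ball x (2 * (a / 2 ^+ j))) (c := c) (m := m)) => //.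
- exact: measurable_funS (measurable_norm_powR x _).
- by move=> j; exact: measurable_ball_rV.
- by move=> j; rewrite /c mulr_ge0 ?powR_ge0// invr_ge0 exprn_ge0 ?(ltW (aj _)).
- move=> y /Aa/andP[xy0 xya].
  have z1 : 1 <= a / `|x - y| by rewrite ler_pdivlMr// mul1r.
  have [j /andP[j1 j2]] := dyadic_bracket z1; exists j.
    apply/in_ball; rewrite ler_pdivlMr// in j1.
    have : `|x - y| <= a / 2 ^+ j by rewrite ler_pdivlMr// mulrC.
    by have := aj j; lra.
  rewrite lee_fin powR_add// powRN powR_mulrn; last exact: ltW.
  apply: ler_pM; rewrite ?powR_ge0 ?invr_ge0 ?exprn_ge0//.
    by apply: le_powR2; [exact: ltW|exact: ltW|rewrite ler_pdivlMr// mulrC -ler_pdivlMr].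
  rewrite lef_pV2 ?posrE ?exprn_gt0//; apply: lerXn2r; rewrite ?nnegrE ?(ltW (aj _))//.
  by rewrite ler_pdivrMr// mulrC -ler_pdivrMr// ltW.
- move=> j; apply: (@measure_le_ball _ _ x); rewrite ?mulr_gt0//.
  by apply: measurableI => //; exact: measurable_ball_rV.
move=> n.
have E j : c j * m j = a `^ q * 8 ^+ d * r ^+ j.
  rewrite /c /m exprS.
  have -> : 2 * (2 * (a / 2 ^+ j)) = 8 * (a / (2 * 2 ^+ j)) by field; rewrite gt_eqF.
  rewrite [(8 * _) ^+ d]exprMn.
  have -> : (a / 2 ^+ j) `^ q = a `^ q * r ^+ j.
    by rewrite powRM ?invr_ge0 ?(ltW a0) ?(ltW (p2 j))// powR_invl// powR_exprn.
  have D0 : (a / (2 * 2 ^+ j)) ^+ d != 0 by rewrite expf_neq0// gt_eqF// divr_gt0// mulr_gt0.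
  move: ((a / (2 * 2 ^+ j)) ^+ d) (8 ^+ d) (r ^+ j) (a `^ q) D0 => x1 x2 x3 x4 D0.
  by field.
under eq_bigr do rewrite E.
rewrite -mulr_sumr (_ : 8 ^+ d / (1 - r) * a `^ q = a `^ q * 8 ^+ d * (1 - r)^-1); last by ring.
by rewrite ler_pM2l ?mulr_gt0 ?exprn_gt0 ?powR_gt0//; exact: sum_geometric_lt1.
Qed.

Lemma integral_norm_far q : 0 < q -> exists2 C : R, 0 < C & forall x a A, 0 < a ->
  measurable A -> (forall y, A y -> a <= `|x - y|) ->
  (\int[mu]_(y in A) (`|x - y| `^ (- q - d%:R))%:E <= (C * a `^ (- q))%:E)%E.
Proof.
move=> q0; pose r := 2 `^ (- q) : R.
have r01 : 0 <= r < 1.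
  by rewrite /r powR_ge0/= powRN invf_lt1 ?powR_gt0// powR_gt1// ltr1n.
have r1 : 0 < 1 - r by case/andP: r01 => _ ?; rewrite subr_gt0.
exists (4 ^+ d / (1 - r)); first by rewrite divr_gt0// exprn_gt0.
move=> x a A a0 mA Aa.
have p2 j : 0 < 2 ^+ j :> R by rewrite exprn_gt0.
pose c j := (a * 2 ^+ j) `^ (- q) * ((a * 2 ^+ j) ^+ d)^-1.
pose m j := (2 * (2 * (a * 2 ^+ j))) ^+ d.
have aj j : 0 < a * 2 ^+ j by rewrite mulr_gt0.
apply: (integral_le_shells (S := fun j => ball x (2 * (a * 2 ^+ j))) (c := c) (m := m)) => //.
- exact: measurable_funS (measurable_norm_powR x _).
- by move=> j; exact: measurable_ball_rV.
- by move=> j; rewrite /c mulr_ge0 ?powR_ge0// invr_ge0 exprn_ge0 ?(ltW (aj _)).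
- move=> y /Aa xya; have xy0 : 0 < `|x - y| by exact: lt_le_trans xya.
  have z1 : 1 <= `|x - y| / a by rewrite ler_pdivlMr// mul1r.
  have [j /andP[j1 j2]] := dyadic_bracket z1; exists j.
    by apply/in_ball; rewrite mulrCA mulrC -ltr_pdivrMr// -exprS.
  rewrite ler_pdivlMr// mulrC in j1.
  rewrite lee_fin powR_add// powRN [_ `^ (- d%:R)]powRN powR_mulrn; last exact: ltW.
  rewrite /c powRN; apply: ler_pM; rewrite ?powR_ge0 ?invr_ge0 ?powR_ge0 ?exprn_ge0//.
    by rewrite lef_pV2 ?posrE ?powR_gt0//; apply: le_powR2; [exact: ltW|exact: ltW|].
  by rewrite lef_pV2 ?posrE ?exprn_gt0//; apply: lerXn2r; rewrite ?nnegrE ?(ltW (aj _)).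
- move=> j; apply: (@measure_le_ball _ _ x); rewrite ?mulr_gt0//.
  by apply: measurableI => //; exact: measurable_ball_rV.
move=> n.
have E j : c j * m j = a `^ (- q) * 4 ^+ d * r ^+ j.
  rewrite /c /m.
  have -> : 2 * (2 * (a * 2 ^+ j)) = 4 * (a * 2 ^+ j) by ring.
  rewrite [(4 * _) ^+ d]exprMn.
  have -> : (a * 2 ^+ j) `^ (- q) = a `^ (- q) * r ^+ j.
    by rewrite powRM ?(ltW a0) ?(ltW (p2 j))// powR_exprn.
  have D0 : (a * 2 ^+ j) ^+ d != 0 by rewrite expf_neq0// gt_eqF.
  move: ((a * 2 ^+ j) ^+ d) (4 ^+ d) (r ^+ j) (a `^ _) D0 => x1 x2 x3 x4 D0.
  by field.
under eq_bigr do rewrite E.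
rewrite -mulr_sumr (_ : 4 ^+ d / (1 - r) * a `^ (- q) = a `^ (- q) * 4 ^+ d * (1 - r)^-1); last by ring.
by rewrite ler_pM2l ?mulr_gt0 ?exprn_gt0 ?powR_gt0//; exact: sum_geometric_lt1.
Qed.

Lemma ln_le_powR (z sg : R) : 0 < z -> 0 < sg -> ln z <= z `^ sg / sg.
Proof.
move=> z0 sg0; rewrite ler_pdivlMr// mulrC -ln_powR.
have zs : 0 < z `^ sg by rewrite powR_gt0.
have := @le_ln1Dx R (z `^ sg - 1); rewrite addrCA subrr addr0 => H.
by rewrite (le_trans (H _))// ?ltrBrDl ?subrr// gerBl.
Qed.

(* The logarithmic kernel behaves like `|x - y| near x and grows slower than
   any power at infinity. *)
Lemma integral_log_kernel (p : R) (k : nat) : (0 < d)%N -> (0 < k)%N -> k%:R < p ->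
  exists2 C : R, 0 < C & forall x a A, 0 < a -> measurable A ->
  (\int[mu]_(y in A) (ln (1 + d%:R * `|x - y| / a) `^ p / enorm (x - y) `^ (d%:R + k%:R))%:E
    <= (C * a `^ (- k%:R))%:E)%E.
Proof.
move=> d0 k0 kp.
have k0R : 0 < k%:R :> R by rewrite ltr0n.
have p0 : 0 < p by exact: lt_trans kp.
have dd : 1 <= d%:R :> R by rewrite ler1n.
have dR : 0 < d%:R :> R by exact: lt_le_trans dd.
have qn : 0 < p - k%:R by rewrite subr_gt0.
(* At infinity the p-th power of the logarithm is bounded by a power k / 2, which still leaves the
   decay |x - y|^(- d - k / 2). *)
pose sg := k%:R / (2 * p).
have sg0 : 0 < sg by rewrite divr_gt0// mulr_gt0.
have sp : sg * p = k%:R / 2 by rewrite /sg; field; rewrite gt_eqF.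
have qf : 0 < k%:R / 2 :> R by rewrite divr_gt0.
have [C1 C10 H1] := integral_norm_near qn.
have [C2 C20 H2] := integral_norm_far qf.
pose c2 := ((2 * d%:R) `^ sg / sg) `^ p.
have c20 : 0 < c2 by rewrite powR_gt0// divr_gt0// powR_gt0// mulr_gt0.
exists (d%:R `^ p * C1 + c2 * C2); first by rewrite addr_gt0 ?mulr_gt0 ?(powR_gt0 _ dR).
move=> x a A a0 mA.
pose F y := (ln (1 + d%:R * `|x - y| / a) `^ p / enorm (x - y) `^ (d%:R + k%:R))%:E.
have l0 y : 0 <= ln (1 + d%:R * `|x - y| / a).
  by rewrite ln_ge0// lerDl divr_ge0 ?mulr_ge0 ?(ltW a0).
have F0 y : (0 <= F y)%E by rewrite lee_fin divr_ge0 ?powR_ge0.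
have mx : measurable_fun setT (fun y => `|x - y|).
  exact: (measurableT_comp measurable_norm_sub (pair1_measurable x)).
have mF B : measurable B -> measurable_fun B F.
  move=> mB; apply: measurableT_comp => //; apply: (measurable_funS measurableT) => //.
  rewrite (_ : (fun y => _) = (fun y => ln (1 + d%:R * `|x - y| / a) `^ p *
      enorm (x - y) `^ (- (d%:R + k%:R)))); last by apply/funext => y; rewrite powRN.
  apply: measurable_funM.
    apply: (measurableT_comp (measurable_powR _)); apply: measurableT_comp; first exact: measurable_ln.
    by apply: measurable_funD => //; apply: measurable_funM => //; apply: measurable_funM.
  apply: (measurableT_comp (measurable_powR _)).
  exact: (measurableT_comp measurable_enorm_sub (pair1_measurable x)).
pose A0 : set 'rV[R]_d := [set y | 0 < `|x - y| < a].
pose B0 : set 'rV[R]_d := [set y | a <= `|x - y|].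
have mA0 : measurable A0.
  rewrite (_ : A0 = (fun y => `|x - y|) @^-1` `]0, a[%classic); last first.
    by apply/seteqP; split => y /=; rewrite in_itv.
  by rewrite -[X in measurable X]setTI; exact: mx.
have mB0 : measurable B0.
  rewrite (_ : B0 = (fun y => `|x - y|) @^-1` `[a, +oo[%classic); last first.
    by apply/seteqP; split => y /=; rewrite in_itv/= andbT.
  by rewrite -[X in measurable X]setTI; exact: mx.
(* Near x the bound ln (1 + z) <= z produces the exponent p - k - d, integrable because p > k. *)
pose G1 y := (((d%:R / a) `^ p)%:E * (`|x - y| `^ (p - k%:R - d%:R))%:E)%E.
pose G2 y := ((c2 * a `^ (- (k%:R / 2)))%:E * (`|x - y| `^ (- (k%:R / 2) - d%:R))%:E)%E.
have mG1 B : measurable_fun B G1.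
  by apply: measurable_funeM; exact: measurable_funS (measurable_norm_powR x _).
have mG2 B : measurable_fun B G2.
  by apply: measurable_funeM; exact: measurable_funS (measurable_norm_powR x _).
have G10 y : (0 <= G1 y)%E by rewrite mule_ge0 ?lee_fin ?powR_ge0.
have G20 y : (0 <= G2 y)%E by rewrite mule_ge0 ?lee_fin ?mulr_ge0 ?powR_ge0.
have enD y : 0 < `|x - y| -> (enorm (x - y) `^ (d%:R + k%:R))^-1 <= `|x - y| `^ (- (d%:R + k%:R)).
  move=> t0; rewrite powRN lef_pV2 ?posrE ?powR_gt0//; last first.
    exact: lt_le_trans (norm_le_enorm _).
  by apply: le_powR2; rewrite ?addr_ge0//; exact: norm_le_enorm.
have FG1 y : A0 y -> (F y <= G1 y)%E.
  move=> /andP[t0 ta]; rewrite /F /G1 -EFinM lee_fin.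
  have z0 : 0 <= d%:R * `|x - y| / a by rewrite divr_ge0 ?mulr_ge0 ?(ltW a0).
  have lz : ln (1 + d%:R * `|x - y| / a) <= d%:R * `|x - y| / a.
    by apply: le_ln1Dx; apply: lt_le_trans z0; rewrite ltrN10.
  apply: (@le_trans _ _ ((d%:R * `|x - y| / a) `^ p * `|x - y| `^ (- (d%:R + k%:R)))).
    by apply: ler_pM; rewrite ?powR_ge0 ?invr_ge0 ?powR_ge0 ?enD//; apply: le_powR2; rewrite ?(ltW p0).
  rewrite mulrAC powRM ?divr_ge0 ?(ltW a0) ?(ltW dR)// -mulrA -powR_add//.
  by rewrite opprD addrA addrAC.
have FG2 y : B0 y -> (F y <= G2 y)%E.
  rewrite /B0 /= => ta; have t0 : 0 < `|x - y| by exact: lt_le_trans ta.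
  rewrite /F /G2 -EFinM lee_fin.
  have z1 : 1 <= d%:R * `|x - y| / a.
    rewrite ler_pdivlMr// mul1r (le_trans ta)// ler_peMl//.
  have z20 : 0 < 2 * d%:R * (`|x - y| / a) by rewrite !mulr_gt0// invr_gt0.
  have lz : ln (1 + d%:R * `|x - y| / a) <= (2 * d%:R) `^ sg / sg * (`|x - y| / a) `^ sg.
    have E : (2 * d%:R) `^ sg / sg * (`|x - y| / a) `^ sg = (2 * d%:R * (`|x - y| / a)) `^ sg / sg.
      by rewrite (@powRM _ (2 * d%:R) (`|x - y| / a)) ?divr_ge0 ?(ltW a0)// ?mulr_ge0// mulrAC.
    rewrite E; apply: le_trans (ln_le_powR z20 sg0).
    rewrite ler_ln ?posrE//; last by rewrite addr_gt0// (lt_le_trans ltr01).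
    by move: z1; rewrite mulrA -[2 * d%:R * _]mulrA; lra.
  have lzp : ln (1 + d%:R * `|x - y| / a) `^ p <= c2 * (`|x - y| `^ (k%:R / 2) * a `^ (- (k%:R / 2))).
    apply: (le_trans (le_powR2 (ltW p0) (l0 y) lz)).
    rewrite powRM ?powR_ge0 ?mulr_ge0 ?powR_ge0 ?invr_ge0 ?(ltW sg0)//.
    rewrite -/c2 -powRrM sp [(`|x - y| / a) `^ _]powRM ?invr_ge0 ?(ltW a0)//.
    by rewrite powR_invl.
  apply: (@le_trans _ _ (c2 * (`|x - y| `^ (k%:R / 2) * a `^ (- (k%:R / 2))) * `|x - y| `^ (- (d%:R + k%:R)))).
    by apply: ler_pM; rewrite ?powR_ge0 ?invr_ge0 ?powR_ge0 ?enD.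
  rewrite le_eqVlt; apply/orP; left; apply/eqP.
  have -> : `|x - y| `^ (- (k%:R / 2) - d%:R) = `|x - y| `^ (k%:R / 2) * `|x - y| `^ (- (d%:R + k%:R)).
    by rewrite -powR_add//; congr (_ `^ _); field.
  by move: (`|x - y| `^ _) (`|x - y| `^ _) (a `^ _) => t1 t2 t3; ring.
have res (G : 'rV[R]_d -> \bar R) (B : set 'rV[R]_d) y : (forall y, (0 <= G y)%E) -> (0 <= (G \_ B) y)%E.
  by move=> GG; rewrite patchE; case: ifP.
apply: (@le_trans _ _ (\int[mu]_(y in A) ((G1 \_ A0) y + (G2 \_ B0) y))%E).
  apply: ge0_le_integral => //.
  - by move=> y _; exact: F0.
  - exact: mF.
  - apply: emeasurable_funD.
      by apply/measurable_restrict => //; exact: mG1.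
    by apply/measurable_restrict => //; exact: mG2.
  - move=> y _; have [t0|t0] := ltP 0 `|x - y|.
      have [ta|ta] := ltP `|x - y| a.
        have Ay : A0 y by rewrite /A0 /= t0 ta.
        apply: (le_trans (FG1 y Ay)); rewrite [X in (_ <= X + _)%E]patchE mem_set// leeDl//.
        exact: res.
      have By : B0 y by [].
      apply: (le_trans (FG2 y By)); rewrite [X in (_ <= _ + X)%E]patchE mem_set// leeDr//.
      exact: res.
    have -> : `|x - y| = 0 by apply/le_anti; rewrite t0 normr_ge0.
    rewrite mulr0 mul0r addr0 ln1 powR0 ?gt_eqF// mul0r.
    by apply: adde_ge0; exact: res.
rewrite ge0_integralD//; last 4 first.
- by move=> y _; exact: res.
- by apply/measurable_restrict => //; exact: mG1.
- by move=> y _; exact: res.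
- by apply/measurable_restrict => //; exact: mG2.
rewrite -!integral_mkcondr mulrDl EFinD; apply: leeD.
  have mN t : measurable_fun (A `&` A0) (fun y => (`|x - y| `^ t)%:E).
    exact: measurable_funS (measurable_norm_powR x _).
  rewrite /G1 ge0_integralZl_EFin ?powR_ge0//; last exact: measurableI.
  apply: (@le_trans _ _ (((d%:R / a) `^ p)%:E * (C1 * a `^ (p - k%:R))%:E)%E).
    apply: lee_wpmul2l; first by rewrite lee_fin powR_ge0.
    apply: H1 => //; first exact: measurableI.
    by move=> y [_ /andP[t0 ta]]; rewrite t0 ltW.
  rewrite -EFinM lee_fin powRM ?invr_ge0 ?(ltW a0)// powR_invl// [a `^ (p - _)]powR_add//.
  rewrite le_eqVlt; apply/orP; left; apply/eqP.
  rewrite [a `^ (- p)]powRN; have := powR_gt0 p a0.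
  move: (a `^ p) (a `^ _) (_ `^ p) => t1 t2 t3 t10; field; by rewrite gt_eqF.
have mN t : measurable_fun (A `&` B0) (fun y => (`|x - y| `^ t)%:E).
  exact: measurable_funS (measurable_norm_powR x _).
rewrite /G2 ge0_integralZl_EFin ?mulr_ge0 ?powR_ge0//; last exact: measurableI.
apply: (@le_trans _ _ ((c2 * a `^ (- (k%:R / 2)))%:E * (C2 * a `^ (- (k%:R / 2)))%:E)%E).
  apply: lee_wpmul2l; first by rewrite lee_fin mulr_ge0 ?powR_ge0.
  apply: H2 => //; first exact: measurableI.
  by move=> y [].
rewrite -EFinM lee_fin (_ : - k%:R = - (k%:R / 2) + - (k%:R / 2)); last by field.
rewrite powR_add// le_eqVlt; apply/orP; left; apply/eqP; clearbody c2.
by move: (a `^ _) => t1; ring.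
Qed.

End radial_integrals.

(** [F] needs to control the kernel only when its first argument is the better of the two points;
    the double integral over Omega is symmetric. *)
Lemma gagliardo_le_sym {R : realType} {d : nat} (s p : R) (Omega : set 'rV[R]_d)
    (u : 'rV[R]_d -> R) (F : 'rV[R]_d * 'rV[R]_d -> \bar R) :
  let I := (\int[lebesgue_rV d]_(x in Omega) \int[lebesgue_rV d]_(y in Omega) F (x, y))%E in
  measurable Omega -> measurable_fun setT u -> measurable_fun setT F ->
  (forall z, (0 <= F z)%E) ->
  (forall x y, ((`|u x - u y| `^ p / enorm (x - y) `^ (d%:R + s * p))%:E <= F (x, y) + F (y, x))%E) ->
  (gagliardo s p Omega u <= I + I)%E.
Proof.
move=> I mO mu_u mF F0 HF.
have mFs : measurable_fun setT (fun z => F (z.2, z.1)).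
  exact: (measurableT_comp mF (measurable_fun_pair measurable_snd measurable_fst)).
have mFx x : measurable_fun Omega (fun y => F (x, y)).
  by apply: measurable_funTS; exact: (measurableT_comp mF (pair1_measurable x)).
have mFsx x : measurable_fun Omega (fun y => F (y, x)).
  by apply: measurable_funTS; exact: (measurableT_comp mF (pair2_measurable x)).
have mI := measurable_slice (lebesgue_rV d) mF F0 mO mO.
have mIs := measurable_slice (lebesgue_rV d) mFs (fun z => F0 (z.2, z.1)) mO mO.
have Es : (I = \int[lebesgue_rV d]_(x in Omega) \int[lebesgue_rV d]_(y in Omega) F (y, x))%E.
  by rewrite /I tonelli_setX.
rewrite {2}Es -ge0_integralD//; last 2 first.
- by move=> x _; exact: integral_ge0.
- by move=> x _; exact: integral_ge0.
apply: ge0_le_integral => //.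
- by move=> x _; apply: integral_ge0 => y _; rewrite lee_fin divr_ge0 ?powR_ge0.
- exact: (measurable_energy p (d%:R + s * p) mu_u mO mO).
- exact: emeasurable_funD.
move=> x _; rewrite -ge0_integralD//.
apply: ge0_le_integral => //.
- by move=> y _; rewrite lee_fin divr_ge0 ?powR_ge0.
- exact: (measurable_kernelr p (d%:R + s * p) mu_u x mO).
- exact: emeasurable_funD.
Qed.

(** * The tent in the logarithm of the distance and its energy *)

Section profile.
Context {R : realType} {d : nat}.
Local Notation mu := (lebesgue_rV (R := R) d).
Variables (k : nat) (p : R) (Omega K : set 'rV[R]_d).
Hypotheses (d0 : (0 < d)%N) (k0 : (0 < k)%N) (kp : k%:R < p).
Hypotheses (mO : measurable Omega) (K0 : K !=set0).
Variables (rs b : R).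
Hypotheses (rs0 : 0 < rs) (b1 : 1 < b).
Variable n : nat.
Hypothesis n0 : (0 < n)%N.

Definition scale (j : nat) : R := rs / b ^+ j.
Definition trunc_dist (x : 'rV[R]_d) : R := Num.max (edistance K x) (scale n).
Definition log_dist x : R := ln (rs / trunc_dist x).
(* A tent in the variable log_dist, supported in scale n <= edistance K <= rs;
   the truncation of the distance makes it Lipschitz. *)
Definition profile x : R := Num.max 0 (Num.min (log_dist x) (n%:R * ln b - log_dist x)).

Let b0 : 0 < b. Proof. exact: lt_trans b1. Qed.
Let bj j : 0 < b ^+ j. Proof. by rewrite exprn_gt0. Qed.
Let p0 : 0 < p. Proof. by apply: lt_trans kp; rewrite ltr0n. Qed.
Let lnb0 : 0 < ln b. Proof. by rewrite ln_gt0. Qed.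

Lemma scale_gt0 j : 0 < scale j.
Proof. by rewrite divr_gt0. Qed.

Lemma scaleS j : scale j = b * scale j.+1.
Proof. by rewrite /scale exprS; field; rewrite !gt_eqF. Qed.

Lemma scaleS_le j : scale j.+1 <= scale j.
Proof. by rewrite [scale j]scaleS ler_peMl ?(ltW (scale_gt0 _))// ltW. Qed.

Lemma scale_le i j : (i <= j)%N -> scale j <= scale i.
Proof.
by move=> /subnK <-; elim: (j - i)%N => // m IH; rewrite addSn (le_trans (scaleS_le _)).
Qed.

Lemma scale0 : scale 0 = rs.
Proof. by rewrite /scale expr0 divr1. Qed.

Lemma trunc_dist_gt0 x : 0 < trunc_dist x.
Proof. by rewrite lt_max scale_gt0 orbT. Qed.

Lemma trunc_dist_le_add x y : trunc_dist y <= trunc_dist x + d%:R * `|x - y|.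
Proof.
have H : 0 <= d%:R * `|x - y| by rewrite mulr_ge0.
rewrite {1}/trunc_dist ge_max; apply/andP; split.
  apply: (le_trans (edistance_le_add y x K0)); apply: lerD.
    by rewrite le_max lexx.
  by rewrite distrC; exact: enorm_le_norm.
by rewrite (@le_trans _ _ (trunc_dist x))// ?lerDl// le_max lexx orbT.
Qed.

Lemma log_dist_lip x y :
  log_dist x - log_dist y <= ln (1 + d%:R * `|x - y| / trunc_dist x).
Proof.
have tx := trunc_dist_gt0 x; have ty := trunc_dist_gt0 y.
rewrite /log_dist -ln_div ?posrE ?divr_gt0// ler_ln ?posrE ?divr_gt0//; last first.
  by rewrite ltr_pwDl// divr_ge0 ?mulr_ge0 ?(ltW tx).
have -> : rs / trunc_dist x / (rs / trunc_dist y) = trunc_dist y / trunc_dist x.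
  by field; rewrite !gt_eqF.
rewrite ler_pdivrMr// mulrDl mul1r divfK ?gt_eqF//; exact: trunc_dist_le_add.
Qed.

Lemma profile_diff_le x y : `|profile x - profile y| <= `|log_dist x - log_dist y|.
Proof.
rewrite /profile; move: (log_dist x) (log_dist y) (n%:R * ln b) => s t L.
rewrite ler_norml.
have H1 : s - t <= `|s - t| by exact: ler_norm.
have H2 : t - s <= `|s - t| by rewrite distrC ler_norm.
move: (`|s - t|) H1 H2 => D H1 H2.
have [] := leP s (L - s); have [] := leP t (L - t) => Ht Hs;
  [have [] := leP 0 s|have [] := leP 0 s|have [] := leP 0 (L - s)|have [] := leP 0 (L - s)] => H3;
  [have [] := leP 0 t|have [] := leP 0 t|have [] := leP 0 (L - t)|have [] := leP 0 (L - t)|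
   have [] := leP 0 t|have [] := leP 0 t|have [] := leP 0 (L - t)|have [] := leP 0 (L - t)] => H4;
  apply/andP; split; lra.
Qed.

Lemma profile_lip x y : trunc_dist x <= trunc_dist y ->
  `|profile x - profile y| <= ln (1 + d%:R * `|x - y| / trunc_dist x).
Proof.
move=> xy; apply: (le_trans (profile_diff_le x y)).
rewrite ger0_norm ?log_dist_lip// subr_ge0.
have tx := trunc_dist_gt0 x; have ty := trunc_dist_gt0 y.
rewrite /log_dist ler_ln ?posrE ?divr_gt0// ler_pM2l// lef_pV2//.
Qed.

Lemma profile_ge0 x : 0 <= profile x.
Proof. by rewrite le_max lexx. Qed.

Lemma profile_far x : rs <= edistance K x -> profile x = 0.
Proof.
move=> xr; apply/max_idPl; rewrite ge_min; apply/orP; left.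
rewrite -(ln1 R) /log_dist ler_ln ?posrE ?divr_gt0 ?trunc_dist_gt0//.
by rewrite ler_pdivrMr ?trunc_dist_gt0// mul1r le_max xr.
Qed.

Lemma profile_near x : edistance K x <= scale n -> profile x = 0.
Proof.
move=> xr; apply/max_idPl; rewrite ge_min; apply/orP; right.
rewrite /log_dist /trunc_dist (max_idPr xr) /scale.
have -> : rs / (rs / b ^+ n) = b ^+ n by field; rewrite !gt_eqF.
by rewrite lnXn// mulr_natl subrr.
Qed.

Lemma profile_le_log x : edistance K x < rs -> profile x <= log_dist x.
Proof.
move=> xr; rewrite /profile ge_max; apply/andP; split; last by rewrite ge_min lexx.
rewrite /log_dist ln_ge0// ler_pdivlMr ?trunc_dist_gt0// mul1r ge_max (ltW xr)/=.
by rewrite -[leRHS]scale0; exact: scale_le.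
Qed.

Lemma profile_le_half x : profile x <= n%:R * ln b / 2.
Proof.
have H : 0 <= n%:R * ln b by rewrite mulr_ge0 ?(ltW lnb0).
rewrite ge_max; apply/andP; split; first lra.
by rewrite ge_min; have [h|h] := leP (log_dist x) (n%:R * ln b / 2) => //=; lra.
Qed.

Lemma continuous_profile : continuous profile.
Proof.
have e0 := scale_gt0 n.
have H x y : trunc_dist x <= trunc_dist y ->
    `|profile x - profile y| <= d%:R / scale n * `|x - y|.
  move=> xy; apply: (le_trans (profile_lip xy)).
  have tx := trunc_dist_gt0 x.
  have z0 : 0 <= d%:R * `|x - y| / trunc_dist x by rewrite divr_ge0 ?mulr_ge0 ?(ltW tx).
  apply: (@le_trans _ _ (d%:R * `|x - y| / trunc_dist x)).
    by apply: le_ln1Dx; apply: lt_le_trans z0; rewrite ltrN10.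
  rewrite mulrAC ler_wpM2r// ler_wpM2l// lef_pV2 ?posrE//.
  by rewrite le_max lexx orbT.
apply: (@lipschitz_continuous_rV _ _ _ (d%:R / scale n)) => x y.
have [xy|/ltW yx] := leP (trunc_dist x) (trunc_dist y); first exact: H.
by rewrite distrC [`|x - y|]distrC; exact: H.
Qed.

Lemma measurable_profile : measurable_fun setT profile.
Proof. by apply: continuous_measurable_rV; exact: continuous_profile. Qed.

Lemma measurable_trunc_dist : measurable_fun setT trunc_dist.
Proof.
apply: continuous_measurable_rV; apply: (@lipschitz_continuous_rV _ _ _ d%:R) => x y.
rewrite ler_norml; have := trunc_dist_le_add x y; have := trunc_dist_le_add y x.
by rewrite [`|y - x|]distrC; lra.
Qed.

Variables CK : R.
Hypotheses (CK0 : 0 < CK) (tubeC : forall t, 0 < t <= rs -> (mu (tube K t) <= (CK * t ^+ k)%:E)%E).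

Let mtube t : measurable (tube K t).
Proof. by apply: open_measurable_rV; exact: open_edistance_lt. Qed.

Lemma scale_bracket x : edistance K x < rs -> scale n <= edistance K x ->
  exists j, (j < n)%N /\ scale j.+1 <= edistance K x < scale j.
Proof.
move=> xr xn.
have Ex : exists j : nat, scale j.+1 <= edistance K x by exists n.-1; rewrite prednK.
case: (ex_minnP Ex) => j Hj minj; exists j; split.
  have := minj n.-1; rewrite prednK// => /(_ xn) H.
  by rewrite (leq_ltn_trans H)// prednK.
rewrite Hj/=; case: j Hj minj => [|j] Hj minj; first by rewrite scale0.
by rewrite ltNge; apply/negP => /minj; rewrite ltnn.
Qed.

(** Each layer has volume of order dist^k, so dist^(- k) contributes at most CK b^k on it. There are
    n layers and the tube of radius [scale n], on which the distance is truncated. *)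
Lemma integral_trunc_dist_le :
  (\int[mu]_(x in tube K rs) (trunc_dist x `^ (- k%:R))%:E
     <= (CK * b ^+ k * n.+1%:R)%:E)%E.
Proof.
pose c j : R := if (j <= n)%N then scale j.+1 `^ (- k%:R) else 0.
pose m j : R := CK * scale j ^+ k.
apply: (integral_le_shells (S := fun j => tube K (scale j)) (c := c) (m := m)) => //.
- apply: measurableT_comp => //; apply: (measurable_funS measurableT) => //.
  exact: (measurableT_comp (measurable_powR _) measurable_trunc_dist).
- by move=> x _; rewrite lee_fin powR_ge0.
- by move=> j; rewrite /c; case: ifP => // _; exact: powR_ge0.
- move=> x xr.
  have H j : (j <= n)%N -> edistance K x < scale j -> scale j.+1 <= trunc_dist x ->
      exists2 j, tube K (scale j) x & ((trunc_dist x `^ (- k%:R))%:E <= (c j)%:E)%E.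
    move=> jn xj jx; exists j => //; rewrite /c jn lee_fin !powRN lef_pV2 ?posrE ?powR_gt0 ?scale_gt0 ?trunc_dist_gt0//.
    by apply: le_powR2 => //; exact: ltW (scale_gt0 _).
  have [xn|xn] := ltP (edistance K x) (scale n).
    apply: (H n) => //; rewrite (le_trans (scaleS_le _))// le_max lexx orbT//.
  have [j [jn /andP[j1 j2]]] := scale_bracket xr xn.
  by apply: (H j) => //; [exact: ltnW|rewrite le_max j1].
- move=> j; apply: (@le_trans _ _ (mu (tube K (scale j)))).
    apply: le_measure; rewrite ?inE//; first exact: measurableI.
  by apply: tubeC; rewrite scale_gt0 -[leRHS]scale0 scale_le.
move=> N.
have cm j : c j * m j = if (j < n.+1)%N then CK * b ^+ k else 0.
  rewrite /c /m ltnS; case: ifP => _; last by rewrite mul0r.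
  rewrite [scale j]scaleS exprMn powRN powR_mulrn ?(ltW (scale_gt0 _))//.
  have : scale j.+1 ^+ k != 0 by rewrite expf_neq0// gt_eqF ?scale_gt0.
  by move: (_ ^+ k) (_ ^+ k) => x y y0; field.
under eq_bigr do rewrite cm.
have Cb : 0 <= CK * b ^+ k by rewrite mulr_ge0 ?exprn_ge0 ?(ltW CK0) ?(ltW b0).
rewrite -[X in X <= _](big_mkord xpredT (fun j => if (j < n.+1)%N then CK * b ^+ k else 0)) -big_mkcond/=.
rewrite big_const_seq iter_addr_0 -[X in X <= _]mulr_natr ler_wpM2l// ler_nat.
have -> : count (fun i => (i < n.+1)%N) (index_iota 0 N) = minn N n.+1.
  rewrite /index_iota subn0; elim: N => [|N IH]; first by rewrite min0n.
  rewrite -[N.+1]addn1 iotaD count_cat IH /= add0n addn0 addn1.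
  case: ltnP => H; first by rewrite (minn_idPl H) addn1.
  by rewrite addn0 (minn_idPr (leqW H)).
exact: geq_minr.
Qed.

(** The first variable is the point of smaller truncated distance. If that point is outside the
    tube, so is the other one and the profile vanishes at both; hence a single indicator. *)
Definition log_kernel (z : 'rV[R]_d * 'rV[R]_d) : R :=
  \1_(tube K rs) z.1 *
  (ln (1 + d%:R * `|z.1 - z.2| / trunc_dist z.1) `^ p / enorm (z.1 - z.2) `^ (d%:R + k%:R)).

Lemma log_kernel_ge0 z : 0 <= log_kernel z.
Proof. by rewrite mulr_ge0 ?divr_ge0 ?powR_ge0. Qed.

Lemma measurable_log_kernel : measurable_fun setT log_kernel.
Proof.
have mtr (q : R) : measurable_fun setT (fun z : 'rV[R]_d * 'rV[R]_d => trunc_dist z.1 `^ q).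
  apply: (measurableT_comp (measurable_powR q)).
  exact: (measurableT_comp measurable_trunc_dist measurable_fst).
rewrite (_ : log_kernel = (fun z => \1_(tube K rs) z.1 *
  (ln (1 + d%:R * `|z.1 - z.2| * trunc_dist z.1 `^ (-1)) `^ p *
   enorm (z.1 - z.2) `^ (- (d%:R + k%:R))))); last first.
  by apply/funext => z; rewrite /log_kernel !powRN powRr1// ltW// trunc_dist_gt0.
apply: measurable_funM.
  apply: measurableT_comp; last exact: measurable_fst.
  by apply: measurable_indic; exact: mtube.
apply: measurable_funM; last first.
  by apply: (measurableT_comp (measurable_powR _)); exact: measurable_enorm_sub.
apply: (measurableT_comp (measurable_powR p)).
apply: measurableT_comp; first exact: measurable_ln.
apply: measurable_funD => //; apply: measurable_funM; last exact: mtr.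
by apply: measurable_funM => //; exact: measurable_norm_sub.
Qed.

Lemma profile_kernel_le x y :
  `|profile x - profile y| `^ p / enorm (x - y) `^ (d%:R + k%:R)
    <= log_kernel (x, y) + log_kernel (y, x).
Proof.
wlog xy : x y / trunc_dist x <= trunc_dist y => [H|].
  have [/H//|/ltW yx] := leP (trunc_dist x) (trunc_dist y).
  by rewrite [leRHS]addrC [`|profile x - profile y|]distrC enorm_distC; exact: H.
apply: (@le_trans _ _ (log_kernel (x, y))); last by rewrite lerDl log_kernel_ge0.
have [xr|xr] := ltP (edistance K x) rs.
  rewrite /log_kernel indicE mem_set//= mul1r ler_wpM2r ?invr_ge0 ?powR_ge0//.
  by apply: le_powR2 => //; [exact: ltW|exact: profile_lip].
have yr : rs <= edistance K y.
  move: xy; rewrite {1}/trunc_dist ge_max => /andP[+ _].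
  rewrite {1}/trunc_dist le_max => /orP[|] H; first exact: le_trans H.
  have := le_trans xr H; rewrite leNgt => /negP[].
  by rewrite ltr_pdivrMr// ltr_pMr// exprn_egt1 ?gt_eqF// -lt0n.
rewrite !profile_far// subrr normr0 powR0 ?gt_eqF// mul0r; exact: log_kernel_ge0.
Qed.

Lemma gagliardo_profile_le (s CL : R) : s * p = k%:R -> 0 < CL ->
  (forall x a A, 0 < a -> measurable A ->
    (\int[mu]_(y in A) (ln (1 + d%:R * `|x - y| / a) `^ p / enorm (x - y) `^ (d%:R + k%:R))%:E
      <= (CL * a `^ (- k%:R))%:E)%E) ->
  (gagliardo s p Omega profile <= (2 * (CL * (CK * b ^+ k)) * n.+1%:R)%:E)%E.
Proof.
move=> sp CL0 HL.
have mF : measurable_fun setT (fun z => (log_kernel z)%:E).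
  by apply: measurableT_comp => //; exact: measurable_log_kernel.
have F0 z : (0 <= (log_kernel z)%:E)%E by rewrite lee_fin log_kernel_ge0.
have H x y : ((`|profile x - profile y| `^ p / enorm (x - y) `^ (d%:R + s * p))%:E
    <= (log_kernel (x, y))%:E + (log_kernel (y, x))%:E)%E.
  by rewrite sp -EFinD lee_fin; exact: profile_kernel_le.
apply: (le_trans (gagliardo_le_sym mO measurable_profile mF F0 H)).
suff HI : (\int[mu]_(x in Omega) \int[mu]_(y in Omega) (log_kernel (x, y))%:E
    <= (CL * (CK * b ^+ k * n.+1%:R))%:E)%E.
  apply: (le_trans (leeD HI HI)); rewrite -EFinD lee_fin.
  by rewrite le_eqVlt; apply/orP; left; apply/eqP; ring.
have mtd A : measurable_fun A (fun x => (trunc_dist x `^ (- k%:R))%:E).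
  apply: measurableT_comp => //; apply: measurable_funTS.
  exact: (measurableT_comp (measurable_powR _) measurable_trunc_dist).
have mtC A : measurable_fun A (fun x => (CL * trunc_dist x `^ (- k%:R))%:E).
  by under eq_fun do rewrite EFinM; exact: measurable_funeM.
apply: (@le_trans _ _ (\int[mu]_(x in Omega) ((fun x => (CL * trunc_dist x `^ (- k%:R))%:E) \_ (tube K rs)) x)%E).
  apply: ge0_le_integral => //.
  - by move=> x _; apply: integral_ge0.
  - exact: (measurable_slice mu mF F0 mO mO).
  - by apply: measurable_funTS; apply/(measurable_restrictT _ (mtube rs)).
  - move=> x _; rewrite patchE /log_kernel /= indicE; case: ifPn => _; last first.
      by rewrite integral0_eq// => y _; rewrite mul0r.
    under eq_integral do rewrite mul1r.
    by apply: HL => //; exact: trunc_dist_gt0.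
rewrite -integral_mkcondr.
apply: (@le_trans _ _ (\int[mu]_(x in tube K rs) (CL * trunc_dist x `^ (- k%:R))%:E)%E).
  apply: ge0_subset_integral => //; first exact: measurableI.
  by move=> x _; rewrite lee_fin mulr_ge0 ?powR_ge0// ltW.
under eq_integral do rewrite EFinM.
rewrite ge0_integralZl_EFin//; last exact: ltW.
  by rewrite EFinM; apply: lee_wpmul2l; [rewrite lee_fin ltW|exact: integral_trunc_dist_le].
by move=> x _; rewrite lee_fin powR_ge0.
Qed.

(** The logarithm is at most (p / k) (rs / dist)^(k / p), whose p-th power is a multiple of dist^(-
    k). The resulting O(n) is crude but of the order of the energy. *)
Lemma integral_profile_le :
  (\int[mu]_(x in Omega) (`|profile x| `^ p)%:E
    <= ((p / k%:R) `^ p * rs ^+ k * (CK * b ^+ k) * n.+1%:R)%:E)%E.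
Proof.
have k0R : 0 < k%:R :> R by rewrite ltr0n.
have A0 : 0 <= (p / k%:R) `^ p * rs ^+ k by rewrite mulr_ge0 ?powR_ge0 ?exprn_ge0 ?(ltW rs0).
pose G x := ((p / k%:R) `^ p * rs ^+ k * trunc_dist x `^ (- k%:R))%:E.
have mG A : measurable_fun A G.
  apply: measurableT_comp => //; apply: measurable_funTS; apply: measurable_funM => //.
  exact: (measurableT_comp (measurable_powR _) measurable_trunc_dist).
have G0 x : (0 <= G x)%E by rewrite lee_fin mulr_ge0 ?powR_ge0.
apply: (@le_trans _ _ (\int[mu]_(x in Omega) (G \_ (tube K rs)) x)%E).
  apply: ge0_le_integral => //.
  - apply: measurableT_comp => //; apply: measurable_funTS.
    by apply: (measurableT_comp (measurable_powR _)); apply: measurableT_comp => //; exact: measurable_profile.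
  - by apply: measurable_funTS; apply/(measurable_restrictT _ (mtube rs)).
  move=> x _; rewrite patchE; case: ifPn => [|/negP] xT; last first.
    have xr : rs <= edistance K x by rewrite leNgt; apply/negP => ?; apply: xT; rewrite inE.
    by rewrite profile_far// normr0 powR0 ?gt_eqF.
  have xr : edistance K x < rs by move: xT; rewrite inE.
  have tx := trunc_dist_gt0 x.
  rewrite /G lee_fin ger0_norm ?profile_ge0//.
  have z0 : 0 < rs / trunc_dist x by rewrite divr_gt0.
  have H := le_trans (profile_le_log xr) (ln_le_powR z0 (divr_gt0 k0R p0)).
  apply: (le_trans (le_powR2 (ltW p0) (profile_ge0 x) H)).
  have -> : (rs / trunc_dist x) `^ (k%:R / p) / (k%:R / p) =
      (p / k%:R) * (rs / trunc_dist x) `^ (k%:R / p) by field; rewrite !gt_eqF.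
  rewrite powRM ?powR_ge0// -?powRrM ?divfK ?gt_eqF//; last by rewrite divr_ge0 ?ltW.
  by rewrite -mulrA ler_wpM2l ?powR_ge0// powR_mulrn ?(ltW z0)// expr_div_n powRN powR_mulrn// ltW.
rewrite -integral_mkcondr.
apply: (@le_trans _ _ (\int[mu]_(x in tube K rs) G x)%E).
  by apply: ge0_subset_integral => //; exact: measurableI.
rewrite {mG G0}/G; move: (_ * _) A0 => Ac A0.
under eq_integral do rewrite EFinM.
rewrite ge0_integralZl_EFin//.
- rewrite -mulrA (EFinM Ac); apply: lee_wpmul2l; first by rewrite lee_fin.
  exact: integral_trunc_dist_le.
- by move=> x _; rewrite lee_fin powR_ge0.
apply: measurableT_comp => //; apply: measurable_funTS.
exact: (measurableT_comp (measurable_powR _) measurable_trunc_dist).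
Qed.

Lemma sobolev_off_profile (s : R) :
  (gagliardo s p Omega profile < +oo)%E -> sobolev_off s p Omega K profile.
Proof.
move=> H; split; last 2 first.
- by apply: continuous_subspaceT => x; exact: continuous_profile.
- exists (tube K (scale n)); split; first exact: open_edistance_lt.
    by move=> x Kx; rewrite /tube/= edistance_eq0// scale_gt0.
  by move=> x [/ltW xn _]; exact: profile_near.
split => //; first by apply: measurable_funTS; exact: measurable_profile.
by apply: (le_lt_trans integral_profile_le); rewrite ltry.
Qed.

End profile.

Lemma sobolev_off_sobolev0 {R : realType} {d : nat} (s p : R) (Omega K : set 'rV[R]_d) u :
  0 < p -> sobolev_off s p Omega K u -> sobolev0 s p Omega K u.
Proof.
move=> p0 Hu; split; first by case: Hu.
move=> e e0; exists u => //.
rewrite /sobolev_norm /gagliardo.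
have E0 (x : 'rV[R]_d) : (u \- u) x = 0 by rewrite /= subrr.
rewrite integral0_eq; last first.
  by move=> x _; rewrite integral0_eq// => y _; rewrite !E0 subrr normr0 powR0 ?gt_eqF// mul0r.
rewrite integral0_eq; last by move=> x _; rewrite E0 normr0 powR0 ?gt_eqF.
by rewrite adde0 poweR0r ?lte_fin// gt_eqF// invr_gt0.
Qed.

(** * Optimality of the weight *)

Section lower_bound.
Context {R : realType} {d : nat}.
Local Notation mu := (lebesgue_rV (R := R) d).
Variables (k : nat) (p : R) (Omega K : set 'rV[R]_d).
Hypothesis p0 : 0 < p.
Hypotheses (mO : measurable Omega) (K0 : K !=set0).
Variables (rs b CK ck R0 : R).
Hypotheses (rs0 : 0 < rs) (b1 : 1 < b).
Hypothesis bCc : 2 * CK <= ck * b ^+ k.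
Hypothesis tubeC : forall t, 0 < t <= rs ->
  ((ck * t ^+ k)%:E <= mu (tube K t) <= (CK * t ^+ k)%:E)%E.
Hypotheses (tubeO : tube K rs `<=` Omega) (R00 : 0 < R0).
Hypothesis distR : forall x, Omega x -> edistance K x < R0.
Variable q : nat.
Hypotheses (q0 : (0 < q)%N) (qR : ln (2 * R0 / rs) <= q%:R * ln b).

Let n := (4 * q)%N.
Let n0 : (0 < n)%N. Proof. by rewrite muln_gt0. Qed.
Local Notation sc := (scale rs b).
Local Notation u := (profile K rs b n).
Let b0 : 0 < b. Proof. exact: lt_trans b1. Qed.
Let lnb0 : 0 < ln b. Proof. by rewrite ln_gt0. Qed.
Let sc0 j : 0 < sc j. Proof. exact: scale_gt0. Qed.
Let qb0 : 0 < q%:R * ln b. Proof. by rewrite mulr_gt0 ?ltr0n. Qed.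

Let mtube t : measurable (tube K t).
Proof. by apply: open_measurable_rV; exact: open_edistance_lt. Qed.

Definition dist_shell j : set 'rV[R]_d := tube K (sc j) `\` tube K (sc j.+1).

Lemma measurable_dist_shell j : measurable (dist_shell j).
Proof. exact: measurableD. Qed.

(** The ratio b is so large that the inner tube has at most half the guaranteed volume of the outer
    one. *)
Lemma measure_dist_shell_ge j : ((ck / 2 * sc j ^+ k)%:E <= mu (dist_shell j))%E.
Proof.
have Hs i : 0 < sc i <= rs by rewrite sc0 -[leRHS](scale0 rs b) scale_le.
have /andP[H1 _] := tubeC (Hs j); have /andP[_ H2] := tubeC (Hs j.+1).
have : (mu (tube K (sc j)) <= mu (dist_shell j `|` tube K (sc j.+1)))%E.
  apply: le_measure; rewrite ?inE//.
    by apply: measurableU => //; exact: measurable_dist_shell.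
  by move=> x xj; have [?|?] := pselect (tube K (sc j.+1) x); [right|left].
move=> /le_trans/(_ (measureU2 _ (measurable_dist_shell j) (mtube _))) H3.
have := le_trans H1 (le_trans H3 (leeD2l _ H2)).
rewrite addeC -leeBlDl// -EFinB => /(le_trans _); apply.
rewrite lee_fin (scaleS rs b1 j) exprMn.
have : 0 < sc j.+1 ^+ k by rewrite exprn_gt0.
have H := bCc; move: (b ^+ k) (sc j.+1 ^+ k) H => B S H S0.
nra.
Qed.

Lemma profile_ge x j : (q <= j < 2 * q)%N -> dist_shell j x -> q%:R * ln b <= u x.
Proof.
move=> /andP[qj jq] [xj /negP]; rewrite -leNgt => xj1.
rewrite /tube/= in xj.
have xq : edistance K x < sc q by exact: lt_le_trans xj (scale_le rs0 b1 qj).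
have x2q : sc (2 * q) <= edistance K x by apply: le_trans xj1; exact: scale_le.
have xn : sc n <= edistance K x.
  by apply: le_trans x2q; apply: scale_le => //; rewrite leq_mul2r orbT.
have e0 : 0 < edistance K x by exact: lt_le_trans xn.
have tE : trunc_dist K rs b n x = edistance K x by exact/max_idPl.
rewrite /profile le_max; apply/orP; right; rewrite le_min /log_dist tE.
have bn i : 0 < b ^+ i by rewrite exprn_gt0.
have L1 : q%:R * ln b <= ln (rs / edistance K x).
  rewrite mulr_natl -lnXn// ler_ln ?posrE ?divr_gt0// ler_pdivlMr// mulrC -ler_pdivlMr//.
  exact: ltW.
have L2 : ln (rs / edistance K x) <= (2 * q)%:R * ln b.
  rewrite mulr_natl -lnXn// ler_ln ?posrE ?divr_gt0// ler_pdivrMr// mulrC -ler_pdivrMr//.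
rewrite L1/=; move: L2; rewrite /n !natrM; have := qb0.
by move: (ln (rs / _)) (ln b) => L B; nra.
Qed.

(** The logarithm of the weight is at most ln (2 R0 / rs) + 2 q ln b, and q is large enough to
    absorb the first term in one more q ln b. *)
Lemma hardy_weight_ge x j : (q <= j < 2 * q)%N -> dist_shell j x -> Omega x ->
  (sc j ^+ k * (3 * (q%:R * ln b)) `^ p)^-1 <= hardy_weight K R0 k%:R p x.
Proof.
move=> /andP[qj jq] [xj /negP]; rewrite -leNgt => xj1 Ox.
rewrite /tube/= in xj.
have e0 : 0 < edistance K x by exact: lt_le_trans xj1.
have x2q : sc (2 * q) <= edistance K x by apply: le_trans xj1; exact: scale_le.
have R1 : 1 < 2 * R0 / edistance K x.
  by rewrite ltr_pdivlMr// mul1r; have := distR Ox; have := R00; lra.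
have L0 : 0 < ln (2 * R0 / edistance K x) by rewrite ln_gt0.
have L3 : 0 < 3 * (q%:R * ln b) by rewrite mulr_gt0.
rewrite /hardy_weight powR_mulrn ?(ltW e0)// lef_pV2 ?posrE ?mulr_gt0 ?exprn_gt0 ?powR_gt0//.
apply: ler_pM; rewrite ?exprn_ge0 ?powR_ge0 ?(ltW e0)//.
  by apply: lerXn2r; rewrite ?nnegrE ?(ltW e0) ?(ltW (sc0 _)) ?(ltW xj).
apply: le_powR2; rewrite ?(ltW p0) ?(ltW L0)//.
have bn i : 0 < b ^+ i by rewrite exprn_gt0.
apply: (@le_trans _ _ (ln (2 * R0 / rs * b ^+ (2 * q)))).
  rewrite ler_ln ?posrE ?mulr_gt0 ?invr_gt0// -!mulrA ler_pM2l// ler_pM2l//.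
  rewrite [rs^-1 * _]mulrC -invf_div lef_pV2 ?posrE ?divr_gt0//.
rewrite lnM ?posrE ?divr_gt0 ?mulr_gt0// lnXn// -[ln b *+ _]mulr_natl natrM.
by have := qR; move: (ln (2 * _ / _)) => L; lra.
Qed.

(** On the q shells |u - a| is at least q ln b / 2 and the logarithm at most 3 q ln b, so their
    quotient is at least 1/6: a shell contributes an amount independent of q. The constant a is 0 or
    the average of u. *)
Lemma weighted_integral_ge (f : 'rV[R]_d -> R) (a M : R) :
  0 <= a <= q%:R * ln b / 2 -> 0 <= M -> measurable_fun Omega f ->
  (forall x, (Omega `\` K) x -> edistance K x < sc q -> M <= `|f x|) ->
  ((M * (6 `^ p)^-1 * (ck / 2) * q%:R)%:E <=
   \int[mu]_(x in Omega) (`|f x| * `|u x - a| `^ p * hardy_weight K R0 k%:R p x)%:E)%E.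
Proof.
move=> /andP[a0 aq] M0 mf fM.
pose F x := `|f x| * `|u x - a| `^ p * hardy_weight K R0 k%:R p x.
have F0 x : 0 <= F x by rewrite !mulr_ge0 ?powR_ge0 ?hardy_weight_ge0.
pose c (i : nat) := M * (6 `^ p)^-1 * (sc (q + i) ^+ k)^-1.
have c0 i : 0 <= c i by rewrite !mulr_ge0 ?invr_ge0 ?powR_ge0 ?exprn_ge0 ?(ltW (sc0 _)).
have subO j : dist_shell j `<=` Omega.
  move=> x [xj _]; apply: tubeO; apply: (lt_le_trans xj).
  by rewrite -[leRHS](scale0 rs b) scale_le.
have Fc x (i : 'I_q) : dist_shell (q + i) x -> c i <= F x.
  move=> xi; have Ox := subO _ _ xi.
  have Hi : (q <= q + i < 2 * q)%N by rewrite leq_addr mul2n -addnn ltn_add2l ltn_ord.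
  have Hu := profile_ge Hi xi; have Hw := hardy_weight_ge Hi xi Ox.
  have xq : edistance K x < sc q.
    by case: xi => xi _; apply: (lt_le_trans xi); apply: scale_le => //; exact: leq_addr.
  have nK : ~ K x.
    move=> Kx; case: xi => _; apply; rewrite /tube/= edistance_eq0//; exact: sc0.
  have Hf := fM x (conj Ox nK) xq.
  have Hua : (q%:R * ln b / 2) `^ p <= `|u x - a| `^ p.
    apply: le_powR2; [exact: ltW|by rewrite divr_ge0// ltW|].
    by apply: (le_trans _ (ler_norm _)); lra.
  apply: (@le_trans _ _ (M * (q%:R * ln b / 2) `^ p * (sc (q + i) ^+ k * (3 * (q%:R * ln b)) `^ p)^-1)).
    rewrite le_eqVlt; apply/orP; left; apply/eqP.
    have -> : 3 * (q%:R * ln b) = 6 * (q%:R * ln b / 2) by field.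
    have -> : (6 * (q%:R * ln b / 2)) `^ p = 6 `^ p * (q%:R * ln b / 2) `^ p.
      by rewrite powRM// divr_ge0// ltW.
    rewrite /c.
    have : 6 `^ p != 0 :> R by rewrite gt_eqF ?powR_gt0.
    have : (q%:R * ln b / 2) `^ p != 0 by rewrite gt_eqF ?powR_gt0// divr_gt0.
    have : sc (q + i) ^+ k != 0 by rewrite gt_eqF ?exprn_gt0.
    by move: (sc _ ^+ _) (_ `^ p) (6 `^ p) => x1 x2 x3 h1 h2 h3; field; rewrite h1 h2 h3.
  rewrite /F; apply: ler_pM; rewrite ?mulr_ge0 ?powR_ge0 ?invr_ge0 ?mulr_ge0 ?powR_ge0 ?exprn_ge0 ?(ltW (sc0 _))//.
  by apply: ler_pM => //; exact: powR_ge0.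
pose G x := (\sum_(i < q) (c i * \1_(dist_shell (q + i)) x)%:E)%E.
have GF x : (G x <= (F x)%:E)%E.
  rewrite /G sumEFin lee_fin.
  apply: (@le_trans _ _ (\sum_(i < q) F x * ((sc (q + i).+1 <= edistance K x < sc (q + i))%R)%:R)).
    apply: ler_sum => i _; rewrite indicE.
    have [xi|xi] := pselect (dist_shell (q + i) x); last first.
      by rewrite memNset// mulr0 mulr_ge0.
    rewrite mem_set// mulr1; case: (xi) => x1 /negP; rewrite -leNgt => x2.
    by rewrite x2 [X in (true && X)%:R]x1/= mulr1; exact: Fc.
  rewrite -mulr_sumr -[leRHS]mulr1 ler_wpM2l//.
  have := sum_between_le1 (r := fun i => sc (q + i)) q (edistance K x).
  under eq_bigr do rewrite addnS.
  by apply => i; rewrite addnS; exact: scaleS_le.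
have mG : measurable_fun Omega G.
  apply: emeasurable_sum => i; apply: measurableT_comp => //; apply: measurable_funM => //.
  apply: measurable_funTS; apply: measurable_indic; exact: measurable_dist_shell.
apply: (@le_trans _ _ (\int[mu]_(x in Omega) G x)%E); last first.
  apply: ge0_le_integral => //.
  - by move=> x _; apply: sume_ge0 => i _; rewrite lee_fin mulr_ge0.
  apply: measurableT_comp => //; apply: measurable_funM; last first.
    by apply: measurable_funTS; exact: measurable_hardy_weight.
  apply: measurable_funM; first exact: measurableT_comp.
  apply: (measurableT_comp (measurable_powR _)); apply: measurableT_comp => //.
  by apply: measurable_funB => //; apply: measurable_funTS; exact: measurable_profile.
rewrite /G ge0_integral_sum//; last 2 first.
- move=> i; apply: measurableT_comp => //; apply: measurable_funM => //.
  apply: measurable_funTS; apply: measurable_indic; exact: measurable_dist_shell.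
- by move=> i x _; rewrite lee_fin mulr_ge0.
apply: (@le_trans _ _ (\sum_(i < q) (M * (6 `^ p)^-1 * (ck / 2))%:E)%E).
  by rewrite sumEFin lee_fin sumr_const card_ord -[leRHS]mulr_natr.
apply: lee_sum => i _; under eq_integral do rewrite EFinM.
rewrite ge0_integralZl_EFin//; last 1 first.
- apply: measurableT_comp => //; apply: measurable_funTS; apply: measurable_indic.
  exact: measurable_dist_shell.
rewrite integral_indic//; last exact: measurable_dist_shell.
rewrite (setIidl (@subO _)).
apply: (@le_trans _ _ ((c i)%:E * (ck / 2 * sc (q + i) ^+ k)%:E)%E); last first.
  by apply: lee_wpmul2l; [rewrite lee_fin|exact: measure_dist_shell_ge].
rewrite -EFinM lee_fin /c le_eqVlt; apply/orP; left; apply/eqP.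
have : sc (q + i) ^+ k != 0 by rewrite gt_eqF ?exprn_gt0.
have : 6 `^ p != 0 :> R by rewrite gt_eqF ?powR_gt0.
by move: (sc _ ^+ _) (6 `^ p) => x1 x2 h1 h2; field; rewrite h1 h2.
Qed.

(** The profile is at most 2 q ln b and lives on a tube that fills at most a quarter of Omega. *)
Lemma average_profile_le (m : R) : 0 < m -> mu Omega = m%:E -> CK * rs ^+ k <= m / 4 ->
  0 <= average Omega u <= q%:R * ln b / 2.
Proof.
move=> m0 muO Cm; rewrite /average muO /=.
have mu_u A : measurable_fun A u by apply: measurable_funTS; exact: measurable_profile.
have I0 : (0 <= \int[mu]_(x in Omega) (u x)%:E)%E.
  by apply: integral_ge0 => x _; rewrite lee_fin profile_ge0.
have IM : (\int[mu]_(x in Omega) (u x)%:E <= (2 * (q%:R * ln b) * (m / 4))%:E)%E.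
  have L0 : 0 <= 2 * (q%:R * ln b) by rewrite mulr_ge0// ltW.
  apply: (@le_trans _ _ (\int[mu]_(x in Omega) (cst (2 * (q%:R * ln b))%:E \_ (tube K rs)) x)%E).
    apply: ge0_le_integral => //.
    - by move=> x _; rewrite lee_fin profile_ge0.
    - exact: measurableT_comp.
    - by apply: measurable_funTS; apply/(measurable_restrictT _ (mtube rs)).
    move=> x _; rewrite patchE; case: ifPn => [_|/negP xT].
      rewrite /= lee_fin; apply: (le_trans (profile_le_half K rs b1 n x)).
      by rewrite /n natrM; lra.
    rewrite profile_far// leNgt; apply/negP => ?; apply: xT; rewrite inE//.
  rewrite -integral_mkcondr integral_cst; last exact: measurableI.
  rewrite [leRHS](EFinM (2 * (q%:R * ln b))); apply: lee_wpmul2l; first by rewrite lee_fin.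
  apply: (@le_trans _ _ (mu (tube K rs))).
    by apply: le_measure; rewrite ?inE//; exact: measurableI.
  have /andP[_ H] : ((ck * rs ^+ k)%:E <= mu (tube K rs) <= (CK * rs ^+ k)%:E)%E.
    by apply: tubeC; rewrite rs0 lexx.
  by apply: (le_trans H); rewrite lee_fin.
rewrite /Rintegral; have If : (\int[mu]_(x in Omega) (u x)%:E)%E \is a fin_num.
  by rewrite ge0_fin_numE// (le_lt_trans IM)// ltry.
move: I0 IM; rewrite -(fineK If) !lee_fin.
move: (fine _) => I I0 IM; rewrite mulr_ge0 ?invr_ge0 ?(ltW m0)//=.
rewrite mulrC ler_pdivrMr//; apply: (le_trans IM).
by rewrite le_eqVlt; apply/orP; left; apply/eqP; field.
Qed.

End lower_bound.

Section optimality.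
Context {R : realType} {d : nat}.
Local Notation mu := (lebesgue_rV (R := R) d).
Implicit Types (Omega K : set 'rV[R]_d).

Lemma compact_tube_sub Omega K : compact K -> K !=set0 -> open Omega -> K `<=` Omega ->
  exists2 r : R, 0 < r & tube K r `<=` Omega.
Proof.
move=> cK K0 oO KO.
pose P (c : R) z := ball z c `<=` Omega.
have /compact_near_coveringP ncK := cK.
have nP : \forall c \near (0 : R)^'+, K `<=` P c.
  apply: (ncK _ _ P) => x0 Kx0.
  have /nbhs_ballP[e /= e0 He] := open_nbhs_nbhs (conj oO (KO _ Kx0)).
  have e20 : 0 < e / 2 by rewrite divr_gt0.
  exists (ball x0 (e / 2), [set c | c <= e / 2]) => /=.
    by split; [exact: nbhsx_ballx|exact: nbhs_right_le].
  move=> [x c] [/= /in_ball xe ce] y /in_ball yx; apply: He; apply/in_ball.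
  rewrite (le_lt_trans (ler_distD x _ _))//.
  by move: xe yx; set u := `|_|; set v := `|_|; lra.
have : \forall c \near (0 : R)^'+, 0 < c /\ K `<=` P c.
  by near=> c; split => //; near: c.
move/filter_ex => [c [c0 KP]]; exists c => // y /(edistance_ltP K0)[x Kx yx].
apply: (KP _ Kx); apply/in_ball; rewrite distrC.
exact: le_lt_trans (norm_le_enorm _) yx.
Unshelve. all: by end_near. Qed.

Section weight.
Variables (k : nat) (s p R0 : R) (Omega K : set 'rV[R]_d).
Hypotheses (d0 : (0 < d)%N) (k0 : (0 < k)%N) (kp : k%:R < p) (spk : s * p = k%:R).
Hypotheses (oO : open Omega) (bO : bounded_set Omega) (cK : compact K) (K0 : K !=set0).
Hypotheses (KO : K `<=` Omega) (tK : tame_codim k K) (R00 : 0 < R0).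
Hypothesis dR : forall x, Omega x -> edistance K x < R0.

Let p0 : 0 < p. Proof. by apply: lt_trans kp; rewrite ltr0n. Qed.
Let mO : measurable Omega. Proof. exact: open_measurable_rV. Qed.

(** Energy and weighted integral are of the same order N, with a ratio [A] that does not depend on
    r; an unbounded factor M must therefore violate any inequality. *)
Lemma log_test_functions : exists2 A : R, 0 < A & forall r, 0 < r ->
  exists (u : 'rV[R]_d -> R) (N : R), [/\ 0 < N, sobolev0 s p Omega K u,
    (gagliardo s p Omega u + \int[mu]_(x in Omega) (`|u x| `^ p)%:E <= N%:E)%E &
    forall (f : 'rV[R]_d -> R) (a M : R), a = 0 \/ a = average Omega u -> 0 <= M ->
      measurable_fun Omega f ->
      (forall x, (Omega `\` K) x -> edistance K x < r -> M <= `|f x|) ->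
      ((A * M * N)%:E <=
       \int[mu]_(x in Omega) (`|f x| * `|u x - a| `^ p * hardy_weight K R0 k%:R p x)%:E)%E].
Proof.
have [rho0 [CK [ck [rho00 CK0 ck0 _ tg]]]] := tK.
have [r1 r10 r1O] := compact_tube_sub cK K0 oO KO.
have [MO _ muO] := bounded_measure_le bO mO.
have fO : mu Omega \is a fin_num by rewrite ge0_fin_numE// (le_lt_trans muO)// ltry.
set m := fine (mu Omega); have mE : mu Omega = m%:E by rewrite fineK.
have mtube t : measurable (tube K t).
  by apply: open_measurable_rV; exact: open_edistance_lt.
have m0 : 0 < m.
  pose t := Num.min r1 rho0.
  have t0 : 0 < t by rewrite lt_min r10.
  have [H _] : ((ck * t ^+ k)%:E <= mu (tube K t))%E /\ (mu (tube K t) <= (CK * t ^+ k)%:E)%E.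
    by apply: tg; rewrite t0 ge_min lexx orbT.
  rewrite -lte_fin -mE (@lt_le_trans _ _ (ck * t ^+ k)%:E)//.
    by rewrite lte_fin mulr_gt0// exprn_gt0.
  apply: (le_trans H); apply: le_measure; rewrite ?inE//.
  by apply: subset_trans r1O => x /lt_le_trans; apply; rewrite ge_min lexx.
(* The first summand gives ck b >= 2 CK, the second b > 1, and then b <= b^k. *)
pose b := 2 * CK / ck + 2.
have b1 : 1 < b.
  by have : 0 <= 2 * CK / ck by [rewrite divr_ge0 ?(ltW ck0)// mulr_ge0// ltW]; rewrite /b; lra.
have b0 : 0 < b by exact: lt_trans b1.
have bCc : 2 * CK <= ck * b ^+ k.
  apply: (@le_trans _ _ (ck * b)).
    by rewrite /b mulrDr mulrCA divff ?gt_eqF// mulr1 lerDl mulr_ge0// ltW.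
  by rewrite ler_pM2l// ler_eXnr// ltW.
(* The four bounds keep the tube inside Omega, keep the volume bounds valid, give rs^k <= rs, and
   limit the tube to a quarter of the volume of Omega. *)
pose rs := Num.min r1 (Num.min rho0 (Num.min 1 (m / (4 * CK)))).
have rs0 : 0 < rs by rewrite !lt_min r10 rho00 ltr01/= divr_gt0// mulr_gt0.
have [rsr1 rsrho rs1 rsm] : [/\ rs <= r1, rs <= rho0, rs <= 1 & rs <= m / (4 * CK)].
  by rewrite /rs !ge_min !lexx !orbT.
have tubeC t : 0 < t <= rs -> ((ck * t ^+ k)%:E <= mu (tube K t) <= (CK * t ^+ k)%:E)%E.
  move=> /andP[t0 trs]; apply/andP; apply: tg; rewrite t0; exact: le_trans rsrho.
have tubeC' t : 0 < t <= rs -> (mu (tube K t) <= (CK * t ^+ k)%:E)%E.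
  by move=> /tubeC/andP[].
have tubeO : tube K rs `<=` Omega.
  by apply: subset_trans r1O => x /lt_le_trans; apply.
have Cm : CK * rs ^+ k <= m / 4.
  apply: (@le_trans _ _ (CK * rs)); first by rewrite ler_pM2l// -[leRHS]expr1 ler_wiXn2l// ltW.
  by move: rsm; rewrite ler_pdivlMr ?mulr_gt0//; lra.
have [CL CL0 HL] := integral_log_kernel d0 k0 kp.
pose Cg := 2 * (CL * (CK * b ^+ k)) + (p / k%:R) `^ p * rs ^+ k * (CK * b ^+ k).
have Cg0 : 0 < Cg.
  rewrite ltr_pwDl// ?mulr_gt0 ?exprn_gt0//.
  by rewrite !mulr_ge0 ?powR_ge0 ?exprn_ge0 ?(ltW CK0) ?(ltW b0) ?(ltW rs0).
have lnb0 : 0 < ln b by rewrite ln_gt0.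
exists ((6 `^ p)^-1 * (ck / 2) / (5 * Cg)).
  by rewrite divr_gt0 ?mulr_gt0 ?invr_gt0 ?powR_gt0 ?divr_gt0.
move=> r r0.
(* Large enough for [hardy_weight_ge] and for the shells in use to lie within distance r of K, where
   f is large. *)
pose q := (Num.truncn ((`|ln (2 * R0 / rs)| + `|ln (rs / r)|) / ln b)).+1.
have q0 : (0 < q)%N by [].
have qX : `|ln (2 * R0 / rs)| + `|ln (rs / r)| <= q%:R * ln b.
  rewrite -ler_pdivrMr// ltW//.
  have /truncn_itv/andP[_] : 0 <= (`|ln (2 * R0 / rs)| + `|ln (rs / r)|) / ln b; last by [].
  by rewrite divr_ge0 ?addr_ge0// ltW.
have qR : ln (2 * R0 / rs) <= q%:R * ln b.
  by apply: le_trans qX; rewrite ler_wpDr// ler_norm.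
have qr : scale rs b q <= r.
  have : ln (rs / r) <= q%:R * ln b by apply: le_trans qX; rewrite ler_wpDl// ler_norm.
  have bq : 0 < b ^+ q by rewrite exprn_gt0.
  rewrite mulr_natl -lnXn// ler_ln ?posrE ?divr_gt0// ler_pdivrMr//.
  by rewrite /scale ler_pdivrMr// mulrC.
pose n := (4 * q)%N; have n0 : (0 < n)%N by rewrite muln_gt0.
pose u := profile K rs b n.
have nq : n.+1%:R <= 5 * q%:R :> R by rewrite -natrM ler_nat (mulnDl 1 4) mul1n -add1n leq_add2r.
have G1 := gagliardo_profile_le k0 kp mO K0 rs0 b1 n0 CK0 tubeC' spk CL0 HL.
have G2 := integral_profile_le k0 kp mO K0 rs0 b1 n0 CK0 tubeC'.
have GN : (gagliardo s p Omega u + \int[mu]_(x in Omega) (`|u x| `^ p)%:E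
    <= (Cg * (5 * q%:R))%:E)%E.
  apply: (le_trans (leeD G1 G2)); rewrite -EFinD lee_fin -mulrDl.
  by rewrite ler_wpM2l// ltW.
exists u, (Cg * (5 * q%:R)); split => //.
- by rewrite !mulr_gt0// ltr0n.
- apply: sobolev_off_sobolev0 => //.
  apply: (sobolev_off_profile k0 kp mO K0 rs0 b1 n0 CK0 tubeC').
  by apply: (le_lt_trans G1); rewrite ltry.
move=> f a M Ha M0 mf fM.
have aq : 0 <= a <= q%:R * ln b / 2.
  case: Ha => ->; first by rewrite lexx divr_ge0// mulr_ge0// ltW.
  exact: (average_profile_le mO K0 rs0 b1 tubeC q0 m0 mE Cm).
have fM' x : (Omega `\` K) x -> edistance K x < scale rs b q -> M <= `|f x|.
  by move=> xO xq; apply: fM => //; exact: lt_le_trans qr.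
have H := weighted_integral_ge p0 mO K0 rs0 b1 bCc tubeC tubeO R00 dR q0 qR aq M0 mf fM'.
apply: le_trans H.
  rewrite lee_fin le_eqVlt; apply/orP; left; apply/eqP.
  have : 6 `^ p != 0 :> R by rewrite gt_eqF ?powR_gt0.
  have : Cg != 0 by rewrite gt_eqF.
  by generalize Cg (6 `^ p) => x1 x2 h1 h2; field; rewrite h1 h2.
Qed.

Lemma hardy_weight_optimal : optimal_weight s p Omega K (hardy_weight K R0 k%:R p).
Proof.
have [A A0 HA] := log_test_functions.
split=> -[f [mf fK [C C0 HC]]].
  (* Then A M N exceeds C^p N, the p-th power of the right-hand side of the alleged inequality. *)
  pose M := (C `^ p + 1) / A.
  have M0 : 0 < M by rewrite divr_gt0// ltr_wpDl ?powR_ge0.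
  have [r r0 fM] := fK M.
  have [u [N [N0 u0 uN Hf]]] := HA r r0.
  have := HC u u0; rewrite leNgt => /negP; apply.
  have fM' x : (Omega `\` K) x -> edistance K x < r -> M <= `|f x|.
    by move=> xO xr; rewrite (le_trans (ltW (fM x xO xr)))// ler_norm.
  have := Hf f 0 M (or_introl erefl) (ltW M0) mf fM'.
  under eq_integral do rewrite subr0.
  move=> HI.
  have poweR_mono (x y : \bar R) : (0 <= x -> x <= y -> x `^ p^-1 <= y `^ p^-1)%E.
    move=> x0 xy; apply: gt0_ler_poweR => //; rewrite ?invr_ge0 ?(ltW p0)//.
      by rewrite in_itv/= x0 leey.
    by rewrite in_itv/= (le_trans x0 xy) leey.
  have AMN : A * M * N = (C `^ p + 1) * N by rewrite /M mulrCA divff ?gt_eqF// mulr1.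
  rewrite AMN in HI.
  have CN0 : 0 <= (C `^ p + 1) * N by rewrite mulr_ge0 ?addr_ge0 ?powR_ge0 ?(ltW N0).
  apply: lt_le_trans (poweR_mono _ _ _ HI); last by rewrite lee_fin.
  apply: (@le_lt_trans _ _ (C%:E * (N%:E `^ p^-1))%E).
    apply: lee_wpmul2l; first by rewrite lee_fin ltW.
    apply: poweR_mono => //; apply: adde_ge0; apply: integral_ge0 => x _.
      by apply: integral_ge0 => y _; rewrite lee_fin divr_ge0 ?powR_ge0.
    by rewrite lee_fin powR_ge0.
  rewrite !poweR_EFin -EFinM lte_fin powRM ?addr_ge0 ?powR_ge0 ?(ltW N0)//.
  rewrite ltr_pM2r ?powR_gt0// -[ltLHS]powRr1 ?(ltW C0)//.
  rewrite -[1 in ltLHS](mulfV (lt0r_neq0 p0)) powRrM gt0_ltr_powR ?invr_gt0 ?nnegrE ?powR_ge0//.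
    by rewrite addr_ge0// powR_ge0.
  by rewrite ltrDl.
pose M := (C + 1) / A.
have M0 : 0 < M by rewrite divr_gt0// ltr_wpDl// ltW.
have [r r0 fM] := fK M.
have [u [N [N0 u0 uN Hf]]] := HA r r0.
have := HC u u0; rewrite leNgt => /negP; apply.
have fM' x : (Omega `\` K) x -> edistance K x < r -> M <= `|f x|.
  by move=> xO xr; rewrite (le_trans (ltW (fM x xO xr)))// ler_norm.
apply: lt_le_trans (Hf f (average Omega u) M (or_intror erefl) (ltW M0) mf fM').
apply: (@le_lt_trans _ _ (C * N)%:E).
  rewrite EFinM; apply: lee_wpmul2l; first by rewrite lee_fin ltW.
  apply: le_trans uN; rewrite leeDl//; apply: integral_ge0 => x _.
  by rewrite lee_fin powR_ge0.
by rewrite lte_fin ltr_pM2r// /M mulrCA divff ?gt_eqF// mulr1 ltrDl.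
Qed.

End weight.
End optimality.

Theorem theorem1 (R : realType) (d k : nat) (s p R0 : R)
  (Omega K : set 'rV[R]_d)
  (hd : (2 <= d)%N) (hs : 0 < s < 1) (hp : 1 < p)
  (hOmega : bounded_lipschitz_domain Omega)
  (hk : (1 < k <= d)%N) (hKc : compact K) (hKOmega : K `<=` Omega)
  (hKlt : (k < d)%N -> C01_surface Omega k K)
  (hKeq : k = d -> Omega 0 /\ K = [set 0])
  (hsp : s * p = k%:R)
  (hR0 : 0 < R0) (hdelta : forall x, Omega x -> edistance K x < R0) :
  forall tau alpha beta : R,
  alpha = d%:R + (k%:R - d%:R) * (tau / p) ->
  [\/ [/\ (k < d)%N, tau = p & beta = p],
      [/\ (k < d)%N,
          p < tau <= (d%:R * p + 1) / (1 - (k%:R - d%:R)) &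
          beta = tau - 1],
      [/\ (k < d)%N,
          (d%:R * p + 1) / (1 - (k%:R - d%:R)) < tau
            <= d%:R * p / (d%:R - s * p) &
          beta = d%:R * p + (k%:R - d%:R) * tau] |
      [/\ k = d, p <= tau & beta = tau]] ->
  (exists2 C : R, 0 < C &
    forall u, sobolev0 s p Omega K u ->
    ((\int[lebesgue_rV d]_(x in Omega)
        (`|u x| `^ tau * hardy_weight K R0 alpha beta x)%:E) `^ tau^-1
      <= C%:E * (gagliardo s p Omega u
                 + \int[lebesgue_rV d]_(x in Omega) (`|u x| `^ p)%:E) `^ p^-1)%E) /\
  (tau = p -> optimal_weight s p Omega K (hardy_weight K R0 alpha beta)).
Proof.
have /andP[s0 s1] := hs; have /andP[k1 kd] := hk; have k0 : (0 < k)%N by exact: ltnW.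
have d0 : (0 < d)%N by exact: ltnW.
have p0 : 0 < p by exact: lt_trans hp.
(* The condition s < 1 enters here. *)
have kp : k%:R < p by rewrite -hsp gtr_pMl.
have kdR : k%:R <= d%:R :> R by rewrite ler_nat.
have k1R : 1 <= k%:R :> R by rewrite ler1n.
have [K0 tK] : K !=set0 /\ tame_codim k K.
  have [kd'|] := ltnP k d.
    by have surf := hKlt kd'; split; [case: surf|exact: tame_codim_surface surf].
  move=> dk; have kdE : k = d by apply/eqP; rewrite eqn_leq kd.
  have [_ ->] := hKeq kdE; split; first by exists 0.
  by rewrite kdE; exact: tame_codim_point.
have [oO _ bO _] := hOmega.
move=> tau alpha beta alphaE cases.
have alpha_k : alpha - k%:R = (d%:R - k%:R) * (p - tau) / p.
  by rewrite alphaE; field; rewrite gt_eqF.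
(* The four cases reduce to two: alpha < k with some beta >= 0, or alpha = k with beta = tau. *)
have [ptau tkd AB] : [/\ p <= tau, tau * (d%:R - k%:R) <= d%:R * p &
    [/\ p < tau, (k < d)%N & 0 <= beta] \/ alpha = k%:R /\ beta = tau].
  have gt_alpha : tau = p -> alpha = k%:R.
    by move=> tp; apply/eqP; rewrite -subr_eq0 alpha_k tp subrr mulr0 mul0r.
  have kd1 : 0 < 1 - (k%:R - d%:R) :> R by lra.
  case: cases => [[kd' tp bp]|[kd' /andP[pt tle] bE]|[kd' /andP[tge tle] bE]|[kE pt bE]].
  - split; [by rewrite tp|rewrite tp; nra|by right; split; [exact: gt_alpha|rewrite bp]].
  (* The bound reads tau (d - k) + tau <= d p + 1, and tau > 1. *)
  - rewrite ler_pdivlMr// in tle.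
    by split; [exact: ltW|nra|left; split => //; lra].
  (* As s p = k, the upper bound on tau is tau (d - k) <= d p, which is also beta >= 0; the lower
     one exceeds p because k >= 1. *)
  - have kdR' : k%:R < d%:R :> R by rewrite ltr_nat.
    rewrite hsp ler_pdivlMr ?subr_gt0// in tle; rewrite ltr_pdivrMr// in tge.
    have pt : p < tau by nra.
    by split; [exact: ltW|lra|left; split => //; lra].
  - have kER : k%:R = d%:R :> R by rewrite kE.
    split => //; first by rewrite kER subrr mulr0 mulr_ge0// ltW.
    right; split => //; apply/eqP.
    by rewrite -subr_eq0 alpha_k kER subrr !mul0r.
have tau1 : 1 < tau by exact: lt_le_trans ptau.
split.
  have AB' : alpha < k%:R /\ 0 <= beta \/ alpha = k%:R /\ beta = tau.
    case: AB => [[pt kd' b0]|]; [left; split => //|by right].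
    have kdR' : k%:R < d%:R :> R by rewrite ltr_nat.
    rewrite -subr_lt0 alpha_k pmulr_llt0 ?invr_gt0// pmulr_rlt0 ?subr_gt0//.
    by rewrite subr_lt0.
  rewrite alphaE in AB' *.
  have k0d : (0 < k <= d)%N by rewrite k0.
  have [C C0 HC] := hardy_inequality k0d (ltW hp) ptau tau1 tkd hsp hOmega hKc K0 tK hR0 hdelta AB'.
  by exists C => // u [Hu _]; exact: HC.
move=> tp.
have [-> ->] : alpha = k%:R /\ beta = p.
  by case: AB => [[]|[-> ->]] //; rewrite tp ltxx.
exact: hardy_weight_optimal.
Qed.
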